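(* Let $\phi:\mathbb{R}^d\to[0,+\infty]$ be a finite-range, repulsive pair potential and let $\Delta_\phi$ be its potential-weighted connective constant. Then for every $\lambda\in[0,e/\Delta_\phi)$, the family of Gibbs point processes defined by $\phi$ exhibits strong spatial mixing with activities bounded by $\lambda$; that is, there exist constants $\alpha,\beta>0$ such that for every bounded measurable $\Lambda\subset\mathbb{R}^d$ and every two activity functions $\boldsymbol{\lambda},\boldsymbol{\lambda}'$ bounded by $\lambda$, $$\|\mu_{\boldsymbol{\lambda}}-\mu_{\boldsymbol{\lambda}'}\|_\Lambda\le \alpha|\Lambda|\,e^{-\beta\,\mathrm{dist}(\Lambda,\supp(\boldsymbol{\lambda}-\boldsymbol{\lambda}'))}.$$
   Context: A pair potential is a measurable $\phi:\mathbb{R}^d\to(-\infty,+\infty]$ with $\phi(x)=\phi(-x)$; it is repulsive if $\phi\ge0$ and of finite range if there is $r\ge 0$ with $\phi(x)=0$ for $\|x\|>r$. Write $H(x_1,\dots,x_k)=\sum_{i<j}\phi(x_i-x_j)$. An activity function is an integrable $\boldsymbol{\lambda}:\mathbb{R}^d\to[0,\infty)$; it is bounded by $\lambda$ if $\|\boldsymbol{\lambda}\|_\infty\le\lambda$. For $\boldsymbol{\lambda}$ with bounded support, $Z(\boldsymbol{\lambda})=1+\sum_{k\ge1}\frac1{k!}\int_{(\mathbb{R}^d)^k}\prod_i\boldsymbol{\lambda}(x_i)e^{-H(x_1,\dots,x_k)}dx$, and the Gibbs point process $\mu_{\boldsymbol{\lambda}}$ is the law on finite point sets with $\mu_{\boldsymbol{\lambda}}(A)=\sum_{k\ge0}\frac1{k!}\int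 \mathbf 1_{\{x_1,\dots,x_k\}\in A}\frac{\prod_i\boldsymbol{\lambda}(x_i)}{Z(\boldsymbol{\lambda})}e^{-H(x_1,\dots,x_k)}dx$. For $\Lambda\subset\mathbb{R}^d$, $\|\mu_{\boldsymbol{\lambda}}-\mu_{\boldsymbol{\lambda}'}\|_\Lambda=\sup_A|\mu_{\boldsymbol{\lambda}}(A_\Lambda)-\mu_{\boldsymbol{\lambda}'}(A_\Lambda)|$, the supremum over events $A$ in the $\sigma$-field of finite point sets in $\Lambda$, where $A_\Lambda=\{\eta:\eta\cap\Lambda\in A\}$; $|\Lambda|$ is Lebesgue volume and $\supp(f)=\{x:f(x)\neq0\}$. The potential-weighted connective constant is $\Delta_\phi=\lim_{k\to\infty}V_k^{1/k}=\inf_{k\ge1}V_k^{1/k}$ where, with $v_0=0$, $$V_k=\int_{(\mathbb{R}^d)^k}\prod_{j=1}^k\Big(\exp\Big(-\sum_{i=0}^{j-2}\mathbf 1_{|v_j-v_i|<|v_i-v_{i+1}|}\phi(v_j-v_i)\Big)\big(1-e^{-\phi(v_j-v_{j-1})}\big)\Big)dv_1\cdots dv_k.$$ *)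

(* Defs.v *)
From HB Require Import structures.
From mathcomp Require Import all_boot all_order all_algebra.
From mathcomp Require Import all_classical all_reals all_analysis.
From mathcomp Require Import measurable_realfun.

Set Implicit Arguments.
Unset Strict Implicit.
Unset Printing Implicit Defensive.

Import Order.TTheory GRing.Theory Num.Theory.
Local Open Scope classical_set_scope.
Local Open Scope ring_scope.

Section GibbsDefs.
Variables (R : realType) (d : nat).

(** Points of R^d are d-tuples of reals; [d.-tuple R] carries the product
    (= Borel) sigma-algebra generated by the coordinate projections. *)
Local Notation pt := (d.-tuple R).

Definition pzero : pt := [tuple of nseq d 0].
Definition psub (x y : pt) : pt := [tuple tnth x i - tnth y i | i < d].
Definition popp (x : pt) : pt := [tuple - tnth x i | i < d].

Definition enorm (x : pt) : R := Num.sqrt (\sum_(i < d) tnth x i ^+ 2).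

Local Open Scope ereal_scope.

(** Lebesgue integral on R (nonnegative, extended-real valued) iterated
    over the coordinates: by Tonelli this is the Lebesgue integral on R^n
    of a nonnegative measurable function. *)
Fixpoint intR (n : nat) : (n.-tuple R -> \bar R) -> \bar R :=
  match n with
  | 0 => fun f => f [tuple]
  | n'.+1 => fun f =>
      \int[@lebesgue_measure R]_(t in [set: R]) intR (fun y => f (cons_tuple t y))
  end.

Definition intd (f : pt -> \bar R) : \bar R := intR f.

Fixpoint intpts (k : nat) : (k.-tuple pt -> \bar R) -> \bar R :=
  match k with
  | 0 => fun f => f [tuple]
  | k'.+1 => fun f => intd (fun x => intpts (fun xs => f (cons_tuple x xs)))
  end.

Definition vol (L : set pt) : \bar R := intd (fun x => (\1_L x)%:E).

Definition pair_potential (phi : pt -> \bar R) : Prop :=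
  measurable_fun [set: pt] phi /\ forall x, phi x = phi (popp x).

Definition repulsive (phi : pt -> \bar R) : Prop := forall x, 0 <= phi x.

Definition finite_range (phi : pt -> \bar R) : Prop :=
  exists r : R, (0 <= r)%R /\ forall x, (r < enorm x)%R -> phi x = 0.

Definition Vk_integrand (phi : pt -> \bar R) (k : nat) (v : k.-tuple pt) : \bar R :=
  let w := pzero :: (v : seq pt) in
  let vv j := nth pzero w j in
  \prod_(1 <= j < k.+1)
    (expeR (- \sum_(0 <= i < j.-1)
               (if (enorm (psub (vv j) (vv i)) < enorm (psub (vv i) (vv i.+1)))%R
                then phi (psub (vv j) (vv i)) else 0))
     * (1 - expeR (- phi (psub (vv j) (vv j.-1))))).

Definition Vk (phi : pt -> \bar R) (k : nat) : \bar R := intpts (Vk_integrand phi (k := k)).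

(** Delta_phi := inf_{k >= 1} V_k^{1/k} (= lim_k V_k^{1/k}). *)
Definition connective_constant (phi : pt -> \bar R) : \bar R :=
  ereal_inf [set (Vk phi k) `^ (k%:R^-1)%R | k in [set k : nat | (0 < k)%N]].

Definition activity (lam : pt -> R) : Prop :=
  measurable_fun [set: pt] lam /\ (forall x, (0 <= lam x)%R) /\
  intd (fun x => (lam x)%:E) < +oo.

Definition bounded_support (lam : pt -> R) : Prop :=
  exists r : R, forall x, (r < enorm x)%R -> lam x = 0%R.

Definition bounded_by (lam : pt -> R) (l : R) : Prop :=
  vol [set x | (l < lam x)%R] = 0.

Definition energy (phi : pt -> \bar R) (k : nat) (x : k.-tuple pt) : \bar R :=
  \sum_(i < k) \sum_(j < k | (i < j)%N) phi (psub (tnth x i) (tnth x j)).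

Definition weight (phi : pt -> \bar R) (lam : pt -> R) (k : nat) (x : k.-tuple pt)
  : \bar R :=
  (\prod_(i < k) lam (tnth x i))%:E * expeR (- energy phi x).

Definition partition_fn (phi : pt -> \bar R) (lam : pt -> R) : \bar R :=
  1 + \sum_(1 <= k <oo) ((k`!%:R)^-1)%:E * intpts (weight phi lam (k := k)).

(** A finite point configuration is a (finite) subset of R^d;
    the configuration {x_1,...,x_k} of a k-tuple of points. *)
Definition tset (k : nat) (x : k.-tuple pt) : set pt := [set tnth x i | i in [set: 'I_k]].

Definition config_event (A : set (set pt)) : Prop :=
  forall k : nat, measurable [set x : k.-tuple pt | A (tset x)].

Definition gibbs (phi : pt -> \bar R) (lam : pt -> R) (E : set (set pt)) : \bar R :=
  \sum_(0 <= k <oo) ((k`!%:R)^-1)%:E *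
     intpts (fun x : k.-tuple pt =>
               (\1_E (tset x))%:E * weight phi lam x / partition_fn phi lam).

Definition restr_event (L : set pt) (A : set (set pt)) : set (set pt) :=
  [set eta | A (eta `&` L)].

Definition tv_dist_on (phi : pt -> \bar R) (lam lam' : pt -> R) (L : set pt) : \bar R :=
  ereal_sup [set `|gibbs phi lam (restr_event L A) - gibbs phi lam' (restr_event L A)|
            | A in [set A | config_event A /\ A `<=` [set eta | eta `<=` L]]].

Definition supp_fn (f : pt -> R) : set pt := [set x | f x != 0%R].

(** Euclidean distance between two sets (+oo if one is empty). *)
Definition set_dist (A B : set pt) : \bar R :=
  ereal_inf [set (enorm (psub x y))%:E | x in A & y in B].

Definition bounded_pts (L : set pt) : Prop := exists r : R, forall x, L x -> (enorm x <= r)%R.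

End GibbsDefs.

(* Main.v *)
(** The insertion ratio [rho L v = Z(L f_v) / Z(L)], with [f_v x = exp(-phi(x-v))],
    satisfies the recursion
      [rho L v = exp(- int (1 - f_v w) L(w) rho (L_{v->w}) w dw)],
    where [L_{v->w}] is [L f_v] inside the ball of radius [|w - v|] around [v]
    and [L] outside.  It follows by switching on the factor [f_v] in thin
    spherical shells; on each shell [Z] is expanded to first order, the second
    order terms disappearing as the shells get thinner.

    Since [e^{-x^2/2}] is [e^{-1/2}]-Lipschitz, the reverse triangle inequality
    in L^2 turns the recursion into a contraction for
    [(sqrt (rho L v) - sqrt (rho L' v))^2] with constant [lam / e] per step, and
    [k] steps produce exactly the integral [V_k].  As [(lam / e)^k V_k < 1] for
    some [k], the influence of a change of activity at distance [D] on [rho]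
    decays exponentially in [D].

    For the total variation distance on [Lambda], cut [Lambda] into [N] slices of
    equal volume and explore them one after the other.  Up to errors of order
    [N^{-2}], a slice contains at most one point, with density given by [rho], so
    the distance is at most [2 |Lambda|] times the uniform error on the
    densities. *)

Require Import Defs.
From HB Require Import structures.
From mathcomp Require Import all_boot all_order all_algebra.
From mathcomp Require Import all_classical all_reals all_analysis.
From mathcomp Require Import measurable_realfun ring lra.
Import Order.TTheory GRing.Theory Num.Theory numFieldNormedType.Exports.
Local Open Scope classical_set_scope.
Local Open Scope ring_scope.

Set Implicit Arguments.
Unset Strict Implicit.
Unset Printing Implicit Defensive.

(** * Measurable functions of finite sequences *)

(** The square roots are forced by the recursion: it reads [rho = e^{-s}] with [s] linear in the
    ratios one step further, so [u = sqrt s] is the L^2 norm of their square roots and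
    [sqrt rho = e^{-u^2/2}]. Comparing the [rho] directly, with slope at most 1, would only reach
    the threshold [1/Delta]. The two norms live in the same space only if the activities coincide
    within the range of the potential. Every step therefore consumes one range of the distance up to
    which they agree, and the decay is exponential in that distance. For the total variation
    distance, events depend on all points in Lambda at once, and the exploration keeps changing the
    activity: by 0 on an explored slice, by [f x] for a point found at [x]. Hence closeness of
    densities is demanded for all common factors with values in [0,1], and the comparison on one
    slice has to return the error of the other slices with coefficient 1, so that errors add up
    instead of multiplying. Both slicings need null spheres, which make distribution functions
    continuous and pieces of equal mass available. This fails in R^0, which is treated apart. *)

Section seq_measurability.
Context {dT : measure_display} {T : measurableType dT}.

(** [mseq k H] says that [(p, x_1, .., x_k) |-> H p [:: x_1; ..; x_k]] is measurable. *)
Fixpoint mseq {dU} {U : measurableType dU} k {dP} {P : measurableType dP}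
    (H : P -> seq T -> U) : Prop :=
  match k with
  | 0 => measurable_fun [set: P] (fun p => H p [::])
  | k'.+1 => mseq k' (fun (px : P * T) s => H px.1 (px.2 :: s))
  end.

Definition cmeas {dU} {U : measurableType dU} {dP} {P : measurableType dP}
  (H : P -> seq T -> U) := forall k, mseq k H.

Lemma mseq_reparam dU (U : measurableType dU) k dP (P : measurableType dP)
    dQ (Q : measurableType dQ) (H : P -> seq T -> U) (a : Q -> P) :
  measurable_fun setT a -> mseq k H -> mseq k (fun q => H (a q)).
Proof.
elim: k dP P dQ Q H a => [|k IH] dP P dQ Q H a ma /= mH.
  by apply: (measurableT_comp mH ma).
pose b (x : Q * T) := (a x.1, x.2).
apply: (IH _ _ _ _ (fun (px : P * T) s => H px.1 (px.2 :: s)) b _ mH).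
apply: measurable_fun_pair => //.
exact: measurableT_comp.
Qed.

Lemma cmeas_reparam dU (U : measurableType dU) dP (P : measurableType dP)
    dQ (Q : measurableType dQ) (H : P -> seq T -> U) (a : Q -> P) :
  measurable_fun setT a -> cmeas H -> cmeas (fun q => H (a q)).
Proof. by move=> ma mH k; apply: mseq_reparam. Qed.

Lemma cmeas_cons dU (U : measurableType dU) dP (P : measurableType dP)
    dQ (Q : measurableType dQ) (H : P -> seq T -> U) (a : Q -> P) (b : Q -> T) :
  measurable_fun setT a -> measurable_fun setT b ->
  cmeas H -> cmeas (fun q s => H (a q) (b q :: s)).
Proof.
move=> ma mb mH k.
apply: (@mseq_reparam _ _ k _ _ _ _
  (fun (px : P * T) s => H px.1 (px.2 :: s)) (fun q => (a q, b q))).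
  exact: measurable_fun_pair.
exact: (mH k.+1).
Qed.

Lemma mseq_comp dU (U : measurableType dU) dV (V : measurableType dV) k
    dP (P : measurableType dP) (H : P -> seq T -> U) (g : U -> V) :
  measurable_fun setT g -> mseq k H -> mseq k (fun p s => g (H p s)).
Proof.
move=> mg; elim: k dP P H => [|k IH] dP P H /= mH; first exact: measurableT_comp.
exact: IH.
Qed.

Lemma mseq_pair dU (U : measurableType dU) dV (V : measurableType dV) k
    dP (P : measurableType dP) (H : P -> seq T -> U) (K : P -> seq T -> V) :
  mseq k H -> mseq k K -> mseq k (fun p s => (H p s, K p s)).
Proof.
elim: k dP P H K => [|k IH] dP P H K /= mH mK.
  exact: measurable_fun_pair.
exact: IH.
Qed.

Lemma mseq_param dU (U : measurableType dU) k dP (P : measurableType dP)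
    (g : P -> U) : measurable_fun setT g -> mseq k (fun p _ => g p).
Proof.
elim: k dP P g => [//|k IH] dP P g mg /=.
apply: IH. exact: measurableT_comp.
Qed.

Lemma cmeas_ext dU (U : measurableType dU) dP (P : measurableType dP)
    (H K : P -> seq T -> U) : (forall p s, H p s = K p s) -> cmeas H -> cmeas K.
Proof. by move=> HK; rewrite (_ : H = K)//; apply/funext => p; apply/funext. Qed.

Context {R : realType}.

Lemma mseqM k dP (P : measurableType dP) (H K : P -> seq T -> R) :
  mseq k H -> mseq k K -> mseq k (fun p s => H p s * K p s).
Proof.
move=> mH mK.
apply: (mseq_comp (g := fun x : R * R => x.1 * x.2)) (mseq_pair mH mK).
exact: measurable_funM.
Qed.

Lemma mseqD k dP (P : measurableType dP) (H K : P -> seq T -> R) :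
  mseq k H -> mseq k K -> mseq k (fun p s => H p s + K p s).
Proof.
move=> mH mK.
apply: (mseq_comp (g := fun x : R * R => x.1 + x.2)) (mseq_pair mH mK).
exact: measurable_funD.
Qed.

Lemma mseqB k dP (P : measurableType dP) (H K : P -> seq T -> R) :
  mseq k H -> mseq k K -> mseq k (fun p s => H p s - K p s).
Proof.
move=> mH mK.
apply: (mseq_comp (g := fun x : R * R => x.1 - x.2)) (mseq_pair mH mK).
exact: measurable_funB.
Qed.

Lemma cmeasM dP (P : measurableType dP) (H K : P -> seq T -> R) :
  cmeas H -> cmeas K -> cmeas (fun p s => H p s * K p s).
Proof. by move=> mH mK k; apply: mseqM. Qed.

Lemma cmeasB dP (P : measurableType dP) (H K : P -> seq T -> R) :
  cmeas H -> cmeas K -> cmeas (fun p s => H p s - K p s).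
Proof. by move=> mH mK k; apply: mseqB. Qed.

Lemma cmeas_param dU (U : measurableType dU) dP (P : measurableType dP)
    (g : P -> U) : measurable_fun setT g -> cmeas (fun p _ => g p).
Proof. by move=> mg k; apply: mseq_param. Qed.

Lemma cmeas_prod dP (P : measurableType dP) (L : P -> T -> R) :
  measurable_fun setT (fun px : P * T => L px.1 px.2) ->
  cmeas (fun p s => \prod_(x <- s) L p x).
Proof.
move=> mL k; elim: k dP P L mL => [|k IH] dP P L mL /=.
  by under eq_fun do rewrite big_nil; exact: measurable_cst.
under eq_fun do under eq_fun do rewrite big_cons.
apply: mseqM; first exact: mseq_param.
apply: (IH _ _ (fun (px : P * T) => L px.1)).
pose a (z : P * T * T) := (z.1.1, z.2).
have /(measurableT_comp mL) : measurable_fun setT a; last by [].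
by apply: measurable_fun_pair => //; exact: measurableT_comp.
Qed.

(** [extract_sum h s] sums [h x t] over all ways of extracting one point [x] from [s],
    [t] being the remaining points. *)
Fixpoint extract_sum (h : T -> seq T -> R) (s : seq T) : R :=
  match s with
  | [::] => 0
  | x :: t => h x t + extract_sum (fun y u => h y (x :: u)) t
  end.

Lemma cmeas_Sh dP (P : measurableType dP) (h : P -> T -> seq T -> R) :
  cmeas (fun (px : P * T) s => h px.1 px.2 s) -> cmeas (fun p s => extract_sum (h p) s).
Proof.
move=> mh k; elim: k dP P h mh => [|k IH] dP P h mh /=.
  exact: measurable_cst.
apply: mseqD; first exact: mh.
apply: (IH _ _ (fun (px : P * T) y u => h px.1 y (px.2 :: u))).
apply: (cmeas_cons (a := fun z : P * T * T => (z.1.1, z.2))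
  (b := fun z : P * T * T => z.1.2) _ _ mh).
- by apply: measurable_fun_pair => //; exact: measurableT_comp.
- exact: measurableT_comp.
Qed.

Lemma Sh_ge0 (h : T -> seq T -> R) s :
  (forall x t, 0 <= h x t) -> 0 <= extract_sum h s.
Proof.
elim: s h => [//|x s IH] h h0 /=; apply: addr_ge0 => //.
exact: IH.
Qed.

Definition sym (G : seq T -> R) :=
  forall s x y t, G (s ++ x :: y :: t) = G (s ++ y :: x :: t).

Lemma sym_cons G x : sym G -> sym (fun s => G (x :: s)).
Proof. by move=> sG s y z t; exact: (sG (x :: s)). Qed.

(** A symmetric [G] takes the value [G s] whichever point is brought to the front, so it factors out
    of the sum. *)
Lemma Sh_sym G (c : T -> seq T -> R) s : sym G ->
  extract_sum (fun x t => G (x :: t) * c x t) s = G s * extract_sum c s.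
Proof.
elim: s G c => [|x s IH] G c sG /=; first by rewrite mulr0.
rewrite mulrDr; congr (_ + _).
rewrite -(IH (fun u => G (x :: u)) (fun y u => c y (x :: u)) (@sym_cons _ x sG)).
congr (extract_sum _ s); apply/funext => y; apply/funext => t.
by rewrite (sG [::]).
Qed.

(** Both bounds bracket [1 - \prod q]; they differ at second order in [1 - q]. *)
Lemma Sh_prod_le (q : T -> R) s : (forall x, 0 <= q x <= 1) ->
  extract_sum (fun x t => (1 - q x) * \prod_(y <- t) q y) s <= 1 - \prod_(y <- s) q y.
Proof.
move=> q01.
have p0 t : 0 <= \prod_(y <- t) q y by apply: prodr_ge0 => y _; case/andP: (q01 y).
have mulSh (c : R) h t : extract_sum (fun y u => c * h y u) t = c * extract_sum h t.
  by elim: t h => [|y t IH] h /=; rewrite ?mulr0// IH mulrDr.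
elim: s => [|x s IH] /=; first by rewrite big_nil subrr.
rewrite big_cons.
have -> : extract_sum (fun y u => (1 - q y) * \prod_(j <- x :: u) q j) s =
    q x * extract_sum (fun y u => (1 - q y) * \prod_(j <- u) q j) s.
  rewrite -mulSh; congr (extract_sum _ s); apply/funext => y; apply/funext => u.
  by rewrite big_cons mulrCA.
case/andP: (q01 x) => q0 q1.
apply: (@le_trans _ _ ((1 - q x) * \prod_(y <- s) q y + q x * (1 - \prod_(y <- s) q y))).
  by rewrite lerD2l ler_wpM2l.
have p1 : \prod_(y <- s) q y <= 1.
  by elim: (s) => [|y t IHt]; rewrite ?big_nil// big_cons mulr_ile1//; case/andP: (q01 y).
(* With [p] the product over [s], the difference of the two sides is [(1 - q x) (1 - p)]. *)
nra.
Qed.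

Lemma Sh_prod_ge (q : T -> R) s : (forall x, 0 <= q x <= 1) ->
  1 - \prod_(y <- s) q y <= extract_sum (fun x _ => 1 - q x) s.
Proof.
move=> q01; elim: s => [|x s IH] /=; first by rewrite big_nil subrr.
rewrite big_cons; apply: (le_trans _ (lerD (lexx _) IH)).
have p1 : 0 <= \prod_(y <- s) q y <= 1.
  elim: (s) => [|y t IHt]; rewrite ?big_nil ?ler01 ?lexx// big_cons.
  case/andP: (q01 y) => ? ?; case/andP: IHt => ? ?.
  by rewrite mulr_ge0// mulr_ile1.
case/andP: (q01 x) => q0 q1; case/andP: p1 => *; nra.
Qed.

End seq_measurability.

(** * Iterated integrals and sums over configurations *)

Lemma measurable_fun_sec d1 d2 d3 (P : measurableType d1) (T : measurableType d2)
    (U : measurableType d3) (F : P * T -> U) p :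
  measurable_fun setT F -> measurable_fun setT (fun x => F (p, x)).
Proof. by move=> mF; exact: (measurableT_comp mF (pair1_measurable p)). Qed.

Section iterated_integrals.
Context {dT : measure_display} {T : measurableType dT} {R : realType}.
Variable mu : {sigma_finite_measure set T -> \bar R}.

Fixpoint iint k (G : seq T -> R) : \bar R :=
  match k with
  | 0 => (G [::])%:E
  | k'.+1 => (\int[mu]_x iint k' (fun s => G (x :: s)))%E
  end.

Lemma iint_ge0 k G : (forall s, 0 <= G s) -> (0 <= iint k G)%E.
Proof.
elim: k G => [|k IH] G G0 /=; first by rewrite lee_fin.
by apply: integral_ge0 => x _; apply: IH.
Qed.

Lemma eq_iint k G H : G =1 H -> iint k G = iint k H.
Proof. by move=> GH; congr iint; apply/funext. Qed.

(** By Tonelli. The parameter [p] is carried through this section because peeling off the first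
    point makes it part of the parameter: inductions on [k] only close over all parameter spaces. *)
Lemma measurable_iint k dP (P : measurableType dP) (H : P -> seq T -> R) :
  (forall p s, 0 <= H p s) -> mseq k H ->
  measurable_fun setT (fun p => iint k (H p)).
Proof.
elim: k dP P H => [|k IH] dP P H H0 /= mH; first exact/measurable_EFinP.
apply: (@measurable_fun_fubini_tonelli_F _ _ P T R mu
  (fun px : P * T => iint k (fun s => H px.1 (px.2 :: s)))).
  by apply: IH mH => p s; exact: H0.
by move=> px; exact: iint_ge0.
Qed.

Lemma measurable_iint_cons k dP (P : measurableType dP) (H : P -> seq T -> R) p :
  (forall p s, 0 <= H p s) -> mseq k.+1 H ->
  measurable_fun setT (fun x => iint k (fun s => H p (x :: s))).
Proof.
move=> H0 mH.
have /= m := @measurable_iint k _ _ (fun (px : P * T) s => H px.1 (px.2 :: s))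
  (fun px s => H0 _ _) mH.
exact: (measurable_fun_sec p m).
Qed.

Lemma iintD k dP (P : measurableType dP) (H K : P -> seq T -> R) p :
  (forall p s, 0 <= H p s) -> (forall p s, 0 <= K p s) ->
  mseq k H -> mseq k K ->
  iint k (fun s => H p s + K p s) = (iint k (H p) + iint k (K p))%E.
Proof.
elim: k dP P H K p => [|k IH] dP P H K p H0 K0 mH mK /=; first by rewrite EFinD.
under eq_integral do rewrite (IH _ _ _ _ (p, _) _ _ mH mK)//=.
rewrite ge0_integralD//.
- by move=> x _; exact: iint_ge0.
- exact: measurable_iint_cons mH.
- by move=> x _; exact: iint_ge0.
- exact: measurable_iint_cons mK.
Qed.

Lemma iintZl k dP (P : measurableType dP) (H : P -> seq T -> R) (c : R) p :
  0 <= c -> (forall p s, 0 <= H p s) -> mseq k H ->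
  iint k (fun s => c * H p s) = (c%:E * iint k (H p))%E.
Proof.
move=> c0.
elim: k dP P H p => [|k IH] dP P H p H0 mH /=; first by rewrite EFinM.
under eq_integral do rewrite (IH _ _ _ (p, _) _ mH)//=.
rewrite ge0_integralZl//.
- exact: measurable_iint_cons mH.
- by move=> x _; exact: iint_ge0.
Qed.

Lemma le_iint k dP (P : measurableType dP) (H K : P -> seq T -> R) p :
  (forall p s, 0 <= H p s) -> (forall p s, 0 <= K p s) ->
  mseq k H -> mseq k K -> (forall s, H p s <= K p s) ->
  (iint k (H p) <= iint k (K p))%E.
Proof.
elim: k dP P H K p => [|k IH] dP P H K p H0 K0 mH mK HK /=; first by rewrite lee_fin.
apply: ge0_le_integral => //.
- by move=> x _; exact: iint_ge0.
- exact: measurable_iint_cons mH.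
- exact: measurable_iint_cons mK.
- move=> x _; exact: (IH _ _ (fun (px : P * T) s => H px.1 (px.2 :: s))
    (fun (px : P * T) s => K px.1 (px.2 :: s)) (p, x)).
Qed.

(** By Tonelli every one of the [k + 1] positions of the extracted point contributes the same
    integral. *)
Lemma iint_Sh k dP (P : measurableType dP) (h : P -> T -> seq T -> R) p :
  (forall p x s, 0 <= h p x s) ->
  cmeas (fun (px : P * T) s => h px.1 px.2 s) ->
  iint k.+1 (extract_sum (h p)) = ((k.+1)%:R%:E * \int[mu]_x iint k (h p x))%E.
Proof.
elim: k dP P h p => [|k IH] dP P h p h0 mh.
  by rewrite mul1e /=; apply: eq_integral => x _; rewrite addr0.
pose hx (px : P * T) y u := h px.1 y (px.2 :: u).
have mhx : cmeas (fun (pxy : P * T * T) s => hx pxy.1 pxy.2 s).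
  apply: (cmeas_cons (a := fun z : P * T * T => (z.1.1, z.2))
    (b := fun z : P * T * T => z.1.2) _ _ mh).
  - by apply: measurable_fun_pair => //; exact: measurableT_comp.
  - exact: measurableT_comp.
have step x : iint k.+1 (fun s => extract_sum (h p) (x :: s)) =
    (iint k.+1 (h p x) + (k.+1)%:R%:E * \int[mu]_y iint k (fun u => h p y (x :: u)))%E.
  have := @iintD k.+1 _ _ (fun (px : P * T) s => h px.1 px.2 s)
    (fun px => extract_sum (hx px)) (p, x) (fun _ _ => h0 _ _ _)
    (fun _ _ => Sh_ge0 _ (fun _ _ => h0 _ _ _)) (mh k.+1) (cmeas_Sh mhx k.+1).
  by rewrite (IH _ _ hx (p, x) (fun _ _ _ => h0 _ _ _) mhx) => ->.
transitivity (\int[mu]_x (iint k.+1 (h p x) +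
    (k.+1)%:R%:E * \int[mu]_y iint k (fun u => h p y (x :: u))))%E.
  by apply: eq_integral => x _; exact: step.
have m3 : measurable_fun setT (fun z : P * T * T => iint k (fun u => h z.1.1 z.2 (z.1.2 :: u))).
  by apply: (@measurable_iint k _ _ (fun (pxy : P * T * T) s => hx pxy.1 pxy.2 s) _ (mhx k)) => *; exact: h0.
have m2 : measurable_fun setT (fun z : T * T => iint k (fun u => h p z.2 (z.1 :: u))).
  have a : measurable_fun setT (fun z : T * T => ((p, z.1), z.2)).
    by apply: measurable_fun_pair => //; apply: measurable_fun_pair => //; exact: measurable_cst.
  exact: (measurableT_comp m3 a).
have m1 : measurable_fun setT (fun x => iint k.+1 (h p x)).
  have := @measurable_iint k.+1 _ _ (fun (px : P * T) s => h px.1 px.2 s)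
    (fun _ _ => h0 _ _ _) (mh k.+1).
  by move/measurable_fun_sec => /(_ p).
have mF : measurable_fun setT (fun x => (\int[mu]_y iint k (fun u => h p y (x :: u)))%E).
  apply: (@measurable_fun_fubini_tonelli_F _ _ T T R mu
    (fun z : T * T => iint k (fun u => h p z.2 (z.1 :: u)))) => //.
  by move=> z; exact: iint_ge0.
rewrite ge0_integralD//.
- rewrite ge0_integralZl//; last first.
    by move=> x _; apply: integral_ge0 => y _; exact: iint_ge0.
  rewrite (@fubini_tonelli _ _ T T R mu mu
    (fun z : T * T => iint k (fun u => h p z.2 (z.1 :: u))))//; last first.
    by move=> z; exact: iint_ge0.
  rewrite -[in RHS]natr1 EFinD addeC ge0_muleDl//.
  by rewrite mul1e.
- by move=> x _; exact: iint_ge0.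
- by move=> x _; apply: mule_ge0 => //; apply: integral_ge0 => y _; exact: iint_ge0.
- exact: measurable_funeM.
Qed.

(** Integral against the Lebesgue-Poisson measure with intensity [mu]; the factorials make up for
    the ordering of the points. *)
Definition gsum (G : seq T -> R) : \bar R :=
  (\sum_(0 <= k <oo) (k`!%:R^-1)%:E * iint k G)%E.

Let term_ge0 k G : (forall s, 0 <= G s) -> (0 <= (k`!%:R^-1)%:E * iint k G)%E.
Proof.
by move=> G0; apply: mule_ge0; rewrite ?lee_fin ?invr_ge0// iint_ge0.
Qed.

Lemma gsum_ge0 G : (forall s, 0 <= G s) -> (0 <= gsum G)%E.
Proof. by move=> G0; apply: nneseries_ge0 => k _ _; exact: term_ge0. Qed.

Lemma measurable_gsum dP (P : measurableType dP) (H : P -> seq T -> R) :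
  (forall p s, 0 <= H p s) -> cmeas H ->
  measurable_fun setT (fun p => gsum (H p)).
Proof.
move=> H0 mH; apply: ge0_emeasurable_sum.
- by move=> k p _ _; exact: term_ge0.
- by move=> k _; apply: measurable_funeM; exact: measurable_iint (mH k).
Qed.

Lemma gsumD dP (P : measurableType dP) (H K : P -> seq T -> R) p :
  (forall p s, 0 <= H p s) -> (forall p s, 0 <= K p s) ->
  cmeas H -> cmeas K ->
  gsum (fun s => H p s + K p s) = (gsum (H p) + gsum (K p))%E.
Proof.
move=> H0 K0 mH mK; rewrite /gsum -nneseriesD; last 2 first.
- by move=> k _ _; exact: term_ge0.
- by move=> k _ _; exact: term_ge0.
apply: eq_eseriesr => k _.
by rewrite (iintD _ H0 K0 (mH k) (mK k)) ge0_muleDr// iint_ge0.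
Qed.

Lemma gsumZl dP (P : measurableType dP) (H : P -> seq T -> R) (c : R) p :
  0 <= c -> (forall p s, 0 <= H p s) -> cmeas H ->
  gsum (fun s => c * H p s) = (c%:E * gsum (H p))%E.
Proof.
move=> c0 H0 mH; rewrite /gsum -nneseriesZl; last first.
  by move=> k _; exact: term_ge0.
by apply: eq_eseriesr => k _; rewrite (iintZl _ c0 H0 (mH k)) muleCA.
Qed.

Lemma le_gsum dP (P : measurableType dP) (H K : P -> seq T -> R) p :
  (forall p s, 0 <= H p s) -> (forall p s, 0 <= K p s) ->
  cmeas H -> cmeas K -> (forall s, H p s <= K p s) ->
  (gsum (H p) <= gsum (K p))%E.
Proof.
move=> H0 K0 mH mK HK; apply: lee_nneseries => [k _ _|k _]; first exact: term_ge0.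
by apply: lee_wpmul2l; rewrite ?lee_fin ?invr_ge0//; exact: (le_iint H0 K0).
Qed.

(** The Mecke formula: the factor [k + 1] of [iint_Sh] turns [1/(k+1)!] into [1/k!], and the term of
    the empty configuration vanishes. It is the source of every first-order expansion below. *)
Lemma gsum_Sh dP (P : measurableType dP) (h : P -> T -> seq T -> R) p :
  (forall p x s, 0 <= h p x s) ->
  cmeas (fun (px : P * T) s => h px.1 px.2 s) ->
  gsum (extract_sum (h p)) = (\int[mu]_x gsum (h p x))%E.
Proof.
move=> h0 mh; rewrite /gsum integral_nneseries//; last 2 first.
- move=> k; apply: measurable_funeM.
  have := @measurable_iint k _ _ (fun (px : P * T) s => h px.1 px.2 s)
    (fun _ _ => h0 _ _ _) (mh k).
  by move/measurable_fun_sec => /(_ p).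
- by move=> k x _; exact: term_ge0.
rewrite nneseries_recl//; last first.
  by move=> k _; apply: term_ge0 => s; exact: Sh_ge0.
rewrite /= mule0 add0e -(@nneseries_addn _ _ 1); last first.
  by move=> k; apply: term_ge0 => s; exact: Sh_ge0.
apply: eq_eseriesr => k _; rewrite addn1 iint_Sh// muleA -EFinM.
have -> : (k.+1`!%:R^-1 * k.+1%:R = k`!%:R^-1 :> R)%R.
  by rewrite factS natrM invfM mulrAC mulVf ?mul1r// pnatr_eq0.
rewrite ge0_integralZl//.
- have := @measurable_iint k _ _ (fun (px : P * T) s => h px.1 px.2 s)
    (fun _ _ => h0 _ _ _) (mh k).
  by move/measurable_fun_sec => /(_ p).
- by move=> x _; exact: iint_ge0.
Qed.

(** The partition function of the ideal gas is the exponential series at the integral of [L]; it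
    dominates all sums with interaction. *)
Lemma gsum_prod_lty (L : T -> R) : (forall x, 0 <= L x) ->
  measurable_fun setT L -> (\int[mu]_x (L x)%:E < +oo)%E ->
  (gsum (fun s => (\prod_(x <- s) L x)%R) < +oo)%E.
Proof.
move=> L0 mL Ly.
have [r [r0 rE]] : exists r : R, 0 <= r /\ (\int[mu]_x (L x)%:E = r%:E)%E.
  exists (fine (\int[mu]_x (L x)%:E)%E); split.
    by apply: fine_ge0; apply: integral_ge0 => x _; rewrite lee_fin.
  rewrite fineK// ge0_fin_numE//; apply: integral_ge0 => x _; rewrite lee_fin//.
have p0 s : 0 <= \prod_(x <- s) L x by exact: prodr_ge0.
have mp : cmeas (fun (_ : T) s => \prod_(x <- s) L x).
  by apply: (cmeas_prod (L := fun _ => L)); exact: measurableT_comp.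
have it k : iint k (fun s => \prod_(x <- s) L x) = (r ^+ k)%:E.
  elim: k => [|k IH] /=; first by rewrite big_nil.
  transitivity (\int[mu]_x ((r ^+ k)%:E * (L x)%:E))%E.
    apply: eq_integral => x _; rewrite -IH muleC.
    rewrite -(@iintZl k _ _ (fun (_ : T) s => \prod_(x <- s) L x) (L x) x (L0 x) (fun _ => p0) (mp k)).
    by apply: eq_iint => s; rewrite big_cons.
  rewrite ge0_integralZl//.
  - by rewrite rE exprSr EFinM.
  - exact/measurable_EFinP.
  - by move=> x _; rewrite lee_fin.
  - by rewrite lee_fin exprn_ge0.
rewrite /gsum; under eq_eseriesr do rewrite it -EFinM mulrC.
have -> : (fun n => \sum_(0 <= k < n) (r ^+ k * k`!%:R^-1)%:E)%E =
    EFin \o series (exp_coeff r).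
  by apply/funext => n; rewrite /series /= sumEFin.
rewrite EFin_lim ?ltry//; exact: is_cvg_series_exp_coeff.
Qed.

End iterated_integrals.

(** * Gibbs weights *)

Section gibbs_model.
Context {dT : measure_display} {T : measurableType dT} {R : realType}.
Variable mu : {sigma_finite_measure set T -> \bar R}.
Variable f : T -> T -> R.
Hypothesis mf : measurable_fun setT (fun z : T * T => f z.1 z.2).
Hypothesis f01 : forall x y, 0 <= f x y <= 1.
Hypothesis fC : forall x y, f x y = f y x.

(** The pair factor [f] stands for [e^{-phi}], so that a hard core [phi = +oo] is the real value
    [f = 0] and all weights stay real. *)
Fixpoint boltz (s : seq T) : R :=
  match s with
  | [::] => 1
  | x :: t => \prod_(y <- t) f x y * boltz t
  end.

Lemma prod_ge0 (L : T -> R) s : (forall x, 0 <= L x) -> 0 <= \prod_(x <- s) L x.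
Proof. by move=> L0; exact: prodr_ge0. Qed.

Lemma prod01 (L : T -> R) s : (forall x, 0 <= L x <= 1) -> 0 <= \prod_(x <- s) L x <= 1.
Proof.
move=> L01; elim: s => [|x s IH]; first by rewrite big_nil ler01 lexx.
rewrite big_cons; case/andP: IH => a b; case/andP: (L01 x) => c d.
by rewrite mulr_ge0//= mulr_ile1.
Qed.

Lemma boltz01 s : 0 <= boltz s <= 1.
Proof.
elim: s => [|x s IH] /=; first by rewrite ler01 lexx.
case/andP: IH => a b; case/andP: (prod01 s (f01 x)) => c d.
by rewrite mulr_ge0//= mulr_ile1.
Qed.

Lemma sym_prod (L : T -> R) : sym (fun s => \prod_(x <- s) L x).
Proof. by move=> s x y t; rewrite !big_cat/= !big_cons; ring. Qed.

Lemma sym_boltz : sym boltz.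
Proof.
move=> s x y t; elim: s => [|z s IH] /=; last by rewrite IH sym_prod.
by rewrite !big_cons fC; ring.
Qed.

Lemma symM (G H : seq T -> R) : sym G -> sym H -> sym (fun s => G s * H s).
Proof. by move=> sG sH s x y t; rewrite sG sH. Qed.

Lemma cmeas_boltz dP (P : measurableType dP) : cmeas (fun (_ : P) => boltz).
Proof.
move=> k; elim: k dP P => [|k IH] dP P /=; first exact: measurable_cst.
apply: mseqM; last exact: IH.
apply: (cmeas_prod (L := fun px : P * T => f px.2)).
have a : measurable_fun setT (fun z : P * T * T => (z.1.2, z.2)).
  by apply: measurable_fun_pair => //; exact: measurableT_comp.
exact: (measurableT_comp mf a).
Qed.

Definition wt (L : T -> R) s := \prod_(x <- s) L x * boltz s.

(** Fixing a point at [x] amounts to multiplying the activity of the others by [f x]. This is why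
    conditioning never leaves the class of models with the same [f]. *)
Lemma wt_cons L x s : wt L (x :: s) = L x * wt (L \* f x) s.
Proof. by rewrite /wt /= big_cons big_split /=; ring. Qed.

Lemma wtM L q s : wt (L \* q) s = wt L s * \prod_(x <- s) q x.
Proof. by rewrite /wt big_split/= mulrAC. Qed.

Lemma wt_ge0 L s : (forall x, 0 <= L x) -> 0 <= wt L s.
Proof. by move=> L0; apply: mulr_ge0; [exact: prod_ge0|case/andP: (boltz01 s)]. Qed.

Definition jmeas dP (P : measurableType dP) (L : P -> T -> R) :=
  measurable_fun setT (fun z : P * T => L z.1 z.2).

Lemma cmeas_wt dP (P : measurableType dP) (L : P -> T -> R) :
  jmeas L -> cmeas (fun p => wt (L p)).
Proof. by move=> mL; apply: cmeasM; [exact: cmeas_prod|exact: cmeas_boltz]. Qed.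

Lemma jmeasM dP (P : measurableType dP) (L K : P -> T -> R) :
  jmeas L -> jmeas K -> jmeas (fun p => L p \* K p).
Proof. by move=> mL mK; exact: measurable_funM. Qed.

Lemma jmeas_cst dP (P : measurableType dP) (L : T -> R) :
  measurable_fun setT L -> jmeas (fun _ : P => L).
Proof. by move=> mL; exact: measurableT_comp. Qed.

Lemma jmeas_reparam dP (P : measurableType dP) dQ (Q : measurableType dQ)
    (L : P -> T -> R) (a : Q -> P) :
  measurable_fun setT a -> jmeas L -> jmeas (fun q => L (a q)).
Proof.
move=> ma mL.
have b : measurable_fun setT (fun z : Q * T => (a z.1, z.2)).
  by apply: measurable_fun_pair => //; exact: measurableT_comp.
exact: (measurableT_comp mL b).
Qed.

Definition nnintegrable (L : T -> R) := [/\ measurable_fun setT L, forall x, 0 <= L x &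
  (\int[mu]_x (L x)%:E < +oo)%E].

(** Activities are modified by multiplication with such functions only: pair factors, indicators,
    dampings, truncation. The class is closed under products and preserves integrability. *)
Definition frac (q : T -> R) := measurable_fun setT q /\ forall x, 0 <= q x <= 1.

Lemma frac_f x : frac (f x).
Proof. by split; [exact: (measurable_fun_sec x mf)|]. Qed.

Lemma fracM q r : frac q -> frac r -> frac (q \* r).
Proof.
move=> [mq q01] [mr r01]; split; first exact: measurable_funM.
move=> x; case/andP: (q01 x) => ? ?; case/andP: (r01 x) => ? ?.
by rewrite mulr_ge0//= mulr_ile1.
Qed.

Lemma le_act (L K : T -> R) : nnintegrable L -> measurable_fun setT K -> (forall x, 0 <= K x <= L x) -> nnintegrable K.
Proof.
move=> [mL L0 Ly] mK K01; split => //; first by move=> x; case/andP: (K01 x).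
apply: le_lt_trans Ly; apply: ge0_le_integral => //.
- by move=> x _; rewrite lee_fin; case/andP: (K01 x).
- exact/measurable_EFinP.
- exact/measurable_EFinP.
- by move=> x _; rewrite lee_fin; case/andP: (K01 x).
Qed.

Lemma actM L q : nnintegrable L -> frac q -> nnintegrable (L \* q).
Proof.
move=> aL [mq q01]; apply: (le_act aL).
  by apply: measurable_funM => //; case: aL.
case: aL => _ L0 _ x; case/andP: (q01 x) => ? ?.
by rewrite mulr_ge0//= ler_piMr.
Qed.

Definition obs (g : seq T -> R) :=
  [/\ cmeas (fun _ : unit => g), sym g & forall s, 0 <= g s <= 1].

Lemma obs1 : obs (fun _ => 1).
Proof. by split => //; [exact: cmeas_param|move=> s; rewrite ler01 lexx]. Qed.

Lemma obs_cons g x : obs g -> obs (fun s => g (x :: s)).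
Proof.
move=> [mg sg g01]; split => //; last exact: sym_cons.
by apply: (cmeas_cons (a := fun _ : unit => tt) (b := fun _ : unit => x)) mg.
Qed.

(** The default value of [fine] at [+oo] is never met for integrable activities, by [Z_EFin]. *)
Definition config_int L g : R := fine (gsum mu (fun s => wt L s * g s)).

Lemma le_wt (L K : T -> R) s : (forall x, 0 <= L x <= K x) -> wt L s <= wt K s.
Proof.
move=> LK; apply: ler_wpM2r; first by case/andP: (boltz01 s).
elim: s => [|x s IH]; rewrite ?big_nil// !big_cons.
case/andP: (LK x) => ? ?; apply: ler_pM => //.
by apply: prod_ge0 => y; case/andP: (LK y).
Qed.

Lemma cmeas_wtg L g : nnintegrable L -> obs g -> cmeas (fun (_ : unit) s => wt L s * g s).
Proof.
move=> [mL _ _] [mg _ _]; apply: cmeasM => //.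
by apply: (cmeas_wt (L := fun _ => L)); exact: jmeas_cst.
Qed.

Lemma wtg_ge0 L g s : nnintegrable L -> obs g -> 0 <= wt L s * g s.
Proof.
by move=> [_ L0 _] [_ _ g01]; apply: mulr_ge0; [exact: wt_ge0|case/andP: (g01 s)].
Qed.

Lemma Z_EFin L g : nnintegrable L -> obs g -> (gsum mu (fun s => (wt L s * g s)%R) = (config_int L g)%:E)%E.
Proof.
move=> aL og; rewrite /config_int fineK// ge0_fin_numE; last first.
  by apply: gsum_ge0 => s; exact: wtg_ge0.
have [mL L0 Ly] := aL.
apply: le_lt_trans (gsum_prod_lty L0 mL Ly).
apply: (@le_gsum _ _ _ mu _ _ (fun (_ : unit) s => wt L s * g s) (fun _ s => \prod_(x <- s) L x) tt).
- by move=> _ s; exact: wtg_ge0.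
- by move=> _ s; exact: prod_ge0.
- exact: cmeas_wtg.
- by apply: (cmeas_prod (L := fun _ => L)); exact: jmeas_cst.
- move=> s; have [_ _ g01] := og; rewrite /wt -mulrA ler_piMr//; first exact: prod_ge0.
  case/andP: (g01 s) => ? ?; case/andP: (boltz01 s) => ? ?.
  by rewrite mulr_ile1.
Qed.

Lemma Z_ge0 L g : nnintegrable L -> obs g -> 0 <= config_int L g.
Proof.
by move=> aL og; rewrite /config_int; apply: fine_ge0; apply: gsum_ge0 => s; exact: wtg_ge0.
Qed.

Lemma le_Z L g K h : nnintegrable L -> obs g -> nnintegrable K -> obs h ->
  (forall x, L x <= K x) -> (forall s, g s <= h s) -> config_int L g <= config_int K h.
Proof.
move=> aL og aK oh LK gh; rewrite -lee_fin -!Z_EFin//.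
apply: (@le_gsum _ _ _ mu _ _ (fun (_ : unit) s => wt L s * g s) (fun _ s => wt K s * h s) tt).
- by move=> _ s; exact: wtg_ge0.
- by move=> _ s; exact: wtg_ge0.
- exact: cmeas_wtg.
- exact: cmeas_wtg.
- have [_ L0 _] := aL; have [_ _ g01] := og.
  move=> s; apply: ler_pM => //; first exact: wt_ge0.
  + by case/andP: (g01 s).
  + by apply: le_wt => x; rewrite L0 LK.
Qed.

(** The empty configuration alone contributes 1; all divisions by partition functions rest on
    this. *)
Lemma Z_ge1 L : nnintegrable L -> 1 <= config_int L (fun _ => 1).
Proof.
move=> aL; rewrite -lee_fin -Z_EFin//; last exact: obs1.
rewrite /gsum nneseries_recl//; last first.
  move=> k _; apply: mule_ge0; first by rewrite lee_fin invr_ge0.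
  by apply: iint_ge0 => s; apply: wtg_ge0 => //; exact: obs1.
rewrite /= /wt /= big_nil !mulr1 fact0 invr1 mul1e leeDl//.
apply: nneseries_ge0 => k _ _; apply: mule_ge0; first by rewrite lee_fin invr_ge0.
by apply: iint_ge0 => s; apply: wtg_ge0 => //; exact: obs1.
Qed.

Lemma measurable_Z dP (P : measurableType dP) (L : P -> T -> R) (g : P -> seq T -> R) :
  jmeas L -> (forall p x, 0 <= L p x) -> cmeas g -> (forall p s, 0 <= g p s) ->
  measurable_fun setT (fun p => config_int (L p) (g p)).
Proof.
move=> mL L0 mg g0.
apply: (measurableT_comp (fine_measurable measurableT)).
apply: (@measurable_gsum _ _ _ _ _ _ (fun p s => wt (L p) s * g p s)).
- by move=> p s; apply: mulr_ge0 => //; exact: wt_ge0.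
- by apply: cmeasM => //; exact: cmeas_wt.
Qed.

(** * First-order expansion of configuration integrals *)

Section first_order.
Variables (L q : T -> R) (g : seq T -> R).
Hypotheses (aL : nnintegrable L) (fq : frac q) (og : obs g).

Let aLq := actM aL fq.
Let Lpos x : 0 <= L x. Proof. by case: aL. Qed.
Let qc0 x : 0 <= 1 - q x. Proof. by case: fq => _ /(_ x)/andP[_ ?]; rewrite subr_ge0. Qed.

Lemma Z_frac_split : (config_int L g)%:E =
  ((config_int (L \* q) g)%:E + gsum mu (fun s => (wt L s * g s * (1 - \prod_(x <- s) q x))%R))%E.
Proof.
rewrite -!Z_EFin//.
have [mq q01] := fq.
have c0 s : 0 <= 1 - \prod_(x <- s) q x.
  by rewrite subr_ge0; case/andP: (prod01 s q01).
rewrite -(@gsumD _ _ _ mu _ _ (fun (_ : unit) s => wt (L \* q) s * g s)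
  (fun _ s => wt L s * g s * (1 - \prod_(x <- s) q x)) tt).
- by congr gsum; apply/funext => s; rewrite wtM; ring.
- by move=> _ s; exact: wtg_ge0.
- by move=> _ s; apply: mulr_ge0 => //; exact: wtg_ge0.
- exact: cmeas_wtg.
- apply: cmeasM; first exact: cmeas_wtg.
  apply: cmeasB; first exact: cmeas_param.
  by apply: (cmeas_prod (L := fun _ => q)); exact: jmeas_cst.
Qed.

(** The Mecke formula with the factor [1 - q x] on the extracted point; [r = q] and [r = 1] on the
    remaining points give the lower and the upper first-order bound. *)
Lemma gsum_first_order (r : T -> R) : frac r ->
  gsum mu (fun s => wt L s * g s * extract_sum (fun x t => (1 - q x) * \prod_(y <- t) r y) s)
  = (\int[mu]_x ((1 - q x) * L x * config_int (L \* r \* f x) (fun s => g (x :: s)))%:E)%E.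
Proof.
move=> fr.
have [mq q01] := fq; have [mL _ _] := aL; have [mr r01] := fr; have [mg sg g01] := og.
pose h x t := (1 - q x) * L x * (wt (L \* r \* f x) t * g (x :: t)).
have aLr := actM aL fr.
have aLrf x : nnintegrable (L \* r \* f x) by apply: actM => //; exact: frac_f.
transitivity (gsum mu (extract_sum h)).
  congr gsum; apply/funext => s.
  rewrite -(@Sh_sym _ _ _ (fun s => wt L s * g s)); last first.
    by apply: symM => //; apply: symM; [exact: sym_prod|exact: sym_boltz].
  congr (extract_sum _ s); apply/funext => x; apply/funext => t.
  rewrite /h wt_cons (_ : L \* r \* f x = (L \* f x) \* r); last first.
    by apply/funext => y /=; rewrite mulrAC.
  by rewrite !wtM; ring.
have mh' : cmeas (fun (x : T) s => wt (L \* r \* f x) s * g (x :: s)).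
  apply: cmeasM.
    apply: (cmeas_wt (L := fun x => L \* r \* f x)); apply: jmeasM => //.
    by apply: jmeas_cst; exact: measurable_funM.
  by refine (@cmeas_cons _ _ _ _ _ _ _ _ (fun _ : unit => g) (fun _ : T => tt) (fun x => x) _ _ mg).
have h'0 x s : 0 <= wt (L \* r \* f x) s * g (x :: s).
  by apply: (@wtg_ge0 _ (fun s => g (x :: s))) => //; exact: obs_cons.
have mc : measurable_fun setT (fun x => (1 - q x) * L x).
  by apply: measurable_funM => //; exact: measurable_funB.
have := @gsum_Sh _ _ _ mu _ _ (fun (_ : unit) => h) tt.
move=> ->; last 2 first.
- by move=> _ x s; apply: mulr_ge0 => //; exact: mulr_ge0.
  refine (@cmeas_reparam _ _ _ _ _ _ _ _ h (@snd unit T) _ _) => //.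
  by apply: cmeasM => //; exact: cmeas_param.
apply: eq_integral => x _; rewrite EFinM -Z_EFin//; last exact: obs_cons.
rewrite -(@gsumZl _ _ _ mu _ _ (fun x s => wt (L \* r \* f x) s * g (x :: s)) _ x)//.
exact: mulr_ge0.
Qed.

Let cm0 : cmeas (fun (_ : unit) s => wt L s * g s). Proof. exact: cmeas_wtg. Qed.

Let cmP (r : T -> R) : frac r -> cmeas (fun (_ : unit) s => \prod_(x <- s) r x).
Proof. by move=> [mr _]; apply: (cmeas_prod (L := fun _ => r)); exact: jmeas_cst. Qed.

Let cmS (r : T -> R) : frac r ->
  cmeas (fun (_ : unit) s => wt L s * g s * extract_sum (fun x t => (1 - q x) * \prod_(y <- t) r y) s).
Proof.
have [mq q01] := fq; move=> fr; apply: cmeasM => //.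
apply: (cmeas_Sh (h := fun _ x t => (1 - q x) * \prod_(y <- t) r y)).
apply: cmeasM; last exact: (cmeas_reparam (a := fun _ : unit * T => tt) _ (cmP fr)).
by apply: cmeas_param; apply: measurable_funB => //; exact: measurableT_comp.
Qed.

Let frac1 : frac (fun=> 1).
Proof. by split => // x; rewrite ler01 lexx. Qed.

Let w0 s : 0 <= wt L s * g s. Proof. exact: wtg_ge0. Qed.

Let S0 (r : T -> R) s : frac r ->
  0 <= extract_sum (fun x t => (1 - q x) * \prod_(y <- t) r y) s.
Proof.
move=> [_ r01]; apply: Sh_ge0 => x t; apply: mulr_ge0 => //.
by case/andP: (prod01 t r01).
Qed.

(** If each point is kept independently with probability [q], then [1 - \prod q] is the probability
    that some point is deleted. It is at least the probability of exactly one deletion, used here,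
    and at most the expected number of deletions, used in [Z_first_order_le]. *)
Lemma Z_first_order_ge :
  ((config_int (L \* q) g)%:E +
   \int[mu]_x ((1 - q x) * L x * config_int (L \* q \* f x) (fun s => g (x :: s)))%:E
   <= (config_int L g)%:E)%E.
Proof.
have [mq q01] := fq.
rewrite Z_frac_split leeD2l// -gsum_first_order//.
apply: (@le_gsum _ _ _ mu _ _
  (fun (_ : unit) s => wt L s * g s * extract_sum (fun x t => (1 - q x) * \prod_(y <- t) q y) s)
  (fun _ s => wt L s * g s * (1 - \prod_(x <- s) q x)) tt).
- by move=> _ s; apply: mulr_ge0 => //; exact: S0.
- move=> _ s; apply: mulr_ge0 => //.
  by rewrite subr_ge0; case/andP: (prod01 s q01).
- exact: cmS.
- by apply: cmeasM => //; apply: cmeasB; [exact: cmeas_param|exact: cmP].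
- by move=> s; apply: ler_wpM2l => //; exact: Sh_prod_le.
Qed.

Lemma Z_first_order_le :
  ((config_int L g)%:E <= (config_int (L \* q) g)%:E +
   \int[mu]_x ((1 - q x) * L x * config_int (L \* f x) (fun s => g (x :: s)))%:E)%E.
Proof.
have [mq q01] := fq.
rewrite Z_frac_split leeD2l//.
have := gsum_first_order frac1.
rewrite (_ : L \* (fun=> 1) = L) => [<-|]; last by apply/funext => x /=; rewrite mulr1.
apply: (@le_gsum _ _ _ mu _ _
  (fun _ s => wt L s * g s * (1 - \prod_(x <- s) q x))
  (fun (_ : unit) s => wt L s * g s * extract_sum (fun x t => (1 - q x) * \prod_(y <- t) 1) s)
   tt).
- move=> _ s; apply: mulr_ge0 => //.
  by rewrite subr_ge0; case/andP: (prod01 s q01).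
- by move=> _ s; apply: mulr_ge0 => //; exact: S0.
- by apply: cmeasM => //; apply: cmeasB; [exact: cmeas_param|exact: cmP].
- exact: cmS.
- move=> s; apply: ler_wpM2l => //; apply: (le_trans (Sh_prod_ge s q01)).
  rewrite le_eqVlt; apply/orP; left; apply/eqP.
  congr (extract_sum _ s); apply/funext => x; apply/funext => t.
  by rewrite big1 ?mulr1.
Qed.

End first_order.

End gibbs_model.

(** * Finite integrals of nonnegative functions, as reals *)

Section real_integral.
Context {dT : measure_display} {T : measurableType dT} {R : realType}.
Variable mu : {sigma_finite_measure set T -> \bar R}.

Definition rintegral (g : T -> R) : R := fine (\int[mu]_x (g x)%:E)%E.

Lemma RI_EFin g : nnintegrable mu g -> (\int[mu]_x (g x)%:E = (rintegral g)%:E)%E.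
Proof.
move=> [_ g0 gy]; rewrite /rintegral fineK// ge0_fin_numE//.
by apply: integral_ge0 => x _; rewrite lee_fin.
Qed.

Lemma RI_ge0 (g : T -> R) : (forall x, 0 <= g x) -> 0 <= rintegral g.
Proof. by move=> g0; apply/fine_ge0/integral_ge0 => x _; rewrite lee_fin. Qed.

Lemma le_RI g h : nnintegrable mu g -> nnintegrable mu h -> (forall x, g x <= h x) -> rintegral g <= rintegral h.
Proof.
move=> ag ah gh; rewrite -lee_fin -!RI_EFin//.
case: ag => mg g0 _; case: ah => mh _ _.
apply: ge0_le_integral => //.
- by move=> x _; rewrite lee_fin.
- exact/measurable_EFinP.
- exact/measurable_EFinP.
- by move=> x _; rewrite lee_fin.
Qed.

Lemma actD g h : nnintegrable mu g -> nnintegrable mu h -> nnintegrable mu (fun x => g x + h x).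
Proof.
move=> [mg g0 gy] [mh h0 hy]; split.
- exact: measurable_funD.
- by move=> x; rewrite addr_ge0.
- under eq_integral do rewrite EFinD.
  rewrite ge0_integralD//; first exact: lte_add_pinfty.
  + by move=> x _; rewrite lee_fin.
  + exact/measurable_EFinP.
  + by move=> x _; rewrite lee_fin.
  + exact/measurable_EFinP.
Qed.

Lemma RI_D g h : nnintegrable mu g -> nnintegrable mu h -> rintegral (fun x => g x + h x) = rintegral g + rintegral h.
Proof.
move=> ag ah; apply: EFin_inj; rewrite EFinD -!RI_EFin//; last exact: actD.
case: ag => mg g0 _; case: ah => mh h0 _.
under eq_integral do rewrite EFinD.
rewrite ge0_integralD//.
+ by move=> x _; rewrite lee_fin.
+ exact/measurable_EFinP.
+ by move=> x _; rewrite lee_fin.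
+ exact/measurable_EFinP.
Qed.

Lemma actZ c g : 0 <= c -> nnintegrable mu g -> nnintegrable mu (fun x => c * g x).
Proof.
move=> c0 [mg g0 gy]; split.
- exact: measurable_funM.
- by move=> x; rewrite mulr_ge0.
- under eq_integral do rewrite EFinM.
  rewrite ge0_integralZl//.
  + by rewrite lte_mul_pinfty.
  + exact/measurable_EFinP.
  + by move=> x _; rewrite lee_fin.
Qed.

Lemma RI_Z c g : 0 <= c -> nnintegrable mu g -> rintegral (fun x => c * g x) = c * rintegral g.
Proof.
move=> c0 ag; apply: EFin_inj; rewrite EFinM -!RI_EFin//; last exact: actZ.
case: ag => mg g0 _; under eq_integral do rewrite EFinM.
rewrite ge0_integralZl//.
+ exact/measurable_EFinP.
+ by move=> x _; rewrite lee_fin.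
Qed.

End real_integral.

(** * Partition functions and insertion ratios *)

Section ratio.
Context {dT : measure_display} {T : measurableType dT} {R : realType}.
Variable mu : {sigma_finite_measure set T -> \bar R}.
Variable f : T -> T -> R.
Hypothesis mf : measurable_fun setT (fun z : T * T => f z.1 z.2).
Hypothesis f01 : forall x y, 0 <= f x y <= 1.
Hypothesis fC : forall x y, f x y = f y x.
Local Notation act := (nnintegrable mu).
Local Notation RI := (rintegral mu).
Local Notation Z := (config_int mu f).

Let fracf x : frac (f x). Proof. exact: frac_f. Qed.
Hint Resolve fracf : core.

Definition Zpart L := Z L (fun _ => 1).

Definition insertion L w := Zpart (L \* f w) / Zpart L.

Lemma zp_gt0 L : act L -> 0 < Zpart L.
Proof. by move=> aL; apply: lt_le_trans (Z_ge1 mf f01 aL). Qed.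

Lemma frac_ge0 (q : T -> R) : frac q -> forall x, 0 <= q x. 
Proof. by move=> [_ q01] x; case/andP: (q01 x). Qed.

Lemma fracC (q : T -> R) : frac q -> frac (fun x => 1 - q x).
Proof.
move=> [mq q01]; split; first exact: measurable_funB.
by move=> x; case/andP: (q01 x) => a b; rewrite subr_ge0 b/= gerBl.
Qed.

Lemma actMl (L q : T -> R) : act L -> frac q -> act (fun x => q x * L x).
Proof.
move=> aL fq; rewrite (_ : (fun x => q x * L x) = L \* q); first exact: actM.
by apply/funext => x /=; rewrite mulrC.
Qed.

Lemma Z_le_zp (L K : T -> R) g : act L -> act K -> (forall x, L x <= K x) -> obs g -> Z L g <= Zpart K.
Proof.
move=> aL aK LK og; apply: le_Z => //; first exact: obs1.
by case: og => _ _ g01 s; case/andP: (g01 s).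
Qed.

Lemma act_Z_cons (L K : T -> R) g : act L -> act K -> obs g ->
  act (fun x => L x * Z (K \* f x) (fun s => g (x :: s))).
Proof.
move=> aL aK og; have [mL L0 _] := aL; have [mK K0 _] := aK; have [mg _ g01] := og.
apply: (le_act (L := fun x => Zpart K * L x)).
- by apply: actZ => //; apply/ltW/zp_gt0.
- apply: measurable_funM => //.
  apply: (@measurable_Z _ _ _ _ _ mf f01 _ _ (fun x => K \* f x) (fun x s => g (x :: s))).
  + by apply: jmeasM => //; exact: jmeas_cst.
  + by move=> p x /=; apply: mulr_ge0 => //; case/andP: (f01 p x).
  + by refine (@cmeas_cons _ _ _ _ _ _ _ _ (fun _ : unit => g) (fun _ : T => tt) (fun x => x) _ _ mg).
  + by move=> p s; case/andP: (g01 (p :: s)).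
- move=> x; have aKx : act (K \* f x) by exact: actM.
  have ogx := obs_cons x og.
  rewrite mulr_ge0//=; last exact: Z_ge0.
  rewrite mulrC ler_wpM2r//; apply: Z_le_zp => //.
  by move=> y /=; rewrite ler_piMr//; case/andP: (f01 x y).
Qed.

Lemma Z_first_order (L q : T -> R) g : act L -> frac q -> obs g ->
  Z (L \* q) g + RI (fun x => (1 - q x) * L x * Z (L \* q \* f x) (fun s => g (x :: s))) <= Z L g
  <= Z (L \* q) g + RI (fun x => (1 - q x) * L x * Z (L \* f x) (fun s => g (x :: s))).
Proof.
move=> aL fq og.
have a1 : act (fun x => (1 - q x) * L x) by apply: actMl => //; exact: fracC.
rewrite -2!lee_fin !EFinD -!RI_EFin//; last 2 first.
- exact: act_Z_cons.
- by apply: act_Z_cons => //; exact: actM.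
by rewrite Z_first_order_ge//= Z_first_order_le.
Qed.

(** With a point fixed at [x] the integral over the others is at most [Zpart L], so removing
    activity of mass [b] costs at most the fraction [b] of the partition function. The case [b = 0]
    says that null modifications change nothing. *)
Lemma Z_sub_le (L q : T -> R) g b : act L -> frac q -> obs g ->
  RI (fun x => (1 - q x) * L x) <= b ->
  0 <= Z L g - Z (L \* q) g <= b * Zpart L.
Proof.
move=> aL fq og Hb; have [_ L0 _] := aL.
have a1 : act (fun x => (1 - q x) * L x) by apply: actMl => //; exact: fracC.
have z0 := ltW (zp_gt0 aL).
have /andP[_ H] := Z_first_order aL fq og.
apply/andP; split.
  rewrite subr_ge0; apply: le_Z => //; first exact: actM.
  by move=> x /=; rewrite ler_piMr//; case: fq => _ /(_ x)/andP[].
rewrite lerBlDl; apply: (le_trans H); rewrite lerD2l.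
apply: (@le_trans _ _ (Zpart L * RI (fun x => (1 - q x) * L x))); last first.
  by rewrite mulrC ler_wpM2r.
rewrite -RI_Z//; apply: le_RI.
- exact: act_Z_cons.
- exact: actZ.
- move=> x; rewrite mulrC ler_wpM2r//; first by case: a1.
  apply: Z_le_zp => //; [exact: actM| |exact: obs_cons].
  by move=> y /=; rewrite ler_piMr//; case/andP: (f01 x y).
Qed.

Lemma rho01 L w : act L -> 0 <= insertion L w <= 1.
Proof.
move=> aL; have aLf : act (L \* f w) by exact: actM.
apply/andP; split; first by apply: divr_ge0; exact/ltW/zp_gt0.
rewrite /insertion ler_pdivrMr; last exact: zp_gt0.
rewrite mul1r; apply: Z_le_zp => //; last exact: obs1.
by move=> x /=; rewrite ler_piMr//; [case: aL|case/andP: (f01 w x)].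
Qed.

Lemma measurable_rho dP (P : measurableType dP) (K : P -> T -> R) (w : P -> T) :
  jmeas K -> (forall p, act (K p)) -> measurable_fun setT w ->
  measurable_fun setT (fun p => insertion (K p) (w p)).
Proof.
move=> jK aK mw.
have jf : jmeas (fun p => f (w p)) by exact: (jmeas_reparam (L := f) mw).
have m2 : measurable_fun setT (fun p => Zpart (K p)).
  apply: (@measurable_Z _ _ _ _ _ mf f01 _ _ K (fun _ _ => 1)) => //.
  - by move=> p; case: (aK p).
  - exact: cmeas_param.
apply: measurable_funM.
  apply: (@measurable_Z _ _ _ _ _ mf f01 _ _ (fun p => K p \* f (w p)) (fun _ _ => 1)) => //.
  - exact: jmeasM.
  - move=> p x /=; case: (aK p) => _ K0 _; apply: mulr_ge0 => //.
    by case/andP: (f01 (w p) x).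
  - exact: cmeas_param.
(* The inverse of a positive number [z] is [exp (- ln z)], a composition of measurable maps. *)
under eq_fun => p do rewrite -(lnK (x := Zpart (K p))) ?posrE ?zp_gt0// -expRN.
apply: measurableT_comp => //; apply: measurableT_comp => //.
exact: measurableT_comp.
Qed.

End ratio.

(** * Slicing by sublevel sets *)

Section slices.
Context {dT : measure_display} {T : measurableType dT} {R : realType}.
Variable mu : {sigma_finite_measure set T -> \bar R}.
Local Notation act := (nnintegrable mu).
Local Notation RI := (rintegral mu).

Lemma act_if (g : T -> R) (b : T -> bool) : act g -> measurable_fun setT b ->
  act (fun x => if b x then g x else 0).
Proof.
move=> ag mb; apply: (le_act ag).
  by apply: measurable_fun_ifT => //; case: ag.
by move=> x; have [_ /(_ x) g0 _] := ag; case: ifP; rewrite ?lexx ?g0.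
Qed.

Lemma measurable_slab (tau : T -> R) (s t : R) : measurable_fun setT tau ->
  measurable_fun setT (fun x => (s <= tau x) && (tau x < t)).
Proof.
move=> mtau; apply: measurable_and.
  exact: measurable_fun_ler.
exact: measurable_fun_ltr.
Qed.

Lemma cdf_split (g tau : T -> R) (s t : R) : act g -> measurable_fun setT tau -> s <= t ->
  RI (fun x => if tau x < t then g x else 0) =
  RI (fun x => if tau x < s then g x else 0) +
  RI (fun x => if (s <= tau x) && (tau x < t) then g x else 0).
Proof.
move=> ag mtau st; rewrite -RI_D.
- congr (rintegral mu _); apply/funext => x.
  case: (ltP (tau x) s) => [h|h] /=; last by rewrite add0r.
  by rewrite (lt_le_trans h st) addr0.
- by apply: act_if => //; exact: measurable_fun_ltr.
- by apply: act_if => //; exact: measurable_slab.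
Qed.

(** Slabs around the level [t] shrink to a null set, so their [g]-mass tends to 0 by dominated
    convergence, and increments near [t] are at most the mass of one slab. Continuity is what
    permits cutting off pieces of prescribed mass. *)
Lemma cdf_continuous (g tau : T -> R) : act g -> measurable_fun setT tau ->
  (forall t, mu [set x | tau x = t] = 0%E) ->
  continuous (fun t : R => RI (fun x => if tau x < t then g x else 0)).
Proof.
move=> ag mtau null t.
set F := fun t : R => _.
pose h (n : nat) x := if (t - n.+1%:R^-1 <= tau x) && (tau x < t + n.+1%:R^-1) then g x else 0.
have ah n : act (h n) by apply: act_if => //; exact: measurable_slab.
have hcvg : (fun n => RI (h n)) @ \oo --> 0.
  have [mg g0 gy] := ag.
  have mh n : measurable_fun setT (EFin \o h n).
    by apply/measurable_EFinP; case: (ah n).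
  have ae : {ae mu, forall x, setT x -> (fun n => (h n x)%:E) @ \oo --> 0%E}.
    exists [set x | tau x = t]; split => //.
      by rewrite -[X in measurable X]setTI; exact: (mtau measurableT [set t]).
    move=> x /= H; apply: contrapT => xt; apply: H => _.
    have e0 : 0 < `|tau x - t| by rewrite normr_gt0 subr_eq0; apply/eqP.
    apply: cvg_near_cst; near=> n.
    rewrite /h ifF//; apply/negbTE/negP => /andP[h1 h2].
    have : n.+1%:R^-1 < `|tau x - t|.
      by near: n; exact: (near_infty_natSinv_lt (PosNum e0)).
    apply/negP; rewrite -leNgt ler_distl h1/=; exact: ltW.
  have ig : mu.-integrable setT (EFin \o g).
    apply/integrableP; split; first exact/measurable_EFinP.
    by under eq_integral => x _ do rewrite /= ger0_norm//.
  have [|_ _] := dominated_convergence measurableT mh (measurable_cst 0%E) ae ig.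
    apply: (aeW mu) => x n _ /=; rewrite lee_fin /h.
    by case: ifP; rewrite ?normr0// ger0_norm.
  rewrite integral_cst// mul0e => /fine_cvg; apply: cvg_trans; apply: near_eq_cvg.
  by near=> n.
apply/cvgrPdist_lt => e e0.
have /cvgrPdist_lt /(_ e e0) [n _ /(_ n (leqnn n))] := hcvg.
rewrite /= sub0r normrN => He.
have hn0 : 0 <= RI (h n) by apply: RI_ge0; case: (ah n).
rewrite ger0_norm// in He.
near=> s.
have st : `|s - t| < n.+1%:R^-1.
  near: s; exists n.+1%:R^-1 => //= y.
  by rewrite /ball /= distrC.
have i0 : 0 < n.+1%:R^-1 :> R by rewrite invr_gt0.
move: st; rewrite ltr_distl => /andP[st1 st2].
have g0 x : 0 <= g x by case: ag.
apply: le_lt_trans He.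
case: (leP s t) => [le|/ltW le].
- rewrite /F (cdf_split ag mtau le) addrAC subrr add0r ger0_norm; last first.
    by apply: RI_ge0 => x; case: ifP => // _; case: ag.
  apply: le_RI => //; first by apply: act_if => //; exact: measurable_slab.
  move=> x; rewrite /h; case: ifP => [/andP[h1 h2]|_]; last by case: ifP.
  by rewrite ifT// (le_trans (ltW st1) h1)/= (lt_trans h2)// ltrDl.
- rewrite /F (cdf_split ag mtau le) opprD addrA subrr sub0r normrN ger0_norm; last first.
    by apply: RI_ge0 => x; case: ifP => // _; case: ag.
  apply: le_RI => //; first by apply: act_if => //; exact: measurable_slab.
  move=> x; rewrite /h; case: ifP => [/andP[h1 h2]|_]; last by case: ifP.
  by rewrite ifT// (lt_trans h2 st2) andbT (le_trans _ h1)// gerBl ltW.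
Unshelve. all: by end_near.
Qed.
End slices.

(** Here [z], [z'] are the partition functions before and after a thin shell is switched on, [b]
    bounds the mass of the shell and [a] is the first-order term. The error is a multiple of [a],
    not only of [b], so that it telescopes over the shells. From [a <= b <= 1/4] one has
    [1 - b - a >= 1/2], which is what the constant 4 needs; the two sides come from [ln u <= u - 1]
    at [z / z'] and [z' / z]. *)
Lemma ln_ratio_bounds (R : realType) (z z' a b : R) :
  0 < z -> 0 < z' -> 0 <= a <= b -> b <= 4^-1 ->
  (1 - b) * (z - z') <= z * a -> (1 - b) * (z' * a) <= z - z' ->
  `|ln z - ln z' - a| <= 4 * b * a.
Proof.
move=> z0 z'0 /andP[a0 ab] b4 H1 H2.
have lnE : ln z - ln z' = ln (z / z') by rewrite ln_div// posrE.
have lnE' : ln z - ln z' = - ln (z' / z) by rewrite ln_div ?posrE// opprB.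
have u1 : ln (z / z') <= z / z' - 1.
  rewrite -[X in ln X](subrK 1) addrC; apply: le_ln1Dx.
  by rewrite ltrBrDr addNr divr_gt0.
have u2 : ln (z' / z) <= z' / z - 1.
  rewrite -[X in ln X](subrK 1) addrC; apply: le_ln1Dx.
  by rewrite ltrBrDr addNr divr_gt0.
have v1 : z / z' <= 1 + a + 4 * b * a.
  rewrite ler_pdivrMr//.
  have h0 : (1 - b - a) * z <= (1 - b) * z' by lra.
  have h1 : 0 < 1 - b - a by lra.
  suff : (1 - b - a) * z <= (1 - b - a) * ((1 + a + 4 * b * a) * z').
    by rewrite ler_pM2l.
  apply: (le_trans h0); rewrite mulrA ler_wpM2r ?(ltW z'0)//.
  have -> : (1 - b - a) * (1 + a + 4 * b * a) =
    1 - b + a * (b * (4 * (1 - b - a) - 1) - a) by ring.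
  rewrite lerDl mulr_ge0// subr_ge0 (le_trans ab)// ler_peMr//; lra.
have v2 : z' / z <= 1 - a + 2 * b * a.
  rewrite ler_pdivrMr//.
  have ba0 : 0 <= b * a by rewrite mulr_ge0//; lra.
  have h0 : (1 + (1 - b) * a) * z' <= z by lra.
  have c0 : 0 <= 1 - a + 2 * b * a by lra.
  apply: le_trans (ler_wpM2l c0 h0); rewrite mulrA ler_peMl ?(ltW z'0)//.
  have -> : (1 - a + 2 * b * a) * (1 + (1 - b) * a) =
    1 + a * (b - (1 - b) * (1 - 2 * b) * a) by ring.
  rewrite lerDl mulr_ge0// subr_ge0 (le_trans _ ab)// ler_piMl// mulr_ile1//; lra.
rewrite ler_distlC; apply/andP; split; last lra.
have ? : 0 <= b * a by rewrite mulr_ge0//; lra.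
lra.
Qed.

Section recursion.
Context {dT : measure_display} {T : measurableType dT} {R : realType}.
Variable mu : {sigma_finite_measure set T -> \bar R}.
Variable f : T -> T -> R.
Hypothesis mf : measurable_fun setT (fun z : T * T => f z.1 z.2).
Hypothesis f01 : forall x y, 0 <= f x y <= 1.
Hypothesis fC : forall x y, f x y = f y x.
Local Notation act := (nnintegrable mu).
Local Notation RI := (rintegral mu).
Local Notation zp := (Zpart mu f).
Local Notation rho := (insertion mu f).

(** For [w] in the shell [K w] is a stage between [L \* q] and [L]. Within one shell partition
    functions move by a factor between [1 - b] and 1, so the first-order terms of [Z_first_order],
    taken at the ends of the shell, may be replaced by the ratio [rho (K x) x] at the cost of such a
    factor. *)
Lemma ln_zp_slice (L q : T -> R) (K : T -> T -> R) b :
  act L -> frac q -> jmeas K -> (forall w, act (K w)) ->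
  (forall w, q w != 1 -> forall x, L x * q x <= K w x <= L x) ->
  RI (fun x => (1 - q x) * L x) <= b -> b <= 4^-1 ->
  `|ln (zp L) - ln (zp (L \* q)) - RI (fun x => (1 - q x) * L x * rho (K x) x)|
    <= 4 * b * RI (fun x => (1 - q x) * L x * rho (K x) x).
Proof.
move=> aL fq jK aK LK Hb b4.
have b1 : 0 <= 1 - b by lra.
have fq1 := fracC fq.
have q1 x : 0 <= 1 - q x by exact: (frac_ge0 fq1).
have [mL L0 _] := aL.
have a1 : act (fun x => (1 - q x) * L x) by exact: actMl.
have fr : frac (fun x => rho (K x) x).
  by split; [exact: (measurable_rho mf f01)|move=> x; exact: rho01].
have a2 : act (fun x => (1 - q x) * L x * rho (K x) x) by exact: (actM a1 fr).
have aLq := actM aL fq.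
have aLf x : act (L \* f x) by apply: actM => //; exact: frac_f.
have aLqf x : act (L \* q \* f x) by apply: actM => //; exact: frac_f.
have aKf x : act (K x \* f x) by apply: actM => //; exact: frac_f.
have o1 := @obs1 _ T R.
have z0 := zp_gt0 mf f01 aL.
have z'0 := zp_gt0 mf f01 aLq.
have b0 : 0 <= b.
  by apply: le_trans Hb; apply: RI_ge0; case: a1.
have key x : (1 - b) * zp (L \* f x) <= zp (L \* q \* f x).
  rewrite (_ : L \* q \* f x = L \* f x \* q); last by apply/funext => y /=; rewrite mulrAC.
  have /(_ b) := Z_sub_le mf f01 fC (aLf x) fq o1.
  case/(_ _)/andP => [|_]; last by rewrite /zp; lra.
  apply: le_trans Hb; apply: le_RI => //; first by apply: actMl.
  move=> y /=; rewrite ler_wpM2l// ler_piMr//; case/andP: (f01 x y) => //.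
have /andP[F1 F2] := Z_first_order mf f01 fC aL fq o1.
have A1 : act (fun x => (1 - q x) * L x * zp (L \* f x)) by exact: act_Z_cons a1 aL o1.
have A2 : act (fun x => (1 - q x) * L x * zp (L \* q \* f x)) by exact: act_Z_cons a1 aLq o1.
have leKL x y : q x != 1 -> K x y <= L y by move=> /LK/(_ y)/andP[].
have leLK x y : q x != 1 -> L y * q y <= K x y by move=> /LK/(_ y)/andP[].
have fp x y : 0 <= f x y by case/andP: (f01 x y).
have rhoE x : zp (K x \* f x) = rho (K x) x * zp (K x).
  by rewrite /insertion divfK// gt_eqF// (zp_gt0 mf f01).
apply: ln_ratio_bounds => //.
- apply/andP; split; first by apply: RI_ge0; case: a2.
  apply: le_trans Hb; apply: le_RI => // x; rewrite ler_piMr//; first by case: a1.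
  by case/andP: (rho01 mf f01 x (aK x)).
- apply: (@le_trans _ _ ((1 - b) * RI (fun x => (1 - q x) * L x * zp (L \* f x)))).
    by rewrite ler_wpM2l// lerBlDl.
  rewrite -RI_Z//.
  rewrite -(RI_Z (ltW z0))//; apply: le_RI.
  + exact: actZ.
  + by apply: actZ => //; exact: ltW.
  move=> x; case: (eqVneq (q x) 1) => [->|qx]; first by rewrite subrr !mul0r !mulr0.
  rewrite mulrCA [leRHS]mulrCA; apply: ler_wpM2l; first by case: a1.
  apply: (le_trans (key x)).
  apply: (@le_trans _ _ (zp (K x \* f x))).
    apply: (Z_le_zp mf f01) => // y /=; rewrite ler_wpM2r// leLK//.
  rewrite rhoE mulrC ler_wpM2r//; first by case/andP: (rho01 mf f01 x (aK x)).
  by apply: (Z_le_zp mf f01) => // y; exact: leKL.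
- apply: (@le_trans _ _ (RI (fun x => (1 - q x) * L x * zp (L \* q \* f x)))); last first.
    by rewrite lerBrDl.
  rewrite mulrA -RI_Z//; last by rewrite mulr_ge0// ltW.
  apply: le_RI => //; first by apply: actZ => //; rewrite mulr_ge0// ltW.
  move=> x; case: (eqVneq (q x) 1) => [->|qx]; first by rewrite subrr !mul0r !mulr0.
  rewrite mulrCA; apply: ler_wpM2l; first by case: a1.
  apply: le_trans (key x); rewrite -mulrA ler_wpM2l//.
  apply: (@le_trans _ _ (zp (K x \* f x))).
    rewrite rhoE mulrC ler_wpM2l//; first by case/andP: (rho01 mf f01 x (aK x)).
    by apply: (Z_le_zp mf f01) => // y /=; exact: leLK.
  by apply: (Z_le_zp mf f01) => // y /=; rewrite ler_wpM2r// leKL.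
Qed.

End recursion.

(** * The recursion for the insertion ratio *)

Section recursion_formula.
Context {dT : measure_display} {T : measurableType dT} {R : realType}.
Variable mu : {sigma_finite_measure set T -> \bar R}.
Variable f : T -> T -> R.
Hypothesis mf : measurable_fun setT (fun z : T * T => f z.1 z.2).
Hypothesis f01 : forall x y, 0 <= f x y <= 1.
Hypothesis fC : forall x y, f x y = f y x.
Local Notation act := (nnintegrable mu).
Local Notation RI := (rintegral mu).
Local Notation zp := (Zpart mu f).
Local Notation rho := (insertion mu f).

Variables (L q tau : T -> R) (T0 : R).
Hypotheses (aL : act L) (fq : frac q) (mtau : measurable_fun setT tau)
  (tau0 : forall x, 0 <= tau x) (T00 : 0 <= T0)
  (qT : forall x, T0 <= tau x -> q x = 1)
  (null : forall t, mu [set x | tau x = t] = 0%E).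

(** Stage [t] of the switching-on: [L \* below t] is [L] at [t = 0] and [L \* q] from [T0] on. [K w]
    is the stage at the level of [w]; for [tau] the distance from [v] and [q = f v] it is
    [L_{v->w}]. *)
Definition below t x := if tau x < t then q x else 1.
Let K w := L \* below (tau w).
Let g x := (1 - q x) * L x.
Let h x := g x * rho (K x) x.
Let F t := RI (fun x => if tau x < t then g x else 0).
Let A t := RI (fun x => if tau x < t then h x else 0).

Lemma frac_below t : frac (below t).
Proof.
have [mq q01] := fq; split.
  by apply: measurable_fun_ifT => //; exact: measurable_fun_ltr.
by move=> x; rewrite /below; case: ifP; rewrite ?ler01 ?lexx.
Qed.

Lemma jmeas_below : jmeas (fun w => below (tau w)).
Proof.
have [mq q01] := fq; rewrite /jmeas /below.
apply: measurable_fun_ifT => //; last exact: measurableT_comp.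
by apply: measurable_fun_ltr; exact: measurableT_comp.
Qed.

Let aK w : act (K w). Proof. by apply: actM => //; exact: frac_below. Qed.

Let jK : jmeas K.
Proof. by apply: jmeasM; [apply: jmeas_cst; case: aL|exact: jmeas_below]. Qed.

Let ag : act g. Proof. by apply: actMl => //; exact: fracC. Qed.

Let ah : act h.
Proof.
apply: (actM (q := fun x => rho (K x) x) ag).
by split; [exact: (measurable_rho mf f01)|move=> x; exact: rho01].
Qed.

Let step t t' b : t <= t' -> F t' - F t <= b -> b <= 4^-1 ->
  `|ln (zp (L \* below t)) - ln (zp (L \* below t')) - (A t' - A t)| <= 4 * b * (A t' - A t).
Proof.
move=> tt' Fb b4.
pose r x := if (t <= tau x) && (tau x < t') then q x else 1.
have [mq q01] := fq.
have [mL L0 _] := aL.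
have fr : frac r.
  split; first by apply: measurable_fun_ifT => //; exact: measurable_slab.
  by move=> x; rewrite /r; case: ifP; rewrite ?ler01 ?lexx.
have rE : L \* below t \* r = L \* below t'.
  apply/funext => x /=; rewrite /below /r.
  case: (ltP (tau x) t) => [h1|h1] /=; last by rewrite mulr1.
  by rewrite (lt_le_trans h1 tt') mulr1.
have gE x : (1 - r x) * (L \* below t) x = if (t <= tau x) && (tau x < t') then g x else 0.
  rewrite /= /r /below /g; case: ifP => [/andP[h1 _]|]; last by rewrite subrr mul0r.
  by rewrite ltNge h1 mulr1.
have hE x : (1 - r x) * (L \* below t) x * rho (K x) x =
    if (t <= tau x) && (tau x < t') then h x else 0.
  by rewrite gE /h; case: ifP; rewrite ?mul0r.
have := @ln_zp_slice _ _ _ mu f mf f01 fC (L \* below t) r K b (actM aL (frac_below t)) fr jK aK.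
rewrite rE.
under [in X in _ -> X -> _]eq_fun do rewrite gE.
rewrite (_ : (fun x => (1 - r x) * (L \* below t) x * rho (K x) x) =
    (fun x => if (t <= tau x) && (tau x < t') then h x else 0)); last exact/funext.
have -> : RI (fun x => if (t <= tau x) && (tau x < t') then h x else 0) = A t' - A t.
  by rewrite /A (cdf_split ah mtau tt') addrAC subrr add0r.
apply => //.
(* For [w] in the shell, [K w] has switched on [q] only at levels below [tau w], hence it lies
   between the two end stages. *)
- move=> w rw x; move: rw; rewrite /r; case: ifP => [/andP[h1 h2] qw|_]; last by rewrite eqxx.
  have Lx := L0 x; have /andP[q0 q1] := q01 x.
  rewrite /K /below /=; case: (ltP (tau x) t) => h3 /=.
    by rewrite (lt_le_trans h3 h1) mulr1 lexx.
  case: (ltP (tau x) (tau w)) => h4.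
    by rewrite (lt_trans h4 h2) mulr1 lexx/= ler_piMr.
  by case: ifP; rewrite !mulr1 ?lexx// ler_piMr.
- by apply: le_trans Fb; rewrite /F (cdf_split ag mtau tt') addrAC subrr add0r.
Qed.

(** With [N] shells of equal mass the errors [4 b (A t' - A t)] add up to at most
    [4 (RI g / N) RI h], which vanishes as [N] grows. *)
Lemma zp_frac_exp : zp (L \* q) = zp L * expR (- RI h).
Proof.
have [mq q01] := fq.
have [mL L0 _] := aL.
have g0 x : 0 <= g x by case: ag.
have h0 x : 0 <= h x by case: ah.
have b0 : L \* below 0 = L.
  by apply/funext => x; rewrite /= /below ltNge tau0 mulr1.
have bT : L \* below T0 = L \* q.
  by apply/funext => x; rewrite /= /below; case: ltP => // /qT ->.
have F0 : F 0 = 0.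
  rewrite /F; under eq_fun do rewrite ltNge tau0.
  by rewrite /rintegral integral0.
have A0 : A 0 = 0.
  rewrite /A; under eq_fun do rewrite ltNge tau0.
  by rewrite /rintegral integral0.
have gT : (fun x => if tau x < T0 then g x else 0) = g.
  apply/funext => x; case: ltP => // h1.
  by rewrite /g qT// subrr mul0r.
have FT : F T0 = RI g by rewrite /F gT.
have AT : A T0 = RI h.
  rewrite /A; congr RI; apply/funext => x; case: ltP => // h1.
  by rewrite /h /g qT// subrr !mul0r.
have Fmono s t : s <= t -> F s <= F t.
  move=> st; rewrite /F (cdf_split ag mtau st) lerDl; apply: RI_ge0 => x.
  by case: ifP.
have Amono s t : s <= t -> A s <= A t.
  move=> st; rewrite /A (cdf_split ah mtau st) lerDl; apply: RI_ge0 => x.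
  by case: ifP.
have M0 : 0 <= RI g by rewrite -FT -F0; exact: Fmono.
have Ah0 : 0 <= RI h by exact: RI_ge0.
have Fcont : continuous F by exact: cdf_continuous.
have claim (N : nat) : (0 < N)%N -> RI g / N%:R <= 4^-1 ->
    `|ln (zp L) - ln (zp (L \* q)) - RI h| <= 4 * (RI g / N%:R) * RI h.
  move=> N0; set b := RI g / N%:R => b4.
  have bb : 0 <= b by rewrite divr_ge0.
  have NR : 0 < N%:R :> R by rewrite ltr0n.
  have bN : N%:R * b = RI g by rewrite mulrC divfK// gt_eqF.
  have it i : (i <= N)%N -> exists t, [/\ 0 <= t <= T0, F t = i%:R * b &
      `|ln (zp L) - ln (zp (L \* below t)) - A t| <= 4 * b * A t].
    elim: i => [_|i IH iN].
      exists 0; split; [by rewrite lexx|by rewrite F0 mul0r|].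
      by rewrite b0 A0 !subrr mulr0 normr0.
    have [t [/andP[t0 tT] Ft Ht]] := IH (ltnW iN).
    have [t' t'in Ft'] : exists2 t', t' \in `[t, T0] & F t' = i.+1%:R * b.
      apply: IVT => //; first exact: continuous_subspaceT.
      have l1 : F t <= i.+1%:R * b by rewrite Ft ler_wpM2r// ler_nat.
      have l2 : i.+1%:R * b <= F T0 by rewrite FT -bN ler_wpM2r// ler_nat.
      by rewrite ge_min l1 le_max l2 orbT.
    move: t'in; rewrite in_itv/= => /andP[tt' t'T].
    exists t'; split => //; first by rewrite (le_trans t0 tt').
    have Fb : F t' - F t <= b by rewrite Ft' Ft -natr1 mulrDl mul1r addrAC subrr add0r.
    have S := step tt' Fb b4.
    rewrite (_ : ln (zp L) - _ - _ = (ln (zp L) - ln (zp (L \* below t)) - A t) +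
      (ln (zp (L \* below t)) - ln (zp (L \* below t')) - (A t' - A t))); last by ring.
    apply: (le_trans (ler_normD _ _)); apply: (le_trans (lerD Ht S)).
    by rewrite -mulrDr addrC subrK.
  have [t [/andP[t0 tT] Ft Ht]] := it N (leqnn N).
  (* [F t] is already the full mass, though [t] may be smaller than [T0]; the remaining shell has
     mass 0 and causes no error. *)
  have Fb : F T0 - F t <= 0 by rewrite Ft bN FT subrr.
  have S := step tT Fb (ltW _).
  rewrite bT AT mulr0 mul0r in S.
  rewrite (_ : ln (zp L) - _ - _ = (ln (zp L) - ln (zp (L \* below t)) - A t) +
      (ln (zp (L \* below t)) - ln (zp (L \* q)) - (RI h - A t))); last by ring.
  apply: (le_trans (ler_normD _ _)); apply: (le_trans (lerD Ht (S _))).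
    by rewrite invr_gt0.
  by rewrite addr0 ler_wpM2l// ?mulr_ge0// -AT Amono.
have z0 := zp_gt0 mf f01 aL; have z'0 := zp_gt0 mf f01 (actM aL fq).
suff lnE : ln (zp L) - ln (zp (L \* q)) = RI h.
  rewrite -lnE opprB expRD expRN !lnK ?posrE//.
  by rewrite mulrCA divff ?mulr1// gt_eqF.
apply/eqP; rewrite -subr_eq0 -normr_le0; apply/ler_addgt0Pl => e e0; rewrite addr0.
(* For [N] above [c], the first entry gives [RI g / N <= 1/4] and the second a total error of at
   most [e]. *)
pose c := Num.max (4 * RI g) (4 * RI g * RI h / e).
have cM : 4 * RI g <= c by rewrite le_max lexx.
have ce : 4 * RI g * RI h / e <= c by rewrite le_max lexx orbT.
pose N := (Num.truncn c).+1.
have cN : c < N%:R by exact: truncnS_gt.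
have N0 : 0 < N%:R :> R by rewrite ltr0n.
apply: (le_trans (claim N _ _)) => //.
  rewrite ler_pdivrMr// -(ler_pM2l (ltr0n _ 4)) mulrA divff// mul1r.
  exact: (le_trans cM (ltW cN)).
have : 4 * RI g * RI h <= e * N%:R.
  by rewrite -ler_pdivrMl// mulrC (le_trans ce)// ltW.
by move=> H; rewrite mulrA mulrAC ler_pdivrMr.
Qed.

End recursion_formula.

(** * Contraction *)

(** The slope of [e^{-u^2/2}] has square [u^2 e^{-u^2}], maximal at [u = 1] with value [1/e]. This
    is the origin of the [e] in the threshold [e/Delta]. *)
Lemma expR_sqr_contr (R : realType) (x y : R) : 0 <= x -> 0 <= y ->
  (expR (- (x ^+ 2 / 2)) - expR (- (y ^+ 2 / 2))) ^+ 2 <= expR (-1) * (x - y) ^+ 2.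
Proof.
wlog xy : x y / x < y.
  move=> H x0 y0; case: (ltgtP x y) => [xy|xy|->].
  - exact: H.
  - by rewrite -sqrrN opprB -[X in _ <= _ * X]sqrrN opprB; exact: H.
  - by rewrite !subrr expr0n/= mulr0.
move=> x0 _.
pose h (u : R) := expR (- (u ^+ 2 / 2)).
pose dh (u : R) := - u * expR (- (u ^+ 2 / 2)).
have hd (u : R) : is_derive u 1 h (dh u).
  have h1 : is_derive u 1 (fun u : R => - (u ^+ 2 / 2)) (- u).
    rewrite (_ : (fun u : R => - (u ^+ 2 / 2)) = (- 2^-1) *: (id ^+ 2)); last first.
      by apply/funext => w; rewrite !fctE /= /GRing.scale /= mulNr mulrC.
    apply: is_derive_eq; rewrite /GRing.scale /= expr1 mulr1; lra.
  have := @is_derive1_comp R expR (fun u : R => - (u ^+ 2 / 2)) u _ _ (is_derive_expR _) h1.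
  by rewrite /dh mulrC.
have hc : {within `[x, y], continuous h}.
  apply: continuous_subspaceT => u; apply: differentiable_continuous.
  by apply/derivable1_diffP; case: (hd u).
have [c _ hE] := MVT xy (fun u _ => hd u) hc.
rewrite -/(h x) -/(h y) -sqrrN opprB hE -[in leRHS]sqrrN opprB exprMn.
apply: ler_wpM2r; first exact: sqr_ge0.
rewrite /dh exprMn sqrrN -expRM_natr.
(* [c^2 e^{-c^2} <= e^{-1}] is the inequality [1 + y <= e^y] at [y = c^2 - 1]. *)
have -> : - (c ^+ 2 / 2) * 2%:R = -1 - (c ^+ 2 - 1) by lra.
rewrite expRD expRN (expRN (c ^+ 2 - 1)) mulrCA ler_piMr ?invr_ge0 ?expR_ge0//.
rewrite ler_pdivrMr ?expR_gt0// mul1r.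
by apply: le_trans (expR_ge1Dx _); rewrite addrC subrK.
Qed.

Section contraction.
Context {dT : measure_display} {T : measurableType dT} {R : realType}.
Variable mu : {sigma_finite_measure set T -> \bar R}.
Local Notation act := (nnintegrable mu).
Local Notation RI := (rintegral mu).

(* Reverse triangle inequality in L^2(c mu), through
   [a + b <= (sqrt a - sqrt b)^2 + t a + b / t] optimised in [t]. *)
Lemma RI_sqrt_dist (c a b : T -> R) : act c -> frac a -> frac b ->
  (Num.sqrt (RI (fun x => c x * a x)) - Num.sqrt (RI (fun x => c x * b x))) ^+ 2
  <= RI (fun x => c x * (Num.sqrt (a x) - Num.sqrt (b x)) ^+ 2).
Proof.
move=> ac fa fb.
have a0 := frac_ge0 fa; have b0 := frac_ge0 fb.
have aca : act (fun x => c x * a x) by exact: (actM ac fa).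
have acb : act (fun x => c x * b x) by exact: (actM ac fb).
have c0 x : 0 <= c x by case: ac.
have fX : frac (fun x => (Num.sqrt (a x) - Num.sqrt (b x)) ^+ 2).
  split.
    have [ma _] := fa; have [mb _] := fb.
    have msq : measurable_fun setT (@Num.sqrt R).
      by apply: continuous_measurable_fun; exact: sqrt_continuous.
    apply: measurable_funX; apply: measurable_funB.
      exact: (measurableT_comp msq ma).
    exact: (measurableT_comp msq mb).
  move=> x; rewrite sqr_ge0/= -real_normK ?num_real// expr_le1// ler_norml.
  have [_ /(_ x)/andP[_ ax]] := fa; have [_ /(_ x)/andP[_ bx]] := fb.
  have sa := sqrtr_ge0 (a x); have sb := sqrtr_ge0 (b x).
  have sa1 : Num.sqrt (a x) <= 1 by rewrite -sqrtr1 ler_sqrt.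
  have sb1 : Num.sqrt (b x) <= 1 by rewrite -sqrtr1 ler_sqrt.
  by apply/andP; split; lra.
have acX : act (fun x => c x * (Num.sqrt (a x) - Num.sqrt (b x)) ^+ 2) by exact: (actM ac fX).
set s := RI (fun x => c x * a x); set s' := RI (fun x => c x * b x).
set X := RI (fun x => c x * _).
have s0 : 0 <= s by apply: RI_ge0; case: aca.
have s'0 : 0 <= s' by apply: RI_ge0; case: acb.
have X0 : 0 <= X by apply: RI_ge0; case: acX.
have H t : 0 < t -> s + s' <= X + t * s + t^-1 * s'.
  move=> t0; have i0 : 0 <= t^-1 by rewrite invr_ge0 ltW.
  rewrite /s /s' /X -(RI_Z (ltW t0))// -(RI_Z i0)//.
  have ta := actZ (ltW t0) aca; have tb := actZ i0 acb.
  rewrite -(RI_D aca acb) -(RI_D acX ta) -(RI_D (actD acX ta) tb).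
  apply: le_RI; [exact: actD|exact: actD (actD acX ta) tb|].
  move=> x; rewrite -mulrDr (mulrCA t) (mulrCA t^-1) -!mulrDr ler_wpM2l//.
  have := sqr_sqrtr (a0 x); have := sqr_sqrtr (b0 x).
  set p := Num.sqrt (a x); set q := Num.sqrt (b x) => <- <-.
  rewrite -subr_ge0.
  have -> : (p - q) ^+ 2 + t * p ^+ 2 + t^-1 * q ^+ 2 - (p ^+ 2 + q ^+ 2) =
    t * (p - t^-1 * q) ^+ 2.
    by field; rewrite gt_eqF.
  by apply: mulr_ge0; [exact: ltW|exact: sqr_ge0].
have [s00|sn0] := eqVneq s 0.
  rewrite s00 sqrtr0 sub0r sqrrN sqr_sqrtr//.
  apply/ler_addgt0Pr => e e0.
  have [->|s'n0] := eqVneq s' 0; first by rewrite addr_ge0// ltW.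
  have s'p : 0 < s' by rewrite lt_neqAle eq_sym s'n0.
  have := H (s' / e) (divr_gt0 s'p e0).
  by rewrite s00 add0r mulr0 addr0 invf_div divfK.
have sp : 0 < s by rewrite lt_neqAle eq_sym sn0.
have [s'00|s'n0] := eqVneq s' 0.
  rewrite s'00 sqrtr0 subr0 sqr_sqrtr//.
  apply/ler_addgt0Pr => e e0.
  have := H (e / s) (divr_gt0 e0 sp).
  by rewrite s'00 mulr0 !addr0 divfK.
have s'p : 0 < s' by rewrite lt_neqAle eq_sym s'n0.
rewrite -(sqr_sqrtr s0) -(sqr_sqrtr s'0) in H.
have p0 : 0 < Num.sqrt s by rewrite sqrtr_gt0.
have q0 : 0 < Num.sqrt s' by rewrite sqrtr_gt0.
have := H (Num.sqrt s' / Num.sqrt s) (divr_gt0 q0 p0).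
set p := Num.sqrt s in p0 *; set q := Num.sqrt s' in q0 *.
have -> : q / p * p ^+ 2 = p * q by field; rewrite gt_eqF.
have -> : (q / p)^-1 * q ^+ 2 = p * q by field; rewrite !gt_eqF.
by rewrite sqrrB; lra.
Qed.

End contraction.

(** * Iterating the contraction *)

Section contraction_iter.
Context {dT : measure_display} {T : measurableType dT} {R : realType}.
Variable mu : {sigma_finite_measure set T -> \bar R}.
Variable f : T -> T -> R.
Hypothesis mf : measurable_fun setT (fun z : T * T => f z.1 z.2).
Hypothesis f01 : forall x y, 0 <= f x y <= 1.
Hypothesis fC : forall x y, f x y = f y x.
Variables (D : T -> T -> R) (r1 : R).
Hypothesis mD : measurable_fun setT (fun z : T * T => D z.1 z.2).
Hypothesis D0 : forall x y, 0 <= D x y.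
Hypothesis Dtri : forall x y z, D x z <= D x y + D y z.
Hypothesis Dnull : forall v t, mu [set x | D v x = t] = 0%E.
Hypothesis r10 : 0 < r1.
Hypothesis range : forall v x, r1 <= D v x -> f v x = 1.
Local Notation act := (nnintegrable mu).
Local Notation RI := (rintegral mu).
Local Notation zp := (Zpart mu f).
Local Notation rho := (insertion mu f).

(** [L \* damping v w] is the activity [L_{v->w}] of the recursion. *)
Definition damping v w := below (f v) (D v) (D v w).

Lemma measurable_D v : measurable_fun setT (D v).
Proof. exact: (measurable_fun_sec v mD). Qed.

Lemma frac_damp v w : frac (damping v w).
Proof. by apply: frac_below; [exact: frac_f|exact: measurable_D]. Qed.

Lemma rho_rec L v : act L ->
  rho L v = expR (- RI (fun w => (1 - f v w) * L w * rho (L \* damping v w) w)).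
Proof.
move=> aL; rewrite /insertion.
have z0 := zp_gt0 mf f01 aL.
rewrite (zp_frac_exp mf f01 fC aL (frac_f mf f01 v) (measurable_D v) (D0 v) (ltW r10) (@range v) (Dnull v)).
by rewrite mulrC mulrA mulVf ?mul1r// gt_eqF.
Qed.

Definition gap L L' v := (Num.sqrt (rho L v) - Num.sqrt (rho L' v)) ^+ 2.

(** For [t <= 0] this is no condition, [D] being nonnegative. *)
Definition agree (L L' : T -> R) v t := forall x, D v x < t -> L x = L' x.

Lemma gap01 L L' v : act L -> act L' -> 0 <= gap L L' v <= 1.
Proof.
move=> aL aL'; rewrite /gap sqr_ge0/= -real_normK ?num_real// expr_le1// ler_norml.
have /andP[a0 a1] := rho01 mf f01 v aL; have /andP[b0 b1] := rho01 mf f01 v aL'.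
have sa := sqrtr_ge0 (rho L v); have sb := sqrtr_ge0 (rho L' v).
have sa1 : Num.sqrt (rho L v) <= 1 by rewrite -sqrtr1 ler_sqrt.
have sb1 : Num.sqrt (rho L' v) <= 1 by rewrite -sqrtr1 ler_sqrt.
by apply/andP; split; lra.
Qed.

Lemma jmeas_damp dP (P : measurableType dP) (v w : P -> T) :
  measurable_fun setT v -> measurable_fun setT w ->
  jmeas (fun p => damping (v p) (w p)).
Proof.
move=> mv mw.
have pr (u : P * T -> T) (u' : P * T -> T) : measurable_fun setT u -> measurable_fun setT u' ->
    measurable_fun setT (fun z => (u z, u' z)) by exact: measurable_fun_pair.
have m1 : measurable_fun setT (v \o @fst P T) by exact: measurableT_comp.
have m2 : measurable_fun setT (w \o @fst P T) by exact: measurableT_comp.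
have m3 : measurable_fun setT (@snd P T) by [].
rewrite /jmeas /damping /below; apply: measurable_fun_ifT => //.
  apply: measurable_fun_ltr.
    exact: (measurableT_comp mD (pr _ _ m1 m3)).
  exact: (measurableT_comp mD (pr _ _ m1 m2)).
exact: (measurableT_comp mf (pr _ _ m1 m3)).
Qed.

Let frac_rho L v : act L -> frac (fun w => rho (L \* damping v w) w).
Proof.
move=> aL; have aLd w : act (L \* damping v w) by apply: actM => //; exact: frac_damp.
split; last by move=> x; exact: rho01.
apply: (measurable_rho mf f01) => //; apply: jmeasM; last exact: jmeas_damp.
by apply: jmeas_cst; case: aL.
Qed.

(** Agreement up to distance [r1] makes [(1 - f v w) L w dw] and [(1 - f v w) L' w dw] the same
    measure. In its L^2 space the exponents of [rho_rec] are squared norms of the square roots of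
    the next ratios; [RI_sqrt_dist] compares these norms and [expR_sqr_contr] their images under
    [e^{-u^2/2}]. *)
Lemma gap_contraction L L' v : act L -> act L' -> agree L L' v r1 ->
  gap L L' v <= expR (-1) *
    RI (fun w => (1 - f v w) * L w * gap (L \* damping v w) (L' \* damping v w) w).
Proof.
move=> aL aL' LL'.
have fk := fracC (frac_f mf f01 v).
have ac : act (fun w => (1 - f v w) * L w) by exact: actMl.
have ac' : act (fun w => (1 - f v w) * L' w) by exact: actMl.
have E w : (1 - f v w) * L' w = (1 - f v w) * L w.
  case: (ltP (D v w) r1) => [/LL' ->//|/range ->]; by rewrite subrr !mul0r.
have sqrt_exp (s : R) : 0 <= s -> Num.sqrt (expR (- s)) = expR (- (Num.sqrt s ^+ 2 / 2)).
  move=> s0; rewrite sqr_sqrtr//.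
  have -> : - s = - (s / 2) + - (s / 2) by lra.
  by rewrite expRD -expr2 sqrtr_sqr ger0_norm// expR_ge0.
pose s := RI (fun w => (1 - f v w) * L w * rho (L \* damping v w) w).
pose s' := RI (fun w => (1 - f v w) * L' w * rho (L' \* damping v w) w).
have s0 : 0 <= s by apply: RI_ge0; case: (actM ac (frac_rho v aL)).
have s'0 : 0 <= s' by apply: RI_ge0; case: (actM ac' (frac_rho v aL')).
have key : (Num.sqrt s - Num.sqrt s') ^+ 2 <=
    RI (fun w => (1 - f v w) * L w * gap (L \* damping v w) (L' \* damping v w) w).
  have -> : s' = RI (fun w => (1 - f v w) * L w * rho (L' \* damping v w) w).
    by rewrite /s'; under eq_fun do rewrite E.
  exact: (RI_sqrt_dist ac (frac_rho v aL) (frac_rho v aL')).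
have r1E : rho L v = expR (- s) := rho_rec v aL.
have r2E : rho L' v = expR (- s') := rho_rec v aL'.
rewrite /gap r1E r2E; move: key; clearbody s s' => key.
rewrite (sqrt_exp s s0) (sqrt_exp s' s'0).
apply: (le_trans (expR_sqr_contr (sqrtr_ge0 s) (sqrtr_ge0 s'))).
by apply: ler_wpM2l key; exact: expR_ge0.
Qed.

(** For [m = 1] this is the integral [V_k] started from [v]; in general [m]
    carries the damping factors created by the previous steps. *)
Fixpoint tree_int k (m : T -> R) (v : T) : \bar R :=
  match k with
  | 0 => 1%E
  | k'.+1 => (\int[mu]_w (((1 - f v w) * m w)%:E * tree_int k' (m \* damping v w)%R w))%E
  end.

Let kap0 v w : 0 <= 1 - f v w. Proof. by rewrite subr_ge0; case/andP: (f01 v w). Qed.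

Let damp0 v w x : 0 <= damping v w x.
Proof. by case: (frac_damp v w) => _ /(_ x)/andP[]. Qed.

Lemma U_ge0 k m v : (forall x, 0 <= m x) -> (0 <= tree_int k m v)%E.
Proof.
elim: k m v => [|k IH] m v m0 //=.
apply: integral_ge0 => w _; apply: mule_ge0; first by rewrite lee_fin mulr_ge0.
by apply: IH => x /=; rewrite mulr_ge0.
Qed.

Lemma measurable_U k dP (P : measurableType dP) (m : P -> T -> R) (v : P -> T) :
  jmeas m -> (forall p x, 0 <= m p x) -> measurable_fun setT v ->
  measurable_fun setT (fun p => tree_int k (m p) (v p)).
Proof.
elim: k dP P m v => [|k IH] dP P m v jm m0 mv /=; first exact: measurable_cst.
have mv1 : measurable_fun setT (v \o @fst P T) by exact: measurableT_comp.
apply: (@measurable_fun_fubini_tonelli_F _ _ P T R mu (fun z : P * T =>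
  (((1 - f (v z.1) z.2) * m z.1 z.2)%:E * tree_int k (m z.1 \* damping (v z.1) z.2)%R z.2)%E)).
  apply: emeasurable_funM.
    apply/measurable_EFinP; apply: measurable_funM => //.
    apply: measurable_funB => //.
    exact: (measurableT_comp mf (measurable_fun_pair mv1 (measurable_snd))).
  apply: (IH _ _ (fun z : P * T => m z.1 \* damping (v z.1) z.2) snd) => //.
    apply: jmeasM; first exact: (jmeas_reparam (L := m)).
    exact: (jmeas_damp mv1).
  by move=> z x /=; rewrite mulr_ge0.
move=> z; apply: mule_ge0; first by rewrite lee_fin mulr_ge0.
by apply: U_ge0 => x /=; rewrite mulr_ge0.
Qed.

Let measurable_step k (m : T -> R) v : measurable_fun setT m -> (forall x, 0 <= m x) ->
  measurable_fun setT (fun w => (((1 - f v w) * m w)%:E * tree_int k (m \* damping v w)%R w)%E).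
Proof.
move=> mm m0; apply: emeasurable_funM.
  apply/measurable_EFinP; apply: measurable_funM => //.
  by apply: measurable_funB => //; exact: (measurable_fun_sec v mf).
apply: (@measurable_U _ _ T (fun w => m \* damping v w) id) => //.
  apply: jmeasM; first exact: jmeas_cst.
  exact: (@jmeas_damp _ T (fun _ => v) id).
by move=> w x /=; rewrite mulr_ge0.
Qed.

Variable lam : R.
Hypothesis lam0 : 0 <= lam.

(** [m] is the product of the dampings met so far, so [L <= lam * m] survives each step and the
    bound reproduces the integrand of [V_k]. By the triangle inequality a step to [w] within
    distance [r1] costs [r1] of the agreement radius. [S] is a bound available once the radius is
    down to [t]. *)
Lemma gap_iter (S t : R) k (L L' : T -> R) m v : 0 <= S -> 0 <= t ->
  (forall (K K' : T -> R) w, act K -> act K' -> (forall x, K x <= lam) -> agree K K' w t ->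
     gap K K' w <= S) ->
  act L -> act L' -> frac m -> (forall x, L x <= lam * m x) ->
  agree L L' v (t + k%:R * r1) ->
  ((gap L L' v)%:E <= ((lam * expR (-1)) ^+ k * S)%:E * tree_int k m v)%E.
Proof.
move=> S0 t0 HS; elim: k L L' m v => [|k IH] L L' m v aL aL' fm Lm LL' /=.
  rewrite expr0 mul1r mule1 lee_fin; apply: HS => //.
    by move=> x; apply: (le_trans (Lm x)); rewrite ler_piMr//; case: fm => _ /(_ x)/andP[].
  by move=> x Dx; apply: LL'; rewrite mul0r addr0.
have tk0 : 0 <= t + k%:R * r1 by rewrite addr_ge0// mulr_ge0// ltW.
have ag1 : agree L L' v r1.
  by move=> x Dx; apply: LL'; rewrite -natr1 mulrDl mul1r addrA (lt_le_trans Dx)// lerDr.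
have fk := fracC (frac_f mf f01 v).
have ac : act (fun w => (1 - f v w) * L w) by exact: actMl.
have aLd K w : act K -> act (K \* damping v w) by move=> aK; apply: actM => //; exact: frac_damp.
have m0 := frac_ge0 fm.
have [mm _] := fm.
have fg : frac (fun w => gap (L \* damping v w) (L' \* damping v w) w).
  split; last by move=> w; apply: gap01; exact: aLd.
  have msq : measurable_fun setT (@Num.sqrt R).
    by apply: continuous_measurable_fun; exact: sqrt_continuous.
  apply: measurable_funX; apply: measurable_funB.
    by case: (frac_rho v aL) => mr _; exact: (measurableT_comp msq mr).
  by case: (frac_rho v aL') => mr _; exact: (measurableT_comp msq mr).
have acg : act (fun w => (1 - f v w) * L w * gap (L \* damping v w) (L' \* damping v w) w).
  exact: (actM ac fg).
have e0 : 0 <= expR (-1) :> R by exact: expR_ge0.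
have c0 n : 0 <= (lam * expR (-1)) ^+ n * S by rewrite mulr_ge0// exprn_ge0// mulr_ge0.
have Um0 w : (0 <= tree_int k (m \* damping v w)%R w)%E by apply: U_ge0 => x /=; rewrite mulr_ge0.
apply: (@le_trans _ _ (expR (-1) * RI (fun w => (1 - f v w) * L w *
    gap (L \* damping v w) (L' \* damping v w) w))%:E).
  by rewrite lee_fin; exact: gap_contraction.
set c := (lam * expR (-1)) ^+ k * S in IH.
have cc0 : 0 <= c by exact: c0.
have -> : (lam * expR (-1)) ^+ k.+1 * S = expR (-1) * (lam * c) by rewrite exprS /c; ring.
rewrite EFinM -RI_EFin// EFinM -muleA.
apply: lee_wpmul2l; first by rewrite lee_fin.
rewrite -ge0_integralZl//; last 3 first.
- exact: measurable_step.
- by move=> w _; apply: mule_ge0 => //; rewrite lee_fin mulr_ge0.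
- by rewrite lee_fin mulr_ge0.
apply: ge0_le_integral => //.
- by move=> w _; rewrite lee_fin; case: acg.
- by apply/measurable_EFinP; case: acg.
- by apply: measurable_funeM; exact: measurable_step.
move=> w _.
(* Beyond the range [1 - f v w] vanishes and both integrands are 0. *)
case: (ltP (D v w) r1) => Dw; last first.
  by rewrite range// subrr !mul0r mul0e mule0.
have IHw : ((gap (L \* damping v w)%R (L' \* damping v w)%R w)%:E <=
    c%:E * tree_int k (m \* damping v w)%R w)%E.
  apply: IH; [exact: aLd|exact: aLd|by apply: fracM => //; exact: frac_damp| |].
    by move=> x /=; rewrite mulrA ler_wpM2r.
  move=> x Dx /=; rewrite LL'//.
  by apply: (le_lt_trans (Dtri v w x)); rewrite -natr1 mulrDl mul1r addrA addrC ltrD.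
rewrite EFinM.
apply: (@le_trans _ _ (((1 - f v w) * L w)%:E * (c%:E * tree_int k (m \* damping v w)%R w))%E).
  by apply: lee_wpmul2l => //; rewrite lee_fin; case: ac.
rewrite !muleA -!EFinM; apply: lee_wpmul2r => //.
rewrite lee_fin [X in _ <= X](_ : _ = (1 - f v w) * (lam * m w) * c); last by ring.
by apply: ler_wpM2r => //; apply: ler_wpM2l.
Qed.

Variables (k0 : nat) (theta : R).
Hypothesis theta0 : 0 <= theta.
Hypothesis Utheta : forall v, (((lam * expR (-1)) ^+ k0)%:E * tree_int k0 (fun=> 1)%R v <= theta%:E)%E.

(** Blocks of [k0] steps, each costing the distance [k0 * r1] and gaining the factor [theta]. Every
    block restarts with [m = 1], discarding the damping of the others; this is why [Utheta] is asked
    for all starting points [v]. *)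
Lemma gap_geometric n (L L' : T -> R) v : act L -> act L' -> (forall x, L x <= lam) ->
  agree L L' v (n%:R * (k0%:R * r1)) -> gap L L' v <= theta ^+ n.
Proof.
elim: n L L' v => [|n IH] L L' v aL aL' Llam ag.
  by rewrite expr0; case/andP: (gap01 v aL aL').
have tn0 : 0 <= theta ^+ n by exact: exprn_ge0.
have t0 : 0 <= n%:R * (k0%:R * r1) by rewrite !mulr_ge0// ltW.
have f1 : frac (fun _ : T => 1 : R) by split => // x; rewrite ler01 lexx.
have := @gap_iter (theta ^+ n) (n%:R * (k0%:R * r1)) k0 L L' (fun=> 1) v tn0 t0 IH aL aL' f1.
rewrite -lee_fin; move=> /(_ _ _)/le_trans; apply.
- by move=> x; rewrite mulr1.
- by move=> x Dx; apply: ag; rewrite -natr1 mulrDl mul1r.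
rewrite mulrC EFinM -muleA exprSr EFinM; apply: lee_wpmul2l => //.
Qed.

(** From [a - b = (sqrt a - sqrt b) (sqrt a + sqrt b)]; the gap is a squared difference, which
    leaves the square root of [theta]. *)
Lemma rho_dist_geometric n (L L' : T -> R) v : act L -> act L' -> (forall x, L x <= lam) ->
  agree L L' v (n%:R * (k0%:R * r1)) ->
  `|rho L v - rho L' v| <= 2 * Num.sqrt theta ^+ n.
Proof.
move=> aL aL' Llam ag.
have := gap_geometric aL aL' Llam ag; rewrite /gap.
have /andP[a0 a1] := rho01 mf f01 v aL; have /andP[b0 b1] := rho01 mf f01 v aL'.
have sa := sqrtr_ge0 (rho L v); have sb := sqrtr_ge0 (rho L' v).
have sa1 : Num.sqrt (rho L v) <= 1 by rewrite -sqrtr1 ler_sqrt.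
have sb1 : Num.sqrt (rho L' v) <= 1 by rewrite -sqrtr1 ler_sqrt.
have E : rho L v - rho L' v = (Num.sqrt (rho L v) + Num.sqrt (rho L' v)) *
    (Num.sqrt (rho L v) - Num.sqrt (rho L' v)).
  by rewrite mulrC -subr_sqr !sqr_sqrtr.
move=> H; rewrite E normrM; apply: ler_pM => //.
  by rewrite ger0_norm ?addr_ge0//; apply: (le_trans (lerD sa1 sb1)); rewrite -mulr2n.
rewrite -sqrtr_sqr; apply: (le_trans (ler_wsqrtr H)).
by rewrite -[theta in leLHS](sqr_sqrtr theta0) -exprM mulnC exprM sqrtr_sqr ger0_norm// exprn_ge0.
Qed.

End contraction_iter.

(** * Total variation distance *)

Section total_variation.
Context {dT : measure_display} {T : measurableType dT} {R : realType}.
Variable mu : {sigma_finite_measure set T -> \bar R}.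
Variable f : T -> T -> R.
Hypothesis mf : measurable_fun setT (fun z : T * T => f z.1 z.2).
Hypothesis f01 : forall x y, 0 <= f x y <= 1.
Hypothesis fC : forall x y, f x y = f y x.
Local Notation act := (nnintegrable mu).
Local Notation RI := (rintegral mu).
Local Notation zp := (Zpart mu f).
Local Notation Z := (config_int mu f).
Local Notation rho := (insertion mu f).

Definition gibbs_mean L g := Z L g / zp L.

Lemma Phi01 L g : act L -> obs g -> 0 <= gibbs_mean L g <= 1.
Proof.
move=> aL og; have z0 := zp_gt0 mf f01 aL.
apply/andP; split; first by apply: divr_ge0; [exact: Z_ge0|exact: ltW].
by rewrite /gibbs_mean ler_pdivrMr// mul1r; exact: (Z_le_zp mf f01).
Qed.

Definition coind (B : T -> bool) x : R := if B x then 0 else 1.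
Definition ind (B : T -> bool) x : R := if B x then 1 else 0.

Lemma frac_off B : measurable_fun setT B -> frac (coind B).
Proof.
move=> mB; split; first exact: measurable_fun_ifT.
by move=> x; rewrite /coind; case: ifP; rewrite ?lexx ?ler01.
Qed.

Lemma frac_on B : measurable_fun setT B -> frac (ind B).
Proof.
move=> mB; split; first exact: measurable_fun_ifT.
by move=> x; rewrite /ind; case: ifP; rewrite ?lexx ?ler01.
Qed.

Lemma offE B x : 1 - coind B x = ind B x.
Proof. by rewrite /coind /ind; case: ifP; rewrite ?subr0 ?subrr. Qed.

Let frac_Phi (L : T -> R) g : act L -> obs g ->
  frac (fun x => gibbs_mean (L \* f x) (fun s => g (x :: s))).
Proof.
move=> aL og; have aLf x : act (L \* f x) by apply: actM => //; exact: frac_f.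
split; last by move=> x; apply: Phi01 => //; exact: obs_cons.
have [mL L0 _] := aL; have [mg _ g01] := og.
have jL : jmeas (fun x => L \* f x) by apply: jmeasM => //; exact: jmeas_cst.
have L0' x y : 0 <= (L \* f x) y by apply: mulr_ge0 => //; case/andP: (f01 x y).
have m1 : measurable_fun setT (fun x => Z (L \* f x) (fun s => g (x :: s))).
  apply: (@measurable_Z _ _ _ _ _ mf f01 _ _ (fun x => L \* f x) (fun x s => g (x :: s))) => //.
  + by refine (@cmeas_cons _ _ _ _ _ _ _ _ (fun _ : unit => g) (fun _ : T => tt) (fun x => x) _ _ mg).
  + by move=> p s; case/andP: (g01 (p :: s)).
have m2 : measurable_fun setT (fun x => zp (L \* f x)).
  apply: (@measurable_Z _ _ _ _ _ mf f01 _ _ (fun x => L \* f x) (fun x s => 1)) => //.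
  exact: cmeas_param.
apply: measurable_funM => //.
under eq_fun => p do rewrite -(lnK (x := zp (L \* f p))) ?posrE ?(zp_gt0 mf f01 (aLf p))// -expRN.
apply: measurableT_comp => //; apply: measurableT_comp => //.
exact: measurableT_comp.
Qed.

Let frac_rho (L : T -> R) : act L -> frac (fun x => rho L x).
Proof.
move=> aL; split; last by move=> x; exact: rho01.
by apply: (measurable_rho mf f01) => //; apply: jmeas_cst; case: aL.
Qed.

Section slice.
Variables (B : T -> bool).
Hypothesis mB : measurable_fun setT B.

(** Relative to the weight of an empty slice [B], this is the density of having exactly one point
    there, at [x]. [slice_cond] is the expectation of [g] given that point, and [slice_mix] the
    expectation of [g] conditioned on at most one point in [B]. *)
Definition slice_rate L x := ind B x * (L x * rho (L \* coind B) x).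
Definition slice_cond L g x := gibbs_mean (L \* coind B \* f x) (fun s => g (x :: s)).
Definition slice_mix L g := (gibbs_mean (L \* coind B) g + RI (fun x => slice_rate L x * slice_cond L g x)) / (1 + RI (slice_rate L)).

Lemma act_hit L : act L -> act (slice_rate L).
Proof.
move=> aL; rewrite /slice_rate (_ : (fun x => _) = L \* rho (L \* coind B) \* ind B); last first.
  by apply/funext => x /=; rewrite mulrC.
apply: actM; last exact: frac_on.
by apply: actM => //; apply: frac_rho; apply: actM => //; exact: frac_off.
Qed.

Lemma act_hitM L (u : T -> R) : act L -> frac u -> act (fun x => slice_rate L x * u x).
Proof. by move=> aL fu; exact: (actM (act_hit aL) fu). Qed.

Lemma frac_cond L g : act L -> obs g -> frac (slice_cond L g).
Proof. by move=> aL og; apply: frac_Phi => //; apply: actM => //; exact: frac_off. Qed.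

Lemma mix01 L g : act L -> obs g -> 0 <= slice_mix L g <= 1.
Proof.
move=> aL og; have aLo := actM aL (frac_off mB).
have ah := act_hit aL; have h0 : 0 <= RI (slice_rate L) by apply: RI_ge0; case: ah.
have /andP[p0 p1] := Phi01 aLo og.
have fc := frac_cond aL og.
have i0 : 0 <= RI (fun x => slice_rate L x * slice_cond L g x) by apply: RI_ge0; case: (act_hitM aL fc).
have i1 : RI (fun x => slice_rate L x * slice_cond L g x) <= RI (slice_rate L).
  apply: le_RI => //; first exact: act_hitM.
  by move=> x; rewrite ler_piMr//; [case: ah|case: fc => _ /(_ x)/andP[]].
rewrite /slice_mix; apply/andP; split; first by apply: divr_ge0; lra.
by rewrite ler_pdivrMr; lra.
Qed.

(** The mixture discards two or more points in [B], an event of probability at most [b^2]. *)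
Lemma Phi_mix L g b : act L -> obs g -> RI (fun x => ind B x * L x) <= b ->
  `|gibbs_mean L g - slice_mix L g| <= b ^+ 2.
Proof.
move=> aL og Hb.
have fo := frac_off mB.
have aLo := actM aL fo.
have fn := frac_on mB.
have aon : act (fun x => ind B x * L x) by exact: actMl.
have b0 : 0 <= b by apply: le_trans Hb; apply: RI_ge0; case: aon.
have z0 := zp_gt0 mf f01 aL; have zo0 := zp_gt0 mf f01 aLo.
have aLf x : act (L \* f x) by apply: actM => //; exact: frac_f.
have aLof x : act (L \* coind B \* f x) by apply: actM => //; exact: frac_f.
have fle x y : 0 <= f x y <= 1 by [].
have [_ L0 _] := aL.
pose W h := gibbs_mean (L \* coind B) h + RI (fun x => slice_rate L x * slice_cond L h x).
(* The subtracted term is the part of the expectation of [h] with at most one point in [B]. It is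
   used for [h = g] and for [h = 1]. *)
have main h : obs h ->
    0 <= gibbs_mean L h - zp (L \* coind B) / zp L * W h <= b ^+ 2.
  move=> oh.
  have := Z_first_order mf f01 fC aL fo oh.
  rewrite (_ : (fun x => (1 - coind B x) * L x * Z (L \* coind B \* f x) (fun s => h (x :: s))) =
    (fun x => zp (L \* coind B) * (slice_rate L x * slice_cond L h x))); last first.
    apply/funext => x; rewrite offE /slice_rate /slice_cond /gibbs_mean /insertion.
    by field; rewrite !gt_eqF// (zp_gt0 mf f01).
  rewrite RI_Z ?(ltW zo0)//; last by apply: act_hitM => //; exact: frac_cond.
  have up : RI (fun x => (1 - coind B x) * L x * Z (L \* f x) (fun s => h (x :: s))) <=
      zp (L \* coind B) * RI (fun x => slice_rate L x * slice_cond L h x) + b ^+ 2 * zp L.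
    have zL0 := ltW z0.
    have c0 : 0 <= b * zp L by rewrite mulr_ge0.
    apply: (@le_trans _ _ (zp (L \* coind B) * RI (fun x => slice_rate L x * slice_cond L h x) +
        (b * zp L) * RI (fun x => ind B x * L x))); last first.
      rewrite lerD2l (_ : b ^+ 2 * zp L = b * zp L * b); last by ring.
      exact: ler_wpM2l.
    rewrite -(RI_Z (ltW zo0) (act_hitM aL (frac_cond aL oh))) -(RI_Z c0 aon).
    have ahc := actZ (ltW zo0) (act_hitM aL (frac_cond aL oh)).
    rewrite -RI_D//; last exact: actZ.
    apply: le_RI.
    - by apply: act_Z_cons => //; apply: actMl => //; exact: fracC.
    - by apply: actD => //; exact: actZ.
    move=> x; rewrite offE.
    have -> : zp (L \* coind B) * (slice_rate L x * slice_cond L h x) =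
        ind B x * L x * Z (L \* coind B \* f x) (fun s => h (x :: s)).
      rewrite /slice_rate /slice_cond /gibbs_mean /insertion.
      by field; rewrite !gt_eqF// (zp_gt0 mf f01).
    rewrite [leRHS](_ : _ = ind B x * L x *
      (Z (L \* coind B \* f x) (fun s => h (x :: s)) + b * zp L)); last by ring.
    apply: ler_wpM2l; first by case: aon.
    rewrite (_ : L \* coind B \* f x = L \* f x \* coind B); last first.
      by apply/funext => y /=; rewrite mulrAC.
    have /(_ b) := Z_sub_le mf f01 fC (aLf x) fo (obs_cons x oh).
    case/(_ _)/andP => [|_ H].
      apply: le_trans Hb; apply: le_RI => //.
        by apply: actMl => //; exact: fracC.
      move=> y /=; rewrite offE; apply: ler_wpM2l; first exact: (frac_ge0 fn).
      by rewrite ler_piMr//; case/andP: (f01 x y).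
    rewrite -lerBlDl; apply: (le_trans H); apply: ler_wpM2l => //.
    apply: (Z_le_zp mf f01) => //; last exact: obs1.
    by move=> y /=; rewrite ler_piMr//; case/andP: (f01 x y).
  move=> /andP[l u].
  have u' := le_trans u (lerD (lexx _) up).
  have -> : gibbs_mean L h - zp (L \* coind B) / zp L * W h =
    (Z L h - (Z (L \* coind B) h + zp (L \* coind B) * RI (fun x => slice_rate L x * slice_cond L h x))) / zp L.
    by rewrite /W /gibbs_mean; field; rewrite !gt_eqF.
  apply/andP; split; first by apply: divr_ge0; [rewrite subr_ge0|exact: ltW].
  by rewrite ler_pdivrMr//; lra.
have /andP[g1 g2] := main g og.
have /andP[] := main (fun _ => 1) (@obs1 _ T R).
have -> : gibbs_mean L (fun _ => 1) = 1 by rewrite /gibbs_mean divff// gt_eqF.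
have -> : W (fun _ => 1) = 1 + RI (slice_rate L).
  rewrite /W /gibbs_mean divff ?gt_eqF//; congr (1 + RI _); apply/funext => x.
  by rewrite /slice_cond /gibbs_mean divff ?mulr1// gt_eqF// (zp_gt0 mf f01).
have ah := act_hit aL; have h0 : 0 <= RI (slice_rate L) by apply: RI_ge0; case: ah.
have WE : W g = slice_mix L g * (1 + RI (slice_rate L)).
  by rewrite /slice_mix divfK// gt_eqF//; lra.
rewrite WE in g1 g2; move: g1 g2.
have /andP[] := mix01 aL og.
set w := slice_mix L g; set p := zp (L \* coind B) / zp L; set m := RI (slice_rate L) in h0 *.
move=> w0 w1 g1 g2 o1 o2.
(* [gibbs_mean L g - w] is the difference of [gibbs_mean L g - p (1 + m) w] and [(1 - p (1 + m)) w],
   both in [[0, b^2]]. *)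
have e1 : (1 - p * (1 + m)) * w <= b ^+ 2 by apply: le_trans o2; rewrite ler_piMr.
have e0 : 0 <= (1 - p * (1 + m)) * w by rewrite mulr_ge0.
rewrite ler_norml; apply/andP; split; lra.
Qed.

End slice.

End total_variation.

(** The ratio [N / (1 + m)] is at most 1 and both denominators are at least 1, so an error [e] in
    the numerator and one in the denominator cost [2 e]. The inherited error [dl] enters scaled by
    [1 + m] and leaves with coefficient 1, which lets it pass unchanged through many slices. *)
Lemma ratio_perturbation (R : realFieldType) (A N N' m m' dl e : R) :
  0 <= m -> 0 <= m' -> 0 <= e -> 0 <= N -> A <= N + dl * (1 + m) ->
  N <= N' + e -> N <= 1 + m -> m' <= m + e ->
  A / (1 + m) <= N' / (1 + m') + (dl + 2 * e).
Proof.
move=> m0 m0' e0 N0 HA HN HN1 Hm.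
have d0 : 0 < 1 + m by lra.
have d0' : 0 < 1 + m' by lra.
have h1 : A / (1 + m) <= N / (1 + m) + dl.
  by rewrite ler_pdivrMr// mulrDl divfK ?gt_eqF.
suff h2 : N / (1 + m) <= N' / (1 + m') + 2 * e by lra.
rewrite ler_pdivrMr//.
have -> : (N' / (1 + m') + 2 * e) * (1 + m) =
    (N' + 2 * e * (1 + m')) * (1 + m) / (1 + m').
  by field; rewrite gt_eqF.
rewrite ler_pdivlMr//.
have h3 : N * (1 + m') <= N * (1 + m + e) by apply: ler_wpM2l => //; lra.
have h4 : N * e <= (1 + m) * e by apply: ler_wpM2r.
have h5 : N * (1 + m) <= (N' + e) * (1 + m) by apply: ler_wpM2r => //; exact: ltW.
have h6 : 0 <= e * m' * (1 + m) by rewrite !mulr_ge0//; exact: ltW.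
lra.
Qed.

(** * Comparing two activities on one slice *)

Section total_variation_bound.
Context {dT : measure_display} {T : measurableType dT} {R : realType}.
Variable mu : {sigma_finite_measure set T -> \bar R}.
Variable f : T -> T -> R.
Hypothesis mf : measurable_fun setT (fun z : T * T => f z.1 z.2).
Hypothesis f01 : forall x y, 0 <= f x y <= 1.
Hypothesis fC : forall x y, f x y = f y x.
Local Notation act := (nnintegrable mu).
Local Notation RI := (rintegral mu).
Local Notation zp := (Zpart mu f).
Local Notation Z := (config_int mu f).
Local Notation rho := (insertion mu f).
Local Notation Phi := (gibbs_mean mu f).
Local Notation on := (@ind _ T R).
Local Notation off := (@coind _ T R).

Section mix.
Variable B : T -> bool.
Hypothesis mB : measurable_fun setT B.
Hypothesis aB : act (on B).
Local Notation mix := (slice_mix mu f B).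
Local Notation hit := (slice_rate mu f B).
Local Notation cond := (slice_cond mu f B).

Let mix_le (L L' : T -> R) g e dl : act L -> act L' -> obs g -> 0 <= e -> 0 <= dl ->
  (forall x, B x -> `|L x * rho (L \* off B) x - L' x * rho (L' \* off B) x| <= e) ->
  Phi (L \* off B) g <= Phi (L' \* off B) g + dl ->
  (forall x, B x -> cond L g x <= cond L' g x + dl) ->
  mix L g <= mix L' g + (dl + 2 * (e * RI (on B))).
Proof.
move=> aL aL' og e0 dl0 He Hu Hc.
have ah := act_hit mf f01 mB aL; have ah' := act_hit mf f01 mB aL'.
have h0 x : 0 <= hit L x by case: ah.
have h0' x : 0 <= hit L' x by case: ah'.
have m0 : 0 <= RI (hit L) by exact: RI_ge0.
have m0' : 0 <= RI (hit L') by exact: RI_ge0.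
have fc := frac_cond mf f01 mB aL og; have fc' := frac_cond mf f01 mB aL' og.
have ahc := actM ah fc; have ahc' := actM ah fc'; have ah'c' := actM ah' fc'.
have ae := actZ e0 aB.
have hB x : ~~ B x -> hit L x = 0 /\ hit L' x = 0.
  by move=> /negbTE Bx; rewrite /slice_rate /ind Bx !mul0r.
have hE x : B x -> `|hit L x - hit L' x| <= e.
  by move=> Bx; rewrite /slice_rate /ind Bx !mul1r; exact: He.
have onB x : B x -> on B x = 1 by rewrite /ind => ->.
have onNB x : ~~ B x -> on B x = 0 by rewrite /ind => /negbTE ->.
(* Conditional expectations are exchanged first, with the rates of [L] as weights; the rates follow,
   against values in [[0, 1]]. *)
have H1 : RI (hit L \* cond L g) <= RI (hit L \* cond L' g) + dl * RI (hit L).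
  rewrite -(RI_Z dl0 ah) -RI_D//; last exact: actZ.
  apply: le_RI => //; first by apply: actD => //; exact: actZ.
  move=> x /=; have [Bx|/hB[-> _]] := boolP (B x); last by rewrite !mul0r mulr0 addr0.
  by rewrite (mulrC dl) -mulrDr ler_wpM2l// Hc.
have H2 : RI (hit L \* cond L' g) <= RI (hit L' \* cond L' g) + e * RI (on B).
  rewrite -(RI_Z e0 aB) -RI_D//.
  apply: le_RI => //; first exact: actD.
  move=> x /=; have [Bx|Bx] := boolP (B x); last first.
    by have [-> ->] := hB x Bx; rewrite onNB// !mul0r mulr0 addr0.
  rewrite onB// mulr1 -lerBlDl -mulrBl.
  have := hE x Bx; rewrite ler_norml => /andP[_ hx].
  case: fc' => _ /(_ x)/andP[c0 c1].
  by apply: (le_trans (ler_wpM2r c0 hx)); rewrite ler_piMr.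
have H3 : RI (hit L') <= RI (hit L) + e * RI (on B).
  rewrite -(RI_Z e0 aB) -RI_D//.
  apply: le_RI => //; first exact: actD.
  move=> x /=; have [Bx|Bx] := boolP (B x); last first.
    by have [-> ->] := hB x Bx; rewrite onNB// mulr0 addr0.
  by rewrite onB// mulr1; have := hE x Bx; rewrite distrC ler_distl => /andP[].
have H4 : RI (hit L \* cond L' g) <= RI (hit L).
  apply: le_RI => // x /=; rewrite ler_piMr//; case: fc' => _ /(_ x)/andP[] //.
have aL'o := actM aL' (frac_off mB).
have /andP[p0 p1] := Phi01 mf f01 aL'o og.
have I0 : 0 <= RI (hit L \* cond L' g) by apply: RI_ge0; case: ahc'.
have I0' : 0 <= RI (hit L' \* cond L' g) by apply: RI_ge0; case: ah'c'.
have V0 : 0 <= e * RI (on B) by rewrite mulr_ge0//; apply: RI_ge0; case: aB.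
rewrite /slice_mix -/(hit L \* cond L g).
have G1 := addr_ge0 p0 I0.
have G2 : Phi (L \* off B) g + RI (hit L \* cond L g) <=
    Phi (L' \* off B) g + RI (hit L \* cond L' g) + dl * (1 + RI (hit L)).
  by rewrite mulrDr mulr1 addrACA; exact: lerD.
have G3 : Phi (L' \* off B) g + RI (hit L \* cond L' g) <=
    Phi (L' \* off B) g + RI (hit L' \* cond L' g) + e * RI (on B).
  by rewrite -addrA lerD2l.
have G4 : Phi (L' \* off B) g + RI (hit L \* cond L' g) <= 1 + RI (hit L) by exact: lerD.
exact: ratio_perturbation m0 m0' V0 G1 G2 G3 G4 H3.
Qed.

Lemma mix_dist (L L' : T -> R) g e dl : act L -> act L' -> obs g -> 0 <= e -> 0 <= dl ->
  (forall x, B x -> `|L x * rho (L \* off B) x - L' x * rho (L' \* off B) x| <= e) ->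
  `|Phi (L \* off B) g - Phi (L' \* off B) g| <= dl ->
  (forall x, B x -> `|cond L g x - cond L' g x| <= dl) ->
  `|mix L g - mix L' g| <= dl + 2 * (e * RI (on B)).
Proof.
move=> aL aL' og e0 dl0 He Hu Hc.
rewrite ler_distl; apply/andP; split.
- rewrite lerBlDr; apply: mix_le => //.
  + by move=> x Bx; rewrite distrC; exact: He.
  + by move: Hu; rewrite ler_distl lerBlDr => /andP[].
  + by move=> x /Hc; rewrite ler_distl lerBlDr => /andP[].
- apply: mix_le => //.
  + by move: Hu; rewrite ler_distl => /andP[].
  + by move=> x /Hc; rewrite ler_distl => /andP[].
Qed.

End mix.

End total_variation_bound.

(** * Exploring Lambda slice by slice *)

Section total_variation_induction.
Context {dT : measure_display} {T : measurableType dT} {R : realType}.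
Variable mu : {sigma_finite_measure set T -> \bar R}.
Variable f : T -> T -> R.
Hypothesis mf : measurable_fun setT (fun z : T * T => f z.1 z.2).
Hypothesis f01 : forall x y, 0 <= f x y <= 1.
Hypothesis fC : forall x y, f x y = f y x.
Local Notation act := (nnintegrable mu).
Local Notation RI := (rintegral mu).
Local Notation zp := (Zpart mu f).
Local Notation Z := (config_int mu f).
Local Notation rho := (insertion mu f).
Local Notation Phi := (gibbs_mean mu f).
Local Notation on := (@ind _ T R).
Local Notation off := (@coind _ T R).

Variables (Lam : T -> bool) (tau : T -> R) (T0 lam eps : R).
Hypotheses (mLam : measurable_fun setT Lam) (aLam : act (on Lam))
  (mtau : measurable_fun setT tau) (tau0 : forall x, 0 <= tau x)
  (T00 : 0 <= T0) (LamT : forall x, Lam x -> tau x < T0)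
  (null : forall t, mu [set x | tau x = t] = 0%E)
  (lam0 : 0 <= lam) (eps0 : 0 <= eps).

Definition local (g : seq T -> R) := forall s, g s = g [seq x <- s | Lam x].

Lemma local_cons g x : local g -> local (fun s => g (x :: s)).
Proof.
move=> lg s; rewrite (lg (x :: s)) [RHS]lg /=.
by case: ifP => _; rewrite filter_id.
Qed.

(** An activity of mass 0 on [Lam] may be switched off there; then any configuration with a point in
    [Lam] has weight 0, and a local [g] sees only the empty one. *)
Lemma Phi_null L g : act L -> RI (fun x => on Lam x * L x) = 0 -> obs g -> local g ->
  Phi L g = g [::].
Proof.
move=> aL L0 og lg.
have fo : frac (off Lam) by exact: frac_off.
have aLo := actM aL fo.
have hE : RI (fun x => (1 - off Lam x) * L x) <= 0.
  by under eq_fun do rewrite offE; rewrite L0.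
have eqZ h : obs h -> Z L h = Z (L \* off Lam) h.
  move=> oh; have := Z_sub_le mf f01 fC aL fo oh hE.
  by rewrite mul0r -eq_le eq_sym subr_eq0 => /eqP.
have o1 := @obs1 _ T R.
have z0 := zp_gt0 mf f01 aLo.
have g0 : 0 <= g [::] by case: og => _ _ /(_ [::])/andP[].
rewrite /gibbs_mean /Zpart !eqZ//.
suff -> : Z (L \* off Lam) g = g [::] * Z (L \* off Lam) (fun _ => 1).
  by rewrite mulfK// gt_eqF.
apply: EFin_inj; rewrite EFinM -!Z_EFin//.
rewrite -(@gsumZl _ _ _ mu _ _ (fun (_ : unit) s => wt f (L \* off Lam) s * 1) _ tt)//; last 2 first.
- by move=> _ s; exact: (wtg_ge0 f01 s aLo o1).
- exact: (cmeas_wtg mf aLo o1).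
congr gsum; apply/funext => s; rewrite mulr1 lg.
have [sL|sL] := boolP (has Lam s).
  suff -> : wt f (L \* off Lam) s = 0 by rewrite mul0r mulr0.
  rewrite wtM [X in _ * X](_ : _ = 0) ?mulr0//.
  elim: s sL => //= x s IH; rewrite big_cons /coind.
  by case: (Lam x) => /= [_|/IH ->]; rewrite ?mul0r ?mulr0.
by move: sL; rewrite has_filter negbK => /eqP ->; rewrite mulrC.
Qed.

(** The exploration multiplies both activities by the same factors, [off B1] for an explored slice
    and [f x] for a point found at [x]. Asking the estimate for all [q] makes it stable under these,
    see [closeM]. *)
Definition close (L L' : T -> R) (B : T -> bool) := forall q, frac q -> forall w, B w ->
  `|L w * rho (L \* q) w - L' w * rho (L' \* q) w| <= eps.

Lemma closeM L L' (B B' : T -> bool) q : frac q -> (forall x, B' x -> B x) ->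
  close L L' B -> close (L \* q) (L' \* q) B'.
Proof.
move=> fq BB cl r fr w /BB Bw.
have qA K : K \* q \* r = K \* (q \* r) by apply/funext => x /=; rewrite mulrA.
rewrite /= !qA mulrAC [X in _ - X]mulrAC -mulrBl normrM.
have [_ /(_ w)/andP[q0 q1]] := fq.
rewrite (ger0_norm q0); apply: (le_trans _ (cl _ (fracM fq fr) _ Bw)).
by rewrite ler_piMr.
Qed.

Lemma act_on (B : T -> bool) : measurable_fun setT B -> (forall x, B x -> Lam x) -> act (on B).
Proof.
move=> mB BL; apply: (le_act aLam); first by have [] : frac (on B) by exact: frac_on.
move=> x; rewrite /ind; case: ifP => [/BL ->|_]; rewrite ?ler01 ?lexx//=.
by case: ifP; rewrite ?lexx.
Qed.

Lemma cut_slice (B : T -> bool) c : measurable_fun setT B -> (forall x, B x -> Lam x) ->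
  0 <= c <= RI (on B) ->
  exists t, RI (on (fun x => B x && (tau x < t))) = c.
Proof.
move=> mB BL cB.
have aB := act_on mB BL.
pose F t := RI (fun x => if tau x < t then on B x else 0).
have Fcont : continuous F by exact: cdf_continuous.
have [||t _ <-] := @IVT R F 0 T0 c T00; first exact: continuous_subspaceT.
- have -> : F 0 = 0.
    rewrite /F; under eq_fun do rewrite ltNge tau0.
    by rewrite /rintegral integral0.
  have -> : F T0 = RI (on B).
    congr RI; apply/funext => x; rewrite /ind.
    case: (boolP (B x)) => [/BL/LamT ->//|_]; by case: ifP.
  by case/andP: cB => c0 c1; rewrite ge_min c0 le_max c1 orbT.
exists t; congr RI; apply/funext => x; rewrite /ind.
by case: (tau x < t); rewrite ?andbT ?andbF.
Qed.

(** [B] is the unexplored part of [Lam]; on the explored part both activities vanish. After a slice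
    of mass [c] the process continues with [L \* off B1], times [f x] if a point was met at [x], and
    the induction hypothesis bounds both cases by the same [dl]. The slice adds [2 (eps c)] from
    [mix_dist] and [(lam c)^2] twice from [Phi_mix]. *)
Lemma tv_slices n c (B : T -> bool) (L L' : T -> R) g :
  0 <= c -> measurable_fun setT B -> (forall x, B x -> Lam x) -> RI (on B) = n%:R * c ->
  act L -> act L' -> (forall x, L x <= lam) -> (forall x, L' x <= lam) ->
  (forall x, Lam x -> ~~ B x -> L x = 0) -> (forall x, Lam x -> ~~ B x -> L' x = 0) ->
  obs g -> local g -> close L L' B ->
  `|Phi L g - Phi L' g| <= n%:R * (2 * (eps * c) + 2 * (lam * c) ^+ 2).
Proof.
move=> c0; elim: n B L L' g => [|n IH] B L L' g mB BL RB aL aL' Ll Ll' Lv Lv' og lg cl.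
  have nul K : act K -> (forall x, K x <= lam) ->
      (forall x, Lam x -> ~~ B x -> K x = 0) -> RI (fun x => on Lam x * K x) = 0.
    move=> aK Kl Kv; apply/eqP; rewrite eq_le; apply/andP; split; last first.
    apply: RI_ge0 => x. rewrite mulr_ge0//; last by case: aK. by rewrite /ind; case: ifP.
    apply: (@le_trans _ _ (lam * RI (on B))); last by rewrite RB mul0r mulr0.
    rewrite -RI_Z//; last exact: act_on.
    apply: le_RI; [by apply: actMl => //; exact: frac_on|by apply: actZ => //; exact: act_on|].
    move=> x; rewrite /ind; case: (boolP (B x)) => [Bx|nB].
      by rewrite BL// mul1r mulr1.
    by case: ifP => Lx; rewrite ?mul0r ?mulr0 // Kv// mulr0.
  by rewrite !Phi_null//; [rewrite subrr normr0 mul0r|exact: nul|exact: nul].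
have cB : 0 <= c <= RI (on B).
  by rewrite c0 RB ler_peMl// ler1n.
have [t Rt] := cut_slice mB BL cB.
pose B1 x := B x && (tau x < t).
pose B2 x := B x && ~~ (tau x < t).
have mlt : measurable_fun setT (fun x => tau x < t) by exact: measurable_fun_ltr.
have mB1 : measurable_fun setT B1 by exact: measurable_and.
have mB2 : measurable_fun setT B2 by apply: measurable_and => //; exact: measurable_neg.
have B1B x : B1 x -> B x by case/andP.
have B2B x : B2 x -> B x by case/andP.
have B1L x : B1 x -> Lam x by move=> /B1B/BL.
have B2L x : B2 x -> Lam x by move=> /B2B/BL.
have aB1 := act_on mB1 B1L; have aB2 := act_on mB2 B2L.
have RB2 : RI (on B2) = n%:R * c.
  have : RI (on B) = RI (on B1) + RI (on B2).
    rewrite -RI_D//; congr RI; apply/funext => x; rewrite /ind /B1 /B2.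
    by case: (B x); case: (tau x < t); rewrite /= ?addr0 ?add0r.
  by rewrite RB -/B1 Rt -natr1 mulrDl mul1r addrC => /addrI.
have fo : frac (off B1) by exact: frac_off.
pose K := L \* off B1; pose K' := L' \* off B1.
have aK : act K by exact: actM.
have aK' : act K' by exact: actM.
have qle q (M : T -> R) : frac q -> (forall x, 0 <= M x) -> (forall x, M x <= lam) ->
    forall x, (M \* q) x <= lam.
  move=> [_ q01] M0 Ml x /=; case/andP: (q01 x) => q0 q1.
  by apply: (le_trans _ (Ml x)); rewrite ler_piMr.
have L0 x : 0 <= L x by case: aL.
have L0' x : 0 <= L' x by case: aL'.
have K0 x : 0 <= K x by case: aK.
have K0' x : 0 <= K' x by case: aK'.
have Kl : forall x, K x <= lam by exact: qle.
have Kl' : forall x, K' x <= lam by exact: qle.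
have Kv x : Lam x -> ~~ B2 x -> K x = 0.
  move=> Lx; rewrite /K /= /coind /B1 /B2; case: (boolP (B x)) => Bx /=.
    by rewrite negbK => ->; rewrite mulr0.
  by rewrite Lv// mul0r.
have Kv' x : Lam x -> ~~ B2 x -> K' x = 0.
  move=> Lx; rewrite /K' /= /coind /B1 /B2; case: (boolP (B x)) => Bx /=.
    by rewrite negbK => ->; rewrite mulr0.
  by rewrite Lv'// mul0r.
have clK : close K K' B2 by apply: closeM cl.
pose dl := n%:R * (2 * (eps * c) + 2 * (lam * c) ^+ 2).
have dl0 : 0 <= dl.
  by rewrite mulr_ge0// addr_ge0// mulr_ge0 ?sqr_ge0// mulr_ge0.
have H0 : `|Phi K g - Phi K' g| <= dl by exact: (IH B2).
have H1 x : B1 x -> `|slice_cond mu f B1 L g x - slice_cond mu f B1 L' g x| <= dl.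
  move=> _; have ff := frac_f mf f01 x.
  apply: (IH B2) => //; try exact: actM; try exact: qle.
  - by move=> y Ly By; move: (Kv y Ly By); rewrite /K /= => ->; rewrite mul0r.
  - by move=> y Ly By; move: (Kv' y Ly By); rewrite /K' /= => ->; rewrite mul0r.
  - exact: obs_cons.
  - exact: local_cons.
  - exact: closeM clK.
have H2 x : B1 x -> `|L x * rho (L \* off B1) x - L' x * rho (L' \* off B1) x| <= eps.
  by move=> /B1B; exact: cl.
have H3 := mix_dist mf f01 mB1 aB1 aL aL' og eps0 dl0 H2 H0 H1.
rewrite Rt in H3.
have on_le M : act M -> (forall x, M x <= lam) -> RI (fun x => on B1 x * M x) <= lam * c.
  move=> aM Ml; rewrite -Rt -RI_Z//; apply: le_RI.
  - by apply: actMl => //; exact: frac_on.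
  - exact: actZ.
  - by move=> x; rewrite mulrC ler_wpM2r//; case: aB1.
have H4 := Phi_mix mf f01 fC mB1 aL og (on_le _ aL Ll).
have H5 := Phi_mix mf f01 fC mB1 aL' og (on_le _ aL' Ll').
rewrite -natr1 mulrDl mul1r -/dl.
move: H3 H4 H5; clear; move: (Phi L g) (Phi L' g) (slice_mix _ _ _ _ _) (slice_mix _ _ _ _ _).
move=> P P' M' M H3 H4 H5.
rewrite (_ : P - P' = (P - M) + (M - M') + (M' - P')); last by ring.
apply: (le_trans (ler_normD _ _)).
rewrite (_ : dl + _ = (lam * c) ^+ 2 + (dl + 2 * (eps * c)) + (lam * c) ^+ 2); last by ring.
apply: lerD; last by rewrite distrC.
by apply: (le_trans (ler_normD _ _)); exact: lerD.
Qed.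

(** The quadratic errors of [N] slices sum to [2 (lam V)^2 / N] and disappear as [N] grows. *)
Lemma tv_bound (L L' : T -> R) g :
  act L -> act L' -> (forall x, L x <= lam) -> (forall x, L' x <= lam) ->
  obs g -> local g -> close L L' Lam ->
  `|Phi L g - Phi L' g| <= 2 * (eps * RI (on Lam)).
Proof.
move=> aL aL' Ll Ll' og lg cl.
set V := RI (on Lam).
have V0 : 0 <= V by apply: RI_ge0; case: aLam.
apply/ler_addgt0Pr => e e0.
pose C := 2 * (lam * V) ^+ 2.
have C0 : 0 <= C by rewrite mulr_ge0// sqr_ge0.
pose N := (Num.truncn (C / e)).+1.
have NR : 0 < N%:R :> R by rewrite ltr0n.
have CN : C / e < N%:R by exact: truncnS_gt.
have c0 : 0 <= V / N%:R by rewrite divr_ge0.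
have RV : RI (on Lam) = N%:R * (V / N%:R) by rewrite mulrCA divff ?mulr1// gt_eqF.
have vac (M : T -> R) x : Lam x -> ~~ Lam x -> M x = 0 by move=> ->.
apply: (le_trans (@tv_slices N (V / N%:R) Lam L L' g c0 mLam (fun _ => id) RV aL aL' Ll Ll'
  (vac L) (vac L') og lg cl)).
have -> : N%:R * (2 * (eps * (V / N%:R)) + 2 * (lam * (V / N%:R)) ^+ 2) =
    2 * (eps * V) + C / N%:R by rewrite /C; field; rewrite gt_eqF.
rewrite lerD2l ler_pdivrMr// -ler_pdivrMl// mulrC; exact: ltW.
Qed.

End total_variation_induction.

(** * Lebesgue measure on tuples *)

Section lebesgue_tuple.
Context {R : realType}.
Local Notation leb := (@lebesgue_measure R).

Section lebesgue_tuple_step.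
Variables (n : nat) (nu : {sigma_finite_measure set (n.-tuple R) -> \bar R}).

Definition consp (p : R * n.-tuple R) : n.+1.-tuple R := cons_tuple p.1 p.2.

Lemma measurable_consp : measurable_fun setT consp.
Proof.
apply/measurable_fun_tnthP => i /=; case: (unliftP ord0 i) => [j ->|->].
  rewrite (_ : _ \o _ = (fun x => tnth x j) \o snd).
    by apply: measurableT_comp => //; exact: measurable_tnth.
  by apply/funext => p /=; rewrite tnthS.
by rewrite (_ : _ \o _ = fst).
Qed.

Definition uncons (x : n.+1.-tuple R) : R * n.-tuple R := (thead x, [tuple of behead x]).

Lemma measurable_uncons : measurable_fun setT uncons.
Proof.
by apply: measurable_fun_pair; [exact: measurable_tnth|exact: measurable_behead].
Qed.

Lemma conspK : cancel consp uncons.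
Proof. by move=> [t x]; congr pair; exact: val_inj. Qed.

Definition lebn_step : set (n.+1.-tuple R) -> \bar R := pushforward (leb \x nu)%E consp.

Let m0 : lebn_step set0 = 0%E.
Proof. by rewrite /lebn_step /pushforward preimage_set0 measure0. Qed.

Let mge0 A : (0 <= lebn_step A)%E.
Proof. exact: (@measure_ge0 _ _ _ (leb \x nu)%E). Qed.

Let msa : semi_sigma_additive lebn_step.
Proof. apply: (@measure_semi_sigma_additive _ _ _ (pushforward (leb \x nu)%E consp)). exact: measurable_consp. Qed.

HB.instance Definition _ := isMeasure.Build _ _ _ lebn_step m0 mge0 msa.

Let msf : sigma_finite setT lebn_step.
Proof.
have /sigma_finiteP[F [FT Fnd Fy]] := sigma_finiteT (leb : {sigma_finite_measure set _ -> \bar R}).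
have /sigma_finiteP[G [GT Gnd Gy]] := sigma_finiteT nu.
exists (fun i => uncons @^-1` (F i `*` G i)).
  apply/esym; rewrite -subTset => x _.
  have [i _ Fi] : (\bigcup_i F i) (uncons x).1 by rewrite -FT.
  have [j _ Gj] : (\bigcup_i G i) (uncons x).2 by rewrite -GT.
  exists (maxn i j) => //; split.
    by move: (uncons x).1 Fi; exact/subsetPset/Fnd/leq_maxl.
  by move: (uncons x).2 Gj; exact/subsetPset/Gnd/leq_maxr.
move=> i; have [mF Fi] := Fy i; have [mG Gi] := Gy i; split.
  rewrite -[X in measurable X]setTI; apply: measurable_uncons => //.
  exact: measurableX.
rewrite /lebn_step /pushforward -comp_preimage.
rewrite (_ : uncons \o consp = id); last by apply/funext => p; exact: conspK.
by rewrite preimage_id product_measure1E// lte_mul_pinfty// ge0_fin_numE.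
Qed.

HB.instance Definition _ := Measure_isSigmaFinite.Build _ _ _ lebn_step msf.

Lemma integral_lebn_step (f : n.+1.-tuple R -> \bar R) :
  measurable_fun setT f -> (forall x, 0 <= f x)%E ->
  (\int[lebn_step]_x f x = \int[leb]_t \int[nu]_y f (cons_tuple t y))%E.
Proof.
move=> mf f0.
have mfc : measurable_fun setT (f \o consp) by exact: measurableT_comp mf measurable_consp.
transitivity (\int[pushforward (leb \x nu)%E consp]_x f x)%E.
  by apply: eq_measure_integral => //; exact: measurable_consp.
rewrite ge0_integral_pushforward//; last exact: measurable_consp.
rewrite preimage_setT (@fubini_tonelli1 _ _ _ _ _ leb nu (f \o consp))// => x; exact: f0.
Qed.

End lebesgue_tuple_step.

Definition lebn0 : {sigma_finite_measure set (0.-tuple R) -> \bar R} := dirac [tuple].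

(** A sigma-finite measure representing the iterated integral [intR], so that Tonelli and dominated
    convergence apply; see [intR_lebn]. *)
Fixpoint lebn n : {sigma_finite_measure set (n.-tuple R) -> \bar R} :=
  match n with
  | 0 => lebn0
  | n'.+1 => lebn_step (lebn n')
  end.

Lemma integral_lebnS n (f : n.+1.-tuple R -> \bar R) :
  measurable_fun setT f -> (forall x, 0 <= f x)%E ->
  (\int[lebn n.+1]_x f x = \int[leb]_t \int[lebn n]_y f (cons_tuple t y))%E.
Proof. exact: integral_lebn_step. Qed.

Lemma intR_lebn n (f : n.-tuple R -> \bar R) :
  measurable_fun setT f -> (forall x, 0 <= f x)%E ->
  intR f = (\int[lebn n]_x f x)%E.
Proof.
elim: n f => [|n IH] f mf f0.
  by rewrite /= integral_dirac//= diracT mul1e.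
rewrite integral_lebnS//=; apply: eq_integral => t _.
apply: IH => //.
exact: (measurable_fun_sec t (measurableT_comp mf (@measurable_consp n))).
Qed.

(** Translation preserves the lengths of half-open intervals, which determine Lebesgue measure. *)
Lemma integral_leb_shift (f : R -> \bar R) (c : R) :
  measurable_fun setT f -> (forall x, 0 <= f x)%E ->
  (\int[leb]_t f (t - c)%R = \int[leb]_t f t)%E.
Proof.
move=> mf f0.
pose sh := (fun t : R => t - c) : measurableTypeR R -> measurableTypeR R.
have msh : measurable_fun setT sh by apply: measurable_funB => //; exact: measurable_cst.
have shE A : measurable A -> leb A = pushforward leb sh A.
  apply: lebesgue_measure_unique => //= _ [[a b]] _ <-.
  rewrite /pushforward.
  have -> : sh @^-1` `]a, b]%classic = `]a + c, b + c]%classic.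
    apply/seteqP; split => x /=; rewrite !in_itv/= /sh;
    by rewrite ltrBrDr lerBlDr.
  rewrite !lebesgue_measure_itv/= !lte_fin ltrD2r.
  by case: ifP => // _; rewrite -!EFinB; congr EFin; ring.
transitivity (\int[pushforward leb sh]_t f t)%E.
  by rewrite ge0_integral_pushforward.
by apply: eq_measure_integral => // A mA _; exact/esym/shE.
Qed.

End lebesgue_tuple.

(** * Euclidean norm, translations and spheres *)

Section euclid.
Context {R : realType}.
Local Notation leb := (@lebesgue_measure R).

Lemma tnth_psub d (x y : d.-tuple R) i : tnth (psub x y) i = tnth x i - tnth y i.
Proof. by rewrite tnth_mktuple. Qed.

Lemma psub_shift d (x y a : d.-tuple R) : psub (psub x a) (psub y a) = psub x y.
Proof. by apply: eq_from_tnth => i; rewrite !tnth_psub; ring. Qed.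

Lemma psub_self d (x : d.-tuple R) : psub x x = pzero R d.
Proof.
apply: eq_from_tnth => i; rewrite tnth_psub subrr (tnth_nth 0) /= nth_nseq.
by case: ifP.
Qed.

Lemma popp_psub d (x y : d.-tuple R) : popp (psub x y) = psub y x.
Proof. by apply: eq_from_tnth => i; rewrite tnth_mktuple !tnth_psub opprB. Qed.

Lemma enorm_popp d (x : d.-tuple R) : enorm (popp x) = enorm x.
Proof. by congr Num.sqrt; apply: eq_bigr => i _; rewrite tnth_mktuple sqrrN. Qed.

Lemma enorm_psubC d (x y : d.-tuple R) : enorm (psub x y) = enorm (psub y x).
Proof. by rewrite -enorm_popp popp_psub. Qed.

Lemma enorm_ge0 d (x : d.-tuple R) : 0 <= enorm x.
Proof. exact: sqrtr_ge0. Qed.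

Lemma psub_cons d t (y : d.-tuple R) (a : d.+1.-tuple R) :
  psub (cons_tuple t y) a = cons_tuple (t - thead a) (psub y [tuple of behead a]).
Proof.
apply: eq_from_tnth => i; rewrite tnth_psub; case: (unliftP ord0 i) => [j ->|->].
  by rewrite !tnthS tnth_psub [a in LHS]tuple_eta tnthS.
by [].
Qed.

Lemma measurable_psub d dP (P : measurableType dP) (u v : P -> d.-tuple R) :
  measurable_fun setT u -> measurable_fun setT v ->
  measurable_fun setT (fun p => psub (u p) (v p)).
Proof.
move=> mu mv; apply/measurable_fun_tnthP => i /=.
rewrite (_ : _ \o _ = (fun p => tnth (u p) i - tnth (v p) i)); last first.
  by apply/funext => p; rewrite /= tnth_psub.
apply: measurable_funB.
  exact: (measurableT_comp (measurable_tnth i) mu).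
exact: (measurableT_comp (measurable_tnth i) mv).
Qed.

Lemma measurable_enorm d : measurable_fun setT (@enorm R d).
Proof.
have msq : measurable_fun setT (@Num.sqrt R).
  by apply: continuous_measurable_fun; exact: sqrt_continuous.
apply: (measurableT_comp msq); apply: measurable_sum => i.
by apply: measurable_funX; exact: measurable_tnth.
Qed.

Lemma cauchy_schwarz_sum (I : finType) (a b : I -> R) :
  (\sum_i a i * b i) ^+ 2 <= (\sum_i a i ^+ 2) * (\sum_i b i ^+ 2).
Proof.
set A := \sum_i a i ^+ 2; set B := \sum_i b i ^+ 2; set S := \sum_i a i * b i.
have B0 : 0 <= B by apply: sumr_ge0 => i _; exact: sqr_ge0.
have [Bz|Bn0] := eqVneq B 0.
  have b0 i : b i = 0.
    apply/eqP; rewrite -sqrf_eq0; move: Bz => /eqP.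
    rewrite psumr_eq0 => [/allP/(_ i)|j _]; last exact: sqr_ge0.
    by rewrite mem_index_enum => /(_ isT).
  by rewrite Bz mulr0 /S big1 ?expr0n// => i _; rewrite b0 mulr0.
have Bp : 0 < B by rewrite lt_neqAle eq_sym Bn0.
have : 0 <= \sum_i (B * a i - S * b i) ^+ 2 by apply: sumr_ge0 => i _; exact: sqr_ge0.
have -> : \sum_i (B * a i - S * b i) ^+ 2 = B * (A * B - S ^+ 2).
  transitivity (\sum_i (B ^+ 2 * a i ^+ 2 + - (2 * B * S) * (a i * b i) + S ^+ 2 * b i ^+ 2)).
    by apply: eq_bigr => i _; ring.
  by rewrite !big_split/= -!mulr_sumr -/A -/B -/S; ring.
by rewrite pmulr_rge0// subr_ge0.
Qed.

Lemma enorm_triangle d (x y z : d.-tuple R) :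
  enorm (psub x z) <= enorm (psub x y) + enorm (psub y z).
Proof.
rewrite -[leRHS]ger0_norm ?addr_ge0 ?enorm_ge0// -sqrtr_sqr ler_sqrt ?sqr_ge0//.
have ss (u : d.-tuple R) : enorm u ^+ 2 = \sum_i tnth u i ^+ 2.
  by rewrite sqr_sqrtr//; apply: sumr_ge0 => i _; exact: sqr_ge0.
rewrite sqrrD !ss.
have -> : \sum_i tnth (psub x z) i ^+ 2 = \sum_i tnth (psub x y) i ^+ 2 +
    (\sum_i tnth (psub x y) i * tnth (psub y z) i) *+ 2 + \sum_i tnth (psub y z) i ^+ 2.
  rewrite -sumrMnl -!big_split/=; apply: eq_bigr => i _; rewrite !tnth_psub.
  by rewrite mulr2n; ring.
rewrite lerD2r lerD2l lerMn2r/=; apply: (le_trans (ler_norm _)).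
rewrite -sqrtr_sqr -sqrtrM; last by apply: sumr_ge0 => i _; exact: sqr_ge0.
by apply: ler_wsqrtr; exact: cauchy_schwarz_sum.
Qed.

Lemma lebn_shift d (a : d.-tuple R) (f : d.-tuple R -> \bar R) :
  measurable_fun setT f -> (forall x, 0 <= f x)%E ->
  (\int[lebn d]_x f (psub x a) = \int[lebn d]_x f x)%E.
Proof.
move=> mf f0.
have mp : measurable_fun setT (fun x : d.-tuple R => psub x a) by exact: measurable_psub.
rewrite -!intR_lebn//; last exact: (measurableT_comp mf mp).
move: mp => _.
elim: d a f mf f0 => [|d IH] a f mf f0 /=; first by congr f; exact: tuple0.
have mfc : measurable_fun setT (f \o @consp R d) by exact: (measurableT_comp mf (@measurable_consp _ d)).
have mft t : measurable_fun setT (fun y : d.-tuple R => f (cons_tuple t y)).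
  exact: (measurable_fun_sec t mfc).
pose G (t : R) := intR (fun y : d.-tuple R => f (cons_tuple t y)).
transitivity (\int[leb]_t G (t - thead a)%R)%E.
  apply: eq_integral => t _.
  rewrite /G -(IH [tuple of behead a] (fun y => f (cons_tuple (t - thead a : R) y)))//.
  by congr intR; apply/funext => y; rewrite -psub_cons.
apply: integral_leb_shift.
  rewrite /G; under eq_fun do rewrite intR_lebn//.
  by apply: (@measurable_fun_fubini_tonelli_F _ _ _ _ _ (lebn d) _ mfc) => x; exact: f0.
by move=> t; rewrite /G intR_lebn//; exact: integral_ge0.
Qed.

(** With the other coordinates fixed, the first one takes at most two values on a sphere. In
    dimension 0 the sphere of radius 0 is the whole space, hence [d.+1]. *)
Lemma lebn_sphere d (v : d.+1.-tuple R) (t : R) :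
  lebn d.+1 [set x | enorm (psub x v) = t] = 0%E.
Proof.
set S := [set x | _].
have mS : measurable S.
  have mp : measurable_fun setT (fun x : d.+1.-tuple R => psub x v) by exact: measurable_psub.
  have me : measurable_fun setT (fun x : d.+1.-tuple R => enorm (psub x v)).
    exact: (measurableT_comp (@measurable_enorm _) mp).
  by rewrite -[S]setTI; exact: (me measurableT [set t]).
have mI : measurable_fun setT (fun x => (\1_S x)%:E : \bar R).
  by apply/measurable_EFinP; exact: measurable_indic.
rewrite -[S]setIT -integral_indic//.
rewrite integral_lebnS//.
have mIc : measurable_fun setT ((fun x => (\1_S x)%:E : \bar R) \o @consp R d).
  exact: (measurableT_comp mI (@measurable_consp _ d)).
rewrite (@fubini_tonelli _ _ _ _ _ leb (lebn d) ((fun x => (\1_S x)%:E : \bar R) \o @consp R d))//; last first.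
  by move=> x; rewrite lee_fin.
apply: integral0_eq => y _.
pose N := (fun t0 : R => consp (t0, y)) @^-1` S.
have mN : measurable N.
  rewrite -[N]setTI.
  have h := measurableT_comp (@measurable_consp R d) (pair2_measurable y).
  exact: (h measurableT S mS).
rewrite (_ : (fun x => _) = (fun x => (\1_N x)%:E)); last by apply/funext.
rewrite integral_indic// setIT; apply: countable_lebesgue_measure0.
pose K := t ^+ 2 - \sum_(i < d) tnth (psub y [tuple of behead v]) i ^+ 2.
apply/finite_set_countable/(sub_finite_set (B := [set thead v + Num.sqrt K; thead v - Num.sqrt K])).
  move=> x; rewrite /N /S /= /consp /= psub_cons /enorm big_ord_recl /=.
  under eq_bigr do rewrite tnthS.
  move=> Ht.
  have : (x - thead v) ^+ 2 = K.
    rewrite /K -Ht sqr_sqrtr; last first.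
      by rewrite addr_ge0 ?sqr_ge0//; apply: sumr_ge0 => i _; exact: sqr_ge0.
    by rewrite addrK.
  move=> HK; have : (x - thead v) ^+ 2 = Num.sqrt K ^+ 2 by rewrite sqr_sqrtr// -HK sqr_ge0.
  move/eqP; rewrite eqf_sqr => /orP[] /eqP Hx.
    by left; rewrite -Hx addrC subrK.
  by right; rewrite -Hx addrC subrK.
by rewrite finite_setU; split; exact: finite_set1.
Qed.

End euclid.

(** * The Gibbs measures of pair potentials *)

Section interface.
Context {R : realType} (d : nat) (phi : d.-tuple R -> \bar R).
Local Notation pt := (d.-tuple R).
Local Notation mu := (@lebn R d).
Hypotheses (pphi : pair_potential phi) (rphi : repulsive phi).

(** The Boltzmann factor [e^{-phi}], so that [1 - mayer] is the weight of a step in [V_k]; the Mayer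
    function proper is [mayer - 1]. For repulsive [phi] the exponential lies in [[0, 1]] and [fine]
    loses nothing. *)
Definition mayer (x y : pt) : R := fine (expeR (- phi (psub y x))).

Lemma mayerE x y : (mayer x y)%:E = expeR (- phi (psub y x)).
Proof. by rewrite /mayer; have := rphi (psub y x); case: (phi _) => //= r. Qed.

Lemma mayer01 x y : 0 <= mayer x y <= 1.
Proof.
rewrite -2!lee_fin mayerE expeR_ge0/=; have := rphi (psub y x).
case: (phi _) => //= r; rewrite ?lee_fin// => r0.
by rewrite expR_le1 oppr_le0.
Qed.

Lemma mayerC x y : mayer x y = mayer y x.
Proof. by rewrite /mayer (pphi.2 (psub y x)) popp_psub. Qed.

Lemma measurable_mayer : measurable_fun setT (fun z : pt * pt => mayer z.1 z.2).
Proof.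
have [mphi _] := pphi.
have mp : measurable_fun setT (fun z : pt * pt => phi (psub z.2 z.1)).
  by apply: (measurableT_comp mphi); exact: measurable_psub.
(* [fine] sends [+oo] to 0, whose exponential is 1; the hard core, where the factor is 0, is treated
   apart. *)
rewrite (_ : (fun z => _) = (fun z : pt * pt =>
    if (+oo <= phi (psub z.2 z.1))%E then 0 else expR (- fine (phi (psub z.2 z.1))))).
  apply: measurable_fun_ifT => //.
    apply: (measurable_fun_bool true); rewrite setTI.
    by rewrite -[X in measurable X]setTI; exact: emeasurable_fun_c_infty.
  apply: measurableT_comp => //; apply: measurableT_comp => //.
  exact: (measurableT_comp (fine_measurable measurableT) mp).
apply/funext => z; rewrite /mayer; have := rphi (psub z.2 z.1).
by case: (phi _) => [r| |] //= _; rewrite leye_eq.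
Qed.

Lemma intpts_iint k dP (P : measurableType dP) (G : P -> seq pt -> R) p :
  (forall p s, 0 <= G p s) -> mseq k G ->
  intpts (fun x : k.-tuple pt => (G p x)%:E) = iint mu k (G p).
Proof.
elim: k dP P G p => [//|k IH] dP P G p G0 mG /=.
transitivity (intd (fun x : pt => iint mu k (fun s => G p (x :: s)))).
  congr intd; apply/funext => x.
  exact: (IH _ _ (fun (px : P * pt) s => G px.1 (px.2 :: s)) (p, x)).
rewrite /intd intR_lebn//; last by move=> x; exact: iint_ge0.
exact: measurable_iint_cons mG.
Qed.

Lemma expeR_sumN (I : Type) (s : seq I) (Q : pred I) (F : I -> \bar R) :
  (forall i, 0 <= F i)%E ->
  expeR (- \sum_(i <- s | Q i) F i)%E = (\prod_(i <- s | Q i) expeR (- F i))%E.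
Proof.
move=> F0; elim: s => [|i s IH]; first by rewrite !big_nil oppe0 expeR0.
rewrite !big_cons; case: ifP => // _.
rewrite oppeD ?expeRD ?IH//; apply: ge0_adde_def; rewrite inE//.
exact: sume_ge0.
Qed.

Lemma boltz_tuple k (x : k.-tuple pt) : (boltz mayer x)%:E = expeR (- energy phi x).
Proof.
elim: k x => [|k IH] x; first by rewrite tuple0 /energy big_ord0 oppe0 expeR0.
case/tupleP: x => x t.
have -> : energy phi [tuple of x :: t] = (\sum_(j < k) phi (psub x (tnth t j)) + energy phi t)%E.
  rewrite /energy big_ord_recl; congr (_ + _)%E.
    rewrite big_mkcond big_ord_recl /= add0e; apply: eq_bigr => j _.
    by rewrite tnthS.
  apply: eq_bigr => i _; rewrite big_mkcond big_ord_recl /= add0e [RHS]big_mkcond.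
  by apply: eq_bigr => j _; rewrite !tnthS.
rewrite oppeD; last first.
  apply: ge0_adde_def; rewrite inE; first exact: sume_ge0.
  by apply: sume_ge0 => i _; exact: sume_ge0.
rewrite expeRD -IH expeR_sumN//= EFinM; congr (_ * _)%E.
rewrite big_tuple -prodEFin; apply: eq_bigr => j _.
by rewrite mayerC mayerE.
Qed.

Lemma weightE lam k (x : k.-tuple pt) : weight phi lam x = (wt mayer lam x)%:E.
Proof. by rewrite /weight /wt EFinM boltz_tuple big_tuple. Qed.

Local Notation mm := measurable_mayer.
Local Notation act := (nnintegrable mu).
Local Notation zp := (Zpart mu mayer).
Local Notation Phi := (gibbs_mean mu mayer).

Lemma partition_fnE lam : act lam -> partition_fn phi lam = (zp lam)%:E.
Proof.
move=> al; rewrite /Zpart -Z_EFin//; [|exact: mm|exact: mayer01|exact: obs1].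
have w0 k : (0 <= (k`!%:R^-1)%:E * iint mu k (fun s => (wt mayer lam s * 1)%R))%E.
  apply: mule_ge0; first by rewrite lee_fin invr_ge0.
  by apply: iint_ge0 => s; rewrite mulr1; apply: wt_ge0 => //; [exact: mayer01|case: al].
rewrite /gsum nneseries_recl//= /wt big_nil !mulr1 fact0 invr1 mul1e /partition_fn.
congr (_ + _)%E; apply: eq_eseriesr => k _; congr (_ * _)%E.
rewrite (_ : weight phi lam (k := k) = fun x => (wt mayer lam x)%:E); last by apply/funext => x; exact: weightE.
rewrite (@intpts_iint k _ _ (fun (_ : unit) => wt mayer lam) tt).
- by apply: eq_iint => s; rewrite mulr1.
- by move=> _ s; apply: wt_ge0 => //; [exact: mayer01|case: al].
- by apply: (@cmeas_wt _ _ _ _ mm _ _ (fun _ => lam)); apply: jmeas_cst; case: al.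
Qed.

Definition ev (E : set (set pt)) (s : seq pt) : R := \1_E [set x | x \in s].

Lemma tsetE k (x : k.-tuple pt) : tset x = [set y | y \in tval x].
Proof.
apply/seteqP; split => y /=; first by move=> [i _ <-]; exact: mem_tnth.
by move=> /tnthP[i ->]; exists i.
Qed.

Lemma gibbsE lam E : act lam -> obs (ev E) -> gibbs phi lam E = (Phi lam (ev E))%:E.
Proof.
move=> al oE.
have z0 := zp_gt0 mm mayer01 al.
have zi0 : 0 <= (zp lam)^-1 by rewrite invr_ge0 ltW.
have cm := cmeas_wtg mm al oE.
have w0 (_ : unit) s : 0 <= wt mayer lam s * ev E s by exact: (wtg_ge0 mayer01 s al oE).
rewrite /gibbs_mean mulrC EFinM -Z_EFin//; [|exact: mm|exact: mayer01].
rewrite -(@gsumZl _ _ _ mu _ _ (fun (_ : unit) s => wt mayer lam s * ev E s) _ tt)//.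
apply: eq_eseriesr => k _; congr (_ * _)%E.
rewrite -(@intpts_iint k _ _ (fun (_ : unit) s => (zp lam)^-1 * (wt mayer lam s * ev E s)) tt).
- congr intpts; apply/funext => x; rewrite weightE partition_fnE// inver gt_eqF//.
  by rewrite -!EFinM tsetE /ev; congr EFin; ring.
- by move=> _ s; apply: mulr_ge0 => //; exact: w0.
- by apply: mseqM => //; exact: mseq_param.
Qed.

(** Joint measurability in a tuple is turned into [mseq] one point at a time, the prefix [a p]
    collecting the points that have become parameters. *)
Lemma cmeas_tuple (h : seq pt -> R) :
  (forall k, measurable_fun setT (fun x : k.-tuple pt => h x)) ->
  cmeas (fun _ : unit => h).
Proof.
move=> mh k.
suff H dP (P : measurableType dP) m (a : P -> m.-tuple pt) : measurable_fun setT a ->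
    mseq k (fun p s => h (a p ++ s)).
  exact: (H _ unit 0%N (fun=> [tuple])).
elim: k dP P m a => [|k IH] dP P m a ma /=.
  by under eq_fun do rewrite cats0; exact: (measurableT_comp (mh m) ma).
have mr : measurable_fun setT (fun px : P * pt => [tuple of rcons (a px.1) px.2]).
  apply/measurable_fun_tnthP => i /=.
  case: (ltnP i m) => im.
    rewrite (_ : _ \o _ = (fun px : P * pt => tnth (a px.1) (Ordinal im))).
      apply: (measurableT_comp (measurable_tnth (Ordinal im))).
      exact: measurableT_comp.
    apply/funext => px /=; rewrite (tnth_nth px.2) /= nth_rcons size_tuple im.
    by rewrite (tnth_nth px.2).
  rewrite (_ : _ \o _ = snd)//.
  apply/funext => px /=; rewrite (tnth_nth px.2) /= nth_rcons size_tuple ltnNge im/=.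
  by case: ifP.
have := IH _ _ _ _ mr.
by congr (mseq k); apply/funext => px; apply/funext => s; rewrite /= cat_rcons.
Qed.

(** The first point is either kept or dropped, which splits the function into two terms with
    indicator factors. *)
Lemma cmeas_filter (Q : pt -> bool) dP (P : measurableType dP) (H : P -> seq pt -> R) :
  measurable_fun setT Q -> cmeas H -> cmeas (fun p s => H p [seq x <- s | Q x]).
Proof.
move=> mQ mH k; elim: k dP P H mH => [|k IH] dP P H mH /=; first exact: (mH 0%N).
have mQ2 : measurable_fun setT (fun px : P * pt => Q px.2) by exact: measurableT_comp.
have i1 : mseq k (fun (px : P * pt) s => (if Q px.2 then 1 else 0) *
    H px.1 (px.2 :: [seq x <- s | Q x])).
  apply: mseqM; first by apply: mseq_param; exact: measurable_fun_ifT.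
  apply: (IH _ _ (fun (px : P * pt) s => H px.1 (px.2 :: s))).
  by move=> j; exact: (mH j.+1).
have i2 : mseq k (fun (px : P * pt) s => (if Q px.2 then 0 else 1) *
    H px.1 [seq x <- s | Q x]).
  apply: mseqM; first by apply: mseq_param; exact: measurable_fun_ifT.
  apply: (IH _ _ (fun (px : P * pt) => H px.1)).
  by refine (@cmeas_reparam _ _ _ _ _ _ _ _ H (@fst P pt) _ _).
have := mseqD i1 i2.
congr (mseq k); apply/funext => px; apply/funext => s /=.
by case: (Q px.2); rewrite ?mul1r ?mul0r ?addr0 ?add0r.
Qed.

Lemma ev_filter (L : set pt) A s :
  ev (restr_event L A) s = ev A [seq x <- s | x \in L].
Proof.
have E : [set x | x \in s] `&` L = [set x | x \in [seq x <- s | x \in L]].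
  apply/seteqP; split => x /=; rewrite mem_filter.
    by move=> [xs Lx]; rewrite xs andbT; exact/mem_set.
  by move=> /andP[/set_mem Lx xs].
by rewrite /ev !indicE -E.
Qed.

Lemma measurable_mem_set (L : set pt) : measurable L ->
  measurable_fun setT (fun x => x \in L).
Proof.
move=> mL; apply: (measurable_fun_bool true); rewrite setTI.
by rewrite (_ : _ @^-1` _ = L)//; apply/seteqP; split => x /=; [exact: set_mem|exact: mem_set].
Qed.

Lemma obs_ev (L : set pt) A : measurable L -> config_event A -> obs (ev (restr_event L A)).
Proof.
move=> mL cA; split.
- apply: (@cmeas_ext _ _ _ _ _ _ (fun (_ : unit) s => ev A [seq x <- s | x \in L])).
    by move=> _ s; rewrite ev_filter.
  apply: (@cmeas_filter (fun x => x \in L) _ _ (fun _ : unit => ev A)); first exact: measurable_mem_set.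
  apply: cmeas_tuple => k.
  rewrite (_ : (fun x => _) = \1_[set x : k.-tuple pt | A (tset x)]); last first.
    by apply/funext => x; rewrite /ev !indicE -tsetE.
  by apply: measurable_indic; exact: cA.
- move=> s x y t; have E z : (z \in s ++ x :: y :: t) = (z \in s ++ y :: x :: t).
    by rewrite !mem_cat !inE; congr orb; exact: orbCA.
  rewrite /ev (_ : [set z | z \in s ++ x :: y :: t] = [set z | z \in s ++ y :: x :: t])//.
  by apply/seteqP; split => z /=; rewrite E.
- by move=> s; rewrite /ev indicE; case: (_ \in _); rewrite ?ler01 ?lexx.
Qed.

Lemma local_ev (L : set pt) A : local (fun x => x \in L) (ev (restr_event L A)).
Proof. by move=> s; rewrite !ev_filter filter_id. Qed.

Definition edist (x y : pt) : R := enorm (psub x y).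

Lemma measurable_dist : measurable_fun setT (fun z : pt * pt => edist z.1 z.2).
Proof. by rewrite /edist; apply: (measurableT_comp (@measurable_enorm R d)); exact: measurable_psub. Qed.

Local Notation U := (tree_int mu mayer edist).
Local Notation damp := (damping mayer edist).

(** The integrand of [tree_int], gathered into one function of the path that starts at [v] and
    visits [s]. *)
Fixpoint Ur (m : pt -> R) (v : pt) (s : seq pt) : R :=
  match s with
  | [::] => 1
  | w :: t => (1 - mayer v w) * m w * Ur (m \* damp v w) w t
  end.

Let damp01 v w x : 0 <= damp v w x <= 1.
Proof. by rewrite /damping /below; case: ifP; rewrite ?mayer01 ?ler01 ?lexx. Qed.

Let kap0 v w : 0 <= 1 - mayer v w.
Proof. by rewrite subr_ge0; case/andP: (mayer01 v w). Qed.

Lemma Ur_ge0 m v s : (forall x, 0 <= m x) -> 0 <= Ur m v s.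
Proof.
elim: s m v => [|w s IH] m v m0 //=; rewrite mulr_ge0 ?mulr_ge0 ?IH// => x /=.
by rewrite mulr_ge0//; case/andP: (damp01 v w x).
Qed.

Lemma mseq_Ur k dP (P : measurableType dP) (m : P -> pt -> R) (v : P -> pt) :
  jmeas m -> measurable_fun setT v -> mseq k (fun p => Ur (m p) (v p)).
Proof.
elim: k dP P m v => [|k IH] dP P m v jm mv /=; first exact: measurable_cst.
have mv1 : measurable_fun setT (v \o @fst P pt) by exact: measurableT_comp.
apply: mseqM.
  apply: mseq_param; apply: measurable_funM => //; apply: measurable_funB => //.
  exact: (measurableT_comp measurable_mayer (measurable_fun_pair mv1 (measurable_snd))).
apply: (IH _ _ (fun z : P * pt => m z.1 \* damp (v z.1) z.2) snd) => //.
apply: jmeasM; first exact: (jmeas_reparam (L := m)).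
exact: (jmeas_damp measurable_mayer measurable_dist mv1).
Qed.

Lemma U_iint k (m : pt -> R) v : measurable_fun setT m -> (forall x, 0 <= m x) ->
  U k m v = iint mu k (Ur m v).
Proof.
suff H dP (P : measurableType dP) (M : P -> pt -> R) (w : P -> pt) p :
    jmeas M -> (forall p x, 0 <= M p x) -> measurable_fun setT w ->
    U k (M p) (w p) = iint mu k (Ur (M p) (w p)).
  by move=> mm0 m0; apply: (H _ unit (fun=> m) (fun=> v) tt) => //; exact: jmeas_cst.
elim: k dP P M w p => [//|k IH] dP P M w p jM M0 mw /=.
apply: eq_integral => x _.
have mw1 : measurable_fun setT (w \o @fst P pt) by exact: measurableT_comp.
have jM' : jmeas (fun z : P * pt => M z.1 \* damp (w z.1) z.2).
  apply: jmeasM; first exact: (jmeas_reparam (L := M)).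
  exact: (jmeas_damp measurable_mayer measurable_dist mw1).
have M'0 (z : P * pt) y : 0 <= (M z.1 \* damp (w z.1) z.2) y.
  by rewrite /= mulr_ge0//; case/andP: (damp01 (w z.1) z.2 y).
rewrite (IH _ _ (fun z : P * pt => M z.1 \* damp (w z.1) z.2) snd (p, x))//.
rewrite -(@iintZl _ _ _ mu k _ _ (fun z : P * pt => Ur (M z.1 \* damp (w z.1) z.2) z.2) _ (p, x))//.
- by rewrite mulr_ge0.
- by move=> z s; apply: Ur_ge0.
- exact: mseq_Ur.
Qed.

(** [mayer] and [edist] depend on differences only and [lebn] is translation invariant. For [m = 1]
    the path integrals are thus independent of the starting point, and [V_k], which starts at the
    origin, serves for all of them. *)
Lemma U_shift k (m : pt -> R) (a v : pt) : measurable_fun setT m -> (forall x, 0 <= m x) ->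
  U k (fun x => m (psub x a)) v = U k m (psub v a).
Proof.
elim: k m v => [//|k IH] m v mm0 m0 /=.
have mU : measurable_fun setT (fun w => (((1 - mayer (psub v a) w) * m w)%:E *
    U k (m \* damp (psub v a) w)%R w)%E).
  apply: emeasurable_funM.
    apply/measurable_EFinP; apply: measurable_funM => //.
    by apply: measurable_funB => //; exact: (measurable_fun_sec (psub v a) measurable_mayer).
  apply: (@measurable_U _ _ _ mu _ measurable_mayer mayer01 _ measurable_dist k _ _
    (fun w => m \* damp (psub v a) w) id) => //.
    apply: jmeasM; first exact: jmeas_cst.
    exact: (@jmeas_damp _ _ _ _ measurable_mayer _ measurable_dist _ pt (fun=> psub v a) id).
  by move=> w x /=; rewrite mulr_ge0//; case/andP: (damp01 (psub v a) w x).
rewrite -(lebn_shift a mU); last first.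
  move=> w; apply: mule_ge0; first by rewrite lee_fin mulr_ge0.
  apply: (@U_ge0 _ _ _ mu _ measurable_mayer mayer01 _ measurable_dist) => x /=.
  by rewrite mulr_ge0//; case/andP: (damp01 (psub v a) w x).
apply: eq_integral => w _; congr (_ * _)%E.
  by rewrite /mayer psub_shift.
rewrite -IH.
- congr tree_int; apply/funext => x /=; congr (_ * _).
  by rewrite /damping /below /mayer /edist !psub_shift.
- apply: measurable_funM => //.
  by case: (frac_damp measurable_mayer mayer01 measurable_dist (psub v a) (psub w a)).
- by move=> x /=; rewrite mulr_ge0//; case/andP: (damp01 (psub v a) (psub w a) x).
Qed.

End interface.

(** * The connective constant *)

Section connective.
Context {R : realType} (d : nat) (phi : d.-tuple R -> \bar R).
Local Notation pt := (d.-tuple R).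
Local Notation mu := (@lebn R d).
Hypotheses (pphi : pair_potential phi) (rphi : repulsive phi).
Local Notation mayer := (mayer phi).
Local Notation damp := (damping mayer (@edist R d)).
Local Notation U := (tree_int mu mayer (@edist R d)).
Local Notation Ur := (Ur phi).
Local Notation o := (pzero R d).

(** The damping felt at [x] after the path [p], which has [(size p).-1] steps. *)
Let hist (p : seq pt) x := \prod_(0 <= i < (size p).-1) damp (nth o p i) (nth o p i.+1) x.

Let factor (w : seq pt) j := \prod_(0 <= i < j.-1) damp (nth o w i) (nth o w i.+1) (nth o w j)
  * (1 - mayer (nth o w j.-1) (nth o w j)).

(** The induction moves the next point from [s] to the history [p], which adds one damping factor.
    The damping at [w_j] comes from the steps [i -> i + 1] with [i <= j - 2]; the step to [w_j]
    itself enters through [1 - mayer]. *)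
Lemma Ur_prod p s : (0 < size p)%N ->
  Ur (hist p) (nth o p (size p).-1) s =
  \prod_(size p <= j < size p + size s) factor (p ++ s) j.
Proof.
elim: s p => [|x s IH] p p0 /=; first by rewrite addn0 big_geq.
rewrite big_ltn; last by rewrite -addSnnS leq_addr.
have sp : (size p).-1.+1 = size p by rewrite prednK.
have lp : ((size p).-1 < size p)%N by rewrite prednK.
have -> : factor (p ++ x :: s) (size p) = (1 - mayer (nth o p (size p).-1) x) * hist p x.
  rewrite /factor nth_cat ltnn subnn /= mulrC; congr (_ * _).
    by rewrite nth_cat lp.
  apply: eq_big_nat => i /andP[_ ip].
  have ip1 : (i.+1 < size p)%N by rewrite -sp ltnS.
  by rewrite !nth_cat ip1 (ltn_trans (ltnSn i) ip1).
congr (_ * _).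
have -> : hist p \* damp (nth o p (size p).-1) x = hist (rcons p x).
  have E : (size (rcons p x)).-1 = (size p).-1.+1 by rewrite size_rcons.
  apply/funext => y; rewrite /hist E big_nat_recr//= !nth_rcons lp sp ltnn eqxx.
  congr (_ * _).
  apply: eq_big_nat => i /andP[_ ip].
  have ip1 : (i.+1 < size p)%N by rewrite -sp ltnS.
  by rewrite !nth_rcons ip1 (ltn_trans (ltnSn i) ip1).
have := IH (rcons p x); rewrite size_rcons /= nth_rcons ltnn eqxx cat_rcons addSnnS.
exact.
Qed.

Lemma Vk_integrandE k (v : k.-tuple pt) :
  Vk_integrand phi v = (Ur (fun=> 1) o v)%:E.
Proof.
have := @Ur_prod [:: o] v isT; rewrite /= size_tuple add1n.
have -> : hist [:: o] = fun=> 1 by apply/funext => x; rewrite /hist big_geq.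
move=> ->; rewrite /Vk_integrand -prodEFin; apply: eq_bigr => j _.
rewrite /factor EFinM; congr (_ * _)%E; last by rewrite EFinB mayerE.
rewrite expeR_sumN; last by move=> i; case: ifP => // _; exact: rphi.
rewrite -prodEFin; apply: eq_bigr => i _.
rewrite /damping /below /edist [enorm (psub (nth o (o :: v) j) _)]enorm_psubC.
by case: ifP => _; [rewrite mayerE|rewrite oppe0 expeR0].
Qed.

Lemma VkE k : Vk phi k = U k (fun=> 1) o.
Proof.
rewrite U_iint// /Vk.
rewrite (_ : Vk_integrand phi (k := k) = fun v => (Ur (fun=> 1) o v)%:E); last first.
  by apply/funext => v; exact: Vk_integrandE.
apply: (@intpts_iint _ _ k _ unit (fun=> Ur (fun=> 1) o) tt).
- by move=> _ s; exact: Ur_ge0.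
- apply: (@mseq_Ur _ _ _ pphi rphi k _ unit (fun=> fun=> 1) (fun=> o)) => //.
  exact: measurable_cst.
Qed.

Lemma U_base k v : U k (fun=> 1) v = Vk phi k.
Proof.
by rewrite VkE -(psub_self v) -U_shift.
Qed.

(** As the infimum is below [e / lam], so is some [V_k^{1/k}], and the power [k] gives
    [(lam / e)^k V_k < 1]. The lower bound 1/2 keeps [sqrt theta] positive, since its logarithm and
    inverse are used later. For [lam = 0] the quotient [e / lam] is meaningless; this case gets
    [k0 = 1] and [theta = 1/2]. *)
Lemma connective_contraction (lam : R) : 0 <= lam ->
  (lam%:E < (expR 1)%:E * (connective_constant phi)^-1)%E ->
  exists k0 theta, [/\ (0 < k0)%N, 2^-1 <= theta, theta < 1 &
    (((lam * expR (-1)) ^+ k0)%:E * Vk phi k0 <= theta%:E)%E].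
Proof.
have half : 2^-1 < 1 :> R by rewrite invf_lt1// ltr1n.
have V0 k : (0 <= Vk phi k)%E.
  by rewrite VkE; apply: (@U_ge0 _ _ _ mu _ (measurable_mayer pphi rphi) (mayer01 rphi) _ (@measurable_dist R d)).
rewrite le_eqVlt => /orP[/eqP <- _|lam0 H].
  exists 1%N, 2^-1; split => //.
  by rewrite mul0r expr1 mul0e lee_fin invr_ge0.
have e0 : 0 < expR 1 :> R by exact: expR_gt0.
have el0 : 0 < expR 1 / lam by rewrite divr_gt0.
have D0 : (0 <= connective_constant phi)%E.
  by apply: le_ereal_inf_tmp => _ [k _ <-]; exact: poweR_ge0.
have : (connective_constant phi < (expR 1 / lam)%:E)%E.
  (* With extended inverses [Delta = 0] allows every [lam], while [Delta = +oo] gives the bound 0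
     and contradicts the hypothesis. *)
  move: D0 H; case: (connective_constant phi) => [r| |//]; last first.
    by move=> _; rewrite invey mule0 lte_fin ltNge ltW.
  rewrite lee_fin inver lte_fin; case: eqVneq => [-> //|r0] rge0.
  rewrite -EFinM lte_fin ltr_pdivlMr; last by rewrite lt_neqAle eq_sym r0.
  by move=> h; rewrite ltr_pdivlMr// mulrC.
move=> /ereal_inf_lt[_ [k /= k0 <-]] Hk.
have := V0 k; move: Hk; case VE : (Vk phi k) => [v| |//]; last first.
  by rewrite poweRyr// invr_eq0 pnatr_eq0 -lt0n.
rewrite poweR_EFin lte_fin lee_fin => Hv v0.
have vE : v = (v `^ k%:R^-1) ^+ k.
  by rewrite -powR_mulrn ?powR_ge0// -powRrM mulVf ?powRr1// pnatr_eq0 -lt0n.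
have c0 : 0 < lam * expR (-1) by rewrite mulr_gt0// expR_gt0.
exists k, (Num.max 2^-1 ((lam * expR (-1)) ^+ k * v)); split => //.
- by rewrite le_max lexx.
- rewrite gt_max half/= vE -exprMn exprn_ilt1 ?mulr_ge0 ?powR_ge0 ?ltW//.
    by rewrite -lt0n.
  have := Hv; rewrite ltr_pdivlMr// => Hv'.
  by rewrite expRN mulrAC ltr_pdivrMr// mul1r mulrC.
- by rewrite VE -EFinM lee_fin le_max lexx orbT.
Qed.

End connective.

(** * Strong spatial mixing *)

Section clip.
Context {dT : measure_display} {T : measurableType dT} {R : realType}.
Variable mu : {sigma_finite_measure set T -> \bar R}.
Variable f : T -> T -> R.
Hypothesis mf : measurable_fun setT (fun z : T * T => f z.1 z.2).
Hypothesis f01 : forall x y, 0 <= f x y <= 1.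
Hypothesis fC : forall x y, f x y = f y x.
Local Notation act := (nnintegrable mu).
Variables (lam : R) (L : T -> R).
Hypotheses (lam0 : 0 <= lam) (aL : act L).

(** [L \* clip] is the minimum of [L] and [lam]. The activities are bounded by [lam] only almost
    everywhere, while the contraction asks for the bound at every point; the truncation is again a
    factor in [[0, 1]]. *)
Definition clip x : R := if L x <= lam then 1 else lam / L x.

Let L0 x : 0 <= L x. Proof. by case: aL. Qed.

Lemma frac_clip : frac clip.
Proof.
have [mL _ _] := aL; split.
  rewrite (_ : clip = fun x => if L x <= lam then 1 else lam * expR (- ln (L x))).
    apply: measurable_fun_ifT => //; first exact: measurable_fun_ler.
    apply: measurable_funM => //; apply: measurableT_comp => //.
    by apply: measurableT_comp => //; exact: measurableT_comp.
  apply/funext => x; rewrite /clip; case: (leP (L x) lam) => // h.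
  by rewrite expRN lnK// posrE (le_lt_trans lam0).
move=> x; rewrite /clip; case: (leP (L x) lam) => [_|h]; first by rewrite ler01 lexx.
have Lx : 0 < L x by exact: le_lt_trans h.
by rewrite divr_ge0//= ler_pdivrMr// mul1r ltW.
Qed.

Lemma clip_le x : (L \* clip) x <= lam.
Proof.
rewrite /= /clip; case: (leP (L x) lam) => [h|h]; first by rewrite mulr1.
by rewrite mulrC divfK// gt_eqF// (le_lt_trans lam0).
Qed.

(** The truncated part has mass 0, so [Z_sub_le] with [b = 0] applies. *)
Lemma Phi_clip g : mu [set x | lam < L x] = 0%E -> obs g ->
  gibbs_mean mu f (L \* clip) g = gibbs_mean mu f L g.
Proof.
move=> null og.
have fc := frac_clip.
have a1 : act (fun x => (1 - clip x) * L x) by apply: actMl => //; exact: fracC.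
have R0 : rintegral mu (fun x => (1 - clip x) * L x) <= 0.
  rewrite -lee_fin -RI_EFin//.
  rewrite (@ge0_ae_eq_integral _ _ _ mu setT _ (cst 0%E))//.
  - by rewrite integral_cst// mul0e.
  - by apply/measurable_EFinP; case: a1.
  - by move=> x _; rewrite lee_fin; case: a1.
  - exists [set x | lam < L x]; split => //.
      have [mL _ _] := aL; rewrite -[X in measurable X]setTI.
      have := measurable_fun_ltr (measurable_cst lam) mL.
      by move=> /(_ measurableT [set true]); apply.
    move=> x /= H; apply: contrapT => /negP; rewrite -leNgt => h; apply: H => _.
    by rewrite /clip h subrr mul0r.
have eqZ h : obs h -> config_int mu f (L \* clip) h = config_int mu f L h.
  move=> oh; have := Z_sub_le mf f01 fC aL fc oh R0.
  by rewrite mul0r -eq_le eq_sym subr_eq0 eq_sym => /eqP.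
by rewrite /gibbs_mean /Zpart !eqZ//; exact: obs1.
Qed.

End clip.

Section main.
Context {R : realType}.

Lemma vol_set d (S : set (d.-tuple R)) : measurable S -> vol S = lebn d S.
Proof.
move=> mS; rewrite /vol /intd intR_lebn//.
- by rewrite integral_indic// setIT.
- by apply/measurable_EFinP; exact: measurable_indic.
Qed.

Section dim.
Variables (d : nat) (phi : d.-tuple R -> \bar R).
Local Notation pt := (d.-tuple R).
Local Notation mu := (@lebn R d).
Hypotheses (pphi : pair_potential phi) (rphi : repulsive phi).
Local Notation mayer := (mayer phi).
Let mm := measurable_mayer pphi rphi.
Let m01 := mayer01 rphi.
Let mC := mayerC pphi.
Local Notation act := (nnintegrable mu).
Local Notation Phi := (gibbs_mean mu mayer).

Lemma activity_act lam : activity lam -> act lam.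
Proof.
move=> [ml [l0 ly]]; split => //; move: ly; rewrite /intd intR_lebn//.
exact/measurable_EFinP.
Qed.

Lemma bounded_by_null lam l : activity lam -> bounded_by lam l -> mu [set x | l < lam x] = 0%E.
Proof.
move=> [ml _] <-; rewrite vol_set// -[X in measurable X]setTI.
have := measurable_fun_ltr (measurable_cst l) ml.
by move=> /(_ measurableT [set true]); apply.
Qed.

Lemma gibbs_dist lam1 lam2 (L : set pt) A : act lam1 -> act lam2 -> measurable L ->
  config_event A ->
  (`|gibbs phi lam1 (restr_event L A) - gibbs phi lam2 (restr_event L A)| =
   (`|Phi lam1 (ev (restr_event L A)) - Phi lam2 (ev (restr_event L A))|)%:E)%E.
Proof.
move=> a1 a2 mL cA; have oe := obs_ev mL cA.
by rewrite (gibbsE pphi rphi a1 oe) (gibbsE pphi rphi a2 oe).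
Qed.

Lemma tv_le lam1 lam2 (L : set pt) (c : \bar R) : act lam1 -> act lam2 -> measurable L ->
  (forall g, obs g -> local (fun x => x \in L) g -> ((`|Phi lam1 g - Phi lam2 g|)%:E <= c)%E) ->
  (tv_dist_on phi lam1 lam2 L <= c)%E.
Proof.
move=> a1 a2 mL H; apply: ge_ereal_sup => _ [A [cA _] <-].
rewrite gibbs_dist//; apply: H; first exact: obs_ev.
exact: local_ev.
Qed.

Lemma Phi_dist1 lam1 lam2 g : act lam1 -> act lam2 -> obs g -> `|Phi lam1 g - Phi lam2 g| <= 1.
Proof.
move=> a1 a2 og; have /andP[x0 x1] := Phi01 mm m01 a1 og.
have /andP[y0 y1] := Phi01 mm m01 a2 og.
by rewrite ler_norml; apply/andP; split; lra.
Qed.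

Lemma Phi_set0 lam g : act lam -> obs g -> local (fun x : pt => x \in set0) g ->
  Phi lam g = g [::].
Proof.
move=> al og lg.
apply: (@Phi_null _ _ _ mu _ mm m01 mC (fun x : pt => x \in set0)) => //.
  exact: measurable_mem_set.
rewrite /rintegral (_ : (fun x => _) = cst 0%E) ?integral0//.
by apply/funext => x; rewrite /ind in_set0 mul0r.
Qed.

(** Disposes of the conventions: for [L] empty a local observable sees only the empty configuration,
    for an empty support of the difference the activities coincide, and for infinite volume the
    right side is [+oo]. What remains is a finite distance [D] and a finite volume. *)
Lemma tv_degenerate (alpha beta : R) (lam1 lam2 : pt -> R) (L : set pt) :
  0 < alpha -> 0 < beta -> act lam1 -> act lam2 -> measurable L ->
  (forall D : R, 0 <= D -> L !=set0 -> (vol L < +oo)%E ->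
     set_dist L (supp_fn (fun x => lam1 x - lam2 x)) = D%:E ->
     (tv_dist_on phi lam1 lam2 L <= (alpha * fine (vol L) * expR (- (beta * D)))%:E)%E) ->
  (tv_dist_on phi lam1 lam2 L <=
     alpha%:E * vol L * expeR (- (beta%:E * set_dist L (supp_fn (fun x => (lam1 x - lam2 x)%R)))))%E.
Proof.
move=> al0 be0 a1 a2 mL H.
set S := supp_fn _ in H *.
have v0 : (0 <= vol L)%E by rewrite vol_set.
have rhs0 : (0 <= alpha%:E * vol L * expeR (- (beta%:E * set_dist L S)))%E.
  by apply: mule_ge0; [apply: mule_ge0 => //; rewrite lee_fin ltW|exact: expeR_ge0].
have [L0|/set0P[x0 Lx0]] := eqVneq L set0.
  apply: tv_le => // g og lg; rewrite L0 in lg.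
  by rewrite !Phi_set0// subrr normr0.
have [S0|/set0P[y0 Sy0]] := eqVneq S set0.
  have E : lam1 = lam2.
    apply/funext => x; apply/eqP; rewrite -subr_eq0; apply/negPn/negP => h.
    by have : S x by []; rewrite S0.
  by apply: tv_le => // g og lg; rewrite E subrr normr0.
have d0 : (0 <= set_dist L S)%E.
  by apply: le_ereal_inf_tmp => _ [x _ [y _ <-]]; rewrite lee_fin enorm_ge0.
have dy : (set_dist L S < +oo)%E.
  apply: (@le_lt_trans _ _ (enorm (psub x0 y0))%:E); last exact: ltry.
  by apply: ereal_inf_lbound; exists x0 => //; exists y0.
have dE : set_dist L S = (fine (set_dist L S))%:E by rewrite fineK// ge0_fin_numE.
have D0 : 0 <= fine (set_dist L S) by exact: fine_ge0.
rewrite dE -EFinM /=.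
have [vy|] := eqVneq (vol L) +oo%E.
  by rewrite vy gt0_muley ?lte_fin// gt0_mulye ?lte_fin ?expR_gt0// leey.
rewrite -ltey => vy.
have vE : vol L = (fine (vol L))%:E by rewrite fineK// ge0_fin_numE.
rewrite vE -!EFinM; apply: H => //.
by exists x0.
Qed.

End dim.

Lemma ssm_dim0 (phi : 0.-tuple R -> \bar R) (lam1 lam2 : 0.-tuple R -> R) (L : set (0.-tuple R)) :
  pair_potential phi -> repulsive phi -> nnintegrable (lebn 0) lam1 -> nnintegrable (lebn 0) lam2 -> measurable L ->
  (tv_dist_on phi lam1 lam2 L <=
     1%:E * vol L * expeR (- (1%:E * set_dist L (supp_fn (fun x => (lam1 x - lam2 x)%R)))))%E.
Proof.
move=> pphi rphi a1 a2 mL; apply: tv_degenerate => // D D0 [x Lx] vy dE.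
have LT : L = setT by apply/seteqP; split => // y _; rewrite (tuple0 y) -(tuple0 x).
have -> : fine (vol L) = 1.
  by rewrite /vol /intd /= indicE mem_set// LT.
have -> : D = 0.
  have : (D%:E <= 0)%E.
    rewrite -dE; have [S0|/set0P[y Sy]] := eqVneq (supp_fn (fun x => lam1 x - lam2 x)) set0.
      suff : set_dist L set0 = D%:E -> False by rewrite -S0 => /(_ dE).
      rewrite /set_dist (_ : [set _ | _ in _ & _ in _] = set0) ?ereal_inf0//.
      by apply/seteqP; split => // z [? _ [? []]].
    apply: ereal_inf_lbound; exists x => //; exists y => //.
    by rewrite /enorm big_ord0 sqrtr0.
  by rewrite lee_fin => D0'; apply/le_anti/andP.
rewrite mulr0 oppr0 expR0 !mulr1; apply: tv_le => // g og lg.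
by rewrite lee_fin; exact: Phi_dist1.
Qed.

End main.

Lemma ler_dist_double (R : realDomainType) (x y l : R) :
  0 <= x -> 0 <= y -> x <= l -> y <= l -> `|x - y| <= 2 * l.
Proof. by move=> x0 y0 xl yl; rewrite ler_norml; apply/andP; split; lra. Qed.

Lemma enorm_pzero (R : realType) d : enorm (pzero R d) = 0.
Proof.
rewrite /enorm big1 ?sqrtr0// => i _; rewrite (tnth_nth 0) /= nth_nseq.
by case: ifP => _; rewrite expr0n.
Qed.

(** * Exponential decay in positive dimension *)

Section positive_dim.
Context {R : realType}.
Variables (d : nat) (phi : d.+1.-tuple R -> \bar R).
Local Notation pt := (d.+1.-tuple R).
Local Notation mu := (@lebn R d.+1).
Hypotheses (pphi : pair_potential phi) (rphi : repulsive phi).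
Local Notation mayer := (mayer phi).
Let mm := measurable_mayer pphi rphi.
Let m01 := mayer01 rphi.
Let mC := mayerC pphi.
Local Notation act := (nnintegrable mu).
Local Notation Phi := (gibbs_mean mu mayer).
Local Notation rho := (insertion mu mayer).

Let Dnull (v : pt) (t : R) : mu [set x | edist v x = t] = 0%E.
Proof.
rewrite -(lebn_sphere v t); congr (lebn _ _); apply/seteqP; split => x /=;
  by rewrite /edist enorm_psubC.
Qed.

Section decay.
Variables (lam r1 theta : R) (k0 : nat).
Hypotheses (lam0 : 0 <= lam) (r10 : 0 < r1) (k00 : (0 < k0)%N)
  (range : forall v x : pt, r1 <= edist v x -> mayer v x = 1)
  (theta2 : 2^-1 <= theta) (theta1 : theta < 1)
  (Vtheta : (((lam * expR (-1)) ^+ k0)%:E * Vk phi k0 <= theta%:E)%E).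

Let theta0 : 0 < theta. Proof. by apply: lt_le_trans theta2; rewrite invr_gt0. Qed.

Let ell := k0%:R * r1.

Let ell0 : 0 < ell. Proof. by rewrite mulr_gt0// ltr0n. Qed.

(** Common factors [q] preserve both the bound [lam] and the agreement, so the decay of the ratios
    applies to the modified activities. For [n >= 1] the agreement covers [w] itself and
    [L1 w = L2 w]; for [n = 0] nothing is known at [w] and the crude bound [2 lam] is used. *)
Let close_of_agree (L1 L2 : pt -> R) (B : pt -> bool) (n : nat) :
  act L1 -> act L2 -> (forall x, L1 x <= lam) -> (forall x, L2 x <= lam) ->
  (forall w, B w -> agree (@edist R d.+1) L1 L2 w (n%:R * ell)) ->
  close mu mayer (2 * lam * Num.sqrt theta ^+ n) L1 L2 B.
Proof.
move=> a1 a2 l1 l2 ag q fq w Bw.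
have b1 := actM a1 fq; have b2 := actM a2 fq.
have /andP[p0 p1] := rho01 mm m01 w b1; have /andP[q0 q1] := rho01 mm m01 w b2.
have L10 : forall x, 0 <= L1 x by case: a1.
have L20 : forall x, 0 <= L2 x by case: a2.
case: n ag => [_|n ag].
  have u1 : L1 w * rho (L1 \* q) w <= lam by apply: le_trans (l1 w); rewrite ler_piMr.
  have u2 : L2 w * rho (L2 \* q) w <= lam by apply: le_trans (l2 w); rewrite ler_piMr.
  have v1 : 0 <= L1 w * rho (L1 \* q) w by rewrite mulr_ge0.
  have v2 : 0 <= L2 w * rho (L2 \* q) w by rewrite mulr_ge0.
  by rewrite expr0 mulr1; exact: ler_dist_double.
have E : L2 w = L1 w.
  symmetry; apply: (ag w Bw).
  by rewrite /edist psub_self enorm_pzero mulr_gt0.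
rewrite E -mulrBr normrM (ger0_norm (L10 w)).
rewrite (_ : 2 * lam * _ = lam * (2 * Num.sqrt theta ^+ n.+1)); last by ring.
apply: ler_pM => //.
have qle x : (L1 \* q) x <= lam.
  by apply: le_trans (l1 x); rewrite /= ler_piMr//; case: fq => _ /(_ x)/andP[].
have agq : agree (@edist R d.+1) (L1 \* q) (L2 \* q) w (n.+1%:R * ell).
  by move=> x Dx /=; rewrite (ag w Bw x Dx).
have Ut v : (((lam * expR (-1)) ^+ k0)%:E * tree_int mu mayer (@edist R d.+1) k0 (fun=> 1%R) v <= theta%:E)%E.
  by rewrite U_base.
exact: (@rho_dist_geometric _ _ _ mu mayer mm m01 mC (@edist R d.+1) r1 (@measurable_dist R d.+1)
  (fun x y => enorm_ge0 _) (fun x y z => enorm_triangle x y z) Dnull r10 range lam lam0 k0 theta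
  (ltW theta0) Ut n.+1 (L1 \* q) (L2 \* q) w b1 b2 qle agq).
Qed.

(** [n] is the integer part of [D / ell], so [sq ^+ n] is at most [sq] to the power [D / ell],
    divided by [sq]: hence the rate and the divisor. The factor 4 is 2 from [tv_bound] times 2 from
    [close_of_agree]; the summand 1 keeps the constant positive when [lam = 0]. *)
Lemma tv_decay (lam1 lam2 : pt -> R) (L : set pt) (g : seq pt -> R) (D : R) :
  act lam1 -> act lam2 ->
  mu [set x | lam < lam1 x] = 0%E -> mu [set x | lam < lam2 x] = 0%E ->
  measurable L -> bounded_pts L -> (vol L < +oo)%E ->
  0 <= D -> (D%:E <= set_dist L (supp_fn (fun x => (lam1 x - lam2 x)%R)))%E ->
  obs g -> local (fun x => x \in L) g ->
  `|Phi lam1 g - Phi lam2 g| <=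
    (4 * lam / Num.sqrt theta + 1) * fine (vol L) * expR (- (- ln (Num.sqrt theta) / ell * D)).
Proof.
move=> a1 a2 n1 n2 mL [rL bL] vy D0 DS og lg.
set sq := Num.sqrt theta.
have sq0 : 0 < sq by rewrite sqrtr_gt0.
have sq1 : sq < 1 by rewrite -sqrtr1 ltr_sqrt.
pose L1 := lam1 \* clip lam lam1; pose L2 := lam2 \* clip lam lam2.
have b1 : act L1 by apply: actM => //; exact: frac_clip a1.
have b2 : act L2 by apply: actM => //; exact: frac_clip a2.
rewrite -(Phi_clip mm m01 mC lam0 a1 n1 og) -(Phi_clip mm m01 mC lam0 a2 n2 og).
pose n := Num.truncn (D / ell).
have Dl0 : 0 <= D / ell by rewrite divr_ge0// ltW.
have nD : n%:R <= D / ell by rewrite truncn_le.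
have Dn : D / ell < n.+1%:R by exact: truncnS_gt.
pose Lam x := x \in L.
have ag w : Lam w -> agree (@edist R d.+1) L1 L2 w (n%:R * ell).
  move=> /set_mem Lw x Dx.
  suff E : lam1 x = lam2 x by rewrite /L1 /L2 /clip /= E.
  apply/eqP; rewrite -subr_eq0; apply/negPn/negP => Sx.
  have : (set_dist L (supp_fn (fun x => (lam1 x - lam2 x)%R)) <= (edist w x)%:E)%E.
    by apply: ereal_inf_lbound; exists w => //; exists x.
  move=> /(le_trans DS); rewrite lee_fin leNgt => /negP; apply.
  by apply: (lt_le_trans Dx); rewrite -ler_pdivlMr.
have c1 x : L1 x <= lam by exact: clip_le.
have c2 x : L2 x <= lam by exact: clip_le.
have cl := close_of_agree b1 b2 c1 c2 ag.
have mLam : measurable_fun setT Lam by exact: measurable_mem_set.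
have muL : (mu L < +oo)%E by rewrite -vol_set.
have onE : (fun x => (ind Lam x : R)%:E) = (fun x => (\1_L x)%:E).
  by apply/funext => x; rewrite /ind indicE /Lam; case: (x \in L).
have aLam : act (@ind _ _ R Lam).
  have [mo o01] : frac (@ind _ _ R Lam) by exact: frac_on.
  split => //; first by move=> x; case/andP: (o01 x).
  by rewrite onE integral_indic// setIT.
have VE : rintegral mu (@ind _ _ R Lam) = fine (vol L).
  by rewrite /rintegral onE integral_indic// setIT vol_set.
(* Lambda is sliced by spheres around the origin. The maximum covers a negative [rL], and adding 1
   makes the bound strict. *)
pose T0 := Num.max rL 0 + 1.
have T00 : 0 <= T0 by rewrite addr_ge0// le_max lexx orbT.
have LamT x : Lam x -> edist (pzero R d.+1) x < T0.
  move=> /set_mem/bL h; apply: (@le_lt_trans _ _ (Num.max rL 0)); last by rewrite ltrDl.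
  rewrite /edist -(psub_self x) (_ : psub (psub x x) x = popp x).
    by rewrite enorm_popp le_max h.
  by apply: eq_from_tnth => i; rewrite !tnth_psub tnth_mktuple subrr sub0r.
have e0 : 0 <= 2 * lam * sq ^+ n by rewrite !mulr_ge0// exprn_ge0// ltW.
have mtau : measurable_fun setT (edist (pzero R d.+1)).
  exact: (measurable_fun_sec (pzero R d.+1) (@measurable_dist R d.+1)).
apply: (le_trans (@tv_bound _ _ _ mu mayer mm m01 mC Lam (edist (pzero R d.+1)) T0 lam
  (2 * lam * sq ^+ n) mLam aLam mtau (fun x => enorm_ge0 _) T00 LamT (Dnull _) lam0 e0
  L1 L2 g b1 b2 c1 c2 og lg cl)).
rewrite VE.
have V0 : 0 <= fine (vol L) by apply: fine_ge0; rewrite vol_set.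
have E0 : 0 < expR (- (- ln sq / ell * D)) by exact: expR_gt0.
have sqn : sq ^+ n.+1 <= expR (- (- ln sq / ell * D)).
  rewrite -[X in X ^+ _](lnK (x := sq)) ?posrE// -expRM_natl ler_expR.
  have -> : - (- ln sq / ell * D) = D / ell * ln sq by ring.
  by rewrite ler_wnM2r// ?ltW// ln_lt0// sq0.
have h : sq ^+ n <= expR (- (- ln sq / ell * D)) / sq.
  by rewrite ler_pdivlMr// -exprSr.
rewrite [leLHS](_ : _ = 2 * (2 * lam * sq ^+ n) * fine (vol L)); last by ring.
rewrite [leRHS]mulrAC; apply: ler_wpM2r => //.
rewrite [leRHS]mulrDl mul1r; apply: (@le_trans _ _ (4 * lam / sq * expR (- (- ln sq / ell * D)))).
  rewrite [leRHS](_ : _ = 2 * (2 * lam * (expR (- (- ln sq / ell * D)) / sq))); last by ring.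
  by apply: ler_wpM2l => //; apply: ler_wpM2l => //; rewrite mulr_ge0.
by rewrite lerDl ltW.
Qed.

End decay.
End positive_dim.

Theorem theorem2 (R : realType) (d : nat) (phi : d.-tuple R -> \bar R) (lam : R) :
  pair_potential phi -> repulsive phi -> finite_range phi ->
  0 <= lam ->
  (lam%:E < (expR 1)%:E * (connective_constant phi)^-1)%E ->
  exists alpha beta : R, 0 < alpha /\ 0 < beta /\
    forall (L : set (d.-tuple R)) (lam1 lam2 : d.-tuple R -> R),
      measurable L -> bounded_pts L ->
      activity lam1 -> bounded_support lam1 -> bounded_by lam1 lam ->
      activity lam2 -> bounded_support lam2 -> bounded_by lam2 lam ->
      (tv_dist_on phi lam1 lam2 L <=
         alpha%:E * vol L * expeR (- (beta%:E * set_dist L (supp_fn (fun x => (lam1 x - lam2 x)%R)))))%E.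
Proof.
case: d phi => [|d] phi pphi rphi [r [r0 hr]] lam0 lamD.
  exists 1, 1; do 2 split => //; move=> L lam1 lam2 mL _ a1 _ _ a2 _ _.
  by apply: ssm_dim0 => //; exact: activity_act.
have [k0 [theta [k00 th2 th1 Vth]]] := connective_contraction pphi rphi lam0 lamD.
have th0 : 0 < theta by apply: lt_le_trans th2; rewrite invr_gt0.
have sq0 : 0 < Num.sqrt theta by rewrite sqrtr_gt0.
have sq1 : Num.sqrt theta < 1 by rewrite -sqrtr1 ltr_sqrt.
(* [r + 1] is positive even for [r = 0], and being at distance at least [r + 1] implies the strict
   inequality of [finite_range]. *)
have r10 : 0 < r + 1 by rewrite ltr_wpDl.
have range (v x : d.+1.-tuple R) : r + 1 <= edist v x -> mayer phi v x = 1.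
  move=> h; rewrite /mayer hr ?oppe0 ?expeR0//.
  by rewrite enorm_psubC; apply: lt_le_trans h; rewrite ltrDl.
pose al := 4 * lam / Num.sqrt theta + 1.
pose be := - ln (Num.sqrt theta) / (k0%:R * (r + 1)).
have al0 : 0 < al by rewrite ltr_wpDl// divr_ge0 ?mulr_ge0// ltW.
have be0 : 0 < be.
  by apply: divr_gt0; [rewrite oppr_gt0 ln_lt0// sq0|rewrite mulr_gt0// ltr0n].
exists al, be; do 2 split => //.
move=> L lam1 lam2 mL bL act1 _ bd1 act2 _ bd2.
have a1 := activity_act act1; have a2 := activity_act act2.
apply: tv_degenerate => // D D0 _ vy dE.
apply: tv_le => // g og lg; rewrite lee_fin.
apply: tv_decay => //; last by rewrite dE.
- exact: bounded_by_null.
- exact: bounded_by_null.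
Qed.
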